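(* Let $g_o:\mathbb{S}\to\mathbb{S}$ be an orientation-preserving homeomorphism of finite conformal energy, $\mathcal E(g_o)<\infty$, which does not represent the boundary values of a Möbius transformation of the unit disk. Then there is a family of homeomorphisms $\{g^t:\mathbb{S}\to\mathbb{S}: t\in[0,1)\}$ such that: 1. $g^t\to g_o$ uniformly on $\mathbb{S}$ as $t\to1$; 2. $\mathcal E(g^t)<\mathcal E(g_o)$ for all $t\in[0,1)$, and $\mathcal E(g^t)\to\mathcal E(g_o)$ as $t\to1$; 3. as $t\to0$, $g^t$ converges uniformly on $\mathbb{S}$ to the boundary values of a Möbius transformation of the unit disk.
   Context: $\mathbb{S}$ is the unit circle, the boundary of the unit disk $\mathbb{D}\subset\mathbb{C}$. For a homeomorphism $g:\mathbb{S}\to\mathbb{S}$, its conformal energy is $$\mathcal E(g)=-\frac{1}{2\pi^2}\iint_{\mathbb{S}\times\mathbb{S}}\log|g(\zeta)-g(\xi)|\,d\zeta\,d\bar\xi ,$$ that is, with $\zeta=e^{it}$, $\xi=e^{is}$ (the imaginary part vanishes by symmetry), $$\mathcal E(g)=-\frac{1}{2\pi^2}\int_0^{2\pi}\int_0^{2\pi}\log|g(e^{it})-g(e^{is})|\cos(t-s)\,dt\,ds\in(-\infty,\infty].$$ A Möbius transformation of the unit disk is a map $w\mapsto\zeta\frac{w-a}{1-\bar a w}$ with $|a|<1$, $|\zeta|=1$. *)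

(* Defs.v *)
From HB Require Import structures.
From mathcomp Require Import all_boot all_order all_algebra.
From mathcomp Require Import complex.
From mathcomp Require Import all_classical all_reals all_analysis.

Set Implicit Arguments.
Unset Strict Implicit.
Unset Printing Implicit Defensive.

Import Order.TTheory GRing.Theory Num.Theory numFieldNormedType.Exports.
Local Open Scope classical_set_scope.
Local Open Scope complex_scope.
Local Open Scope ring_scope.

(* The topology of a numFieldType is not inferred on [R[i]] itself, only on
   its alias [R[i]^o]. *)
#[export, non_forgetful_inheritance]
HB.instance Definition _ (R : rcfType) := PseudoPointedMetric.copy R[i] R[i]^o.

Definition circle (R : realType) : set R[i] := [set z | `|z| = 1].

Definition expi (R : realType) (t : R) : R[i] := cos t +i* sin t.

(* Self-maps of the circle are represented by functions on the plane, of which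
   only the values on the circle are ever used. *)
Definition circle_homeo (R : realType) (g : R[i] -> R[i]) : Prop :=
  exists h : R[i] -> R[i],
    [/\ set_fun (@circle R) (@circle R) g /\ {within @circle R, continuous g},
        set_fun (@circle R) (@circle R) h /\ {within @circle R, continuous h},
        forall z, circle z -> h (g z) = z
      & forall z, circle z -> g (h z) = z].

(* [g] lifts to an increasing continuous map of the universal cover [expi]. *)
Definition orientation_preserving (R : realType) (g : R[i] -> R[i]) : Prop :=
  exists phi : R -> R,
    [/\ continuous phi,
        {homo phi : x y / x < y}
      & forall t, g (expi t) = expi (phi t)].

Local Open Scope ereal_scope.
(* With zeta = e^{it} and xi = e^{is}, the form d zeta d xibar is
   e^{i(t-s)} dt ds, whose imaginary part integrates to 0 by symmetry in
   (s, t).  On the diagonal, which is negligible, the integrand is 0 because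
   [ln 0 = 0].  For a homeomorphism the integrand is bounded above, so that
   the integral lies in [-oo, +oo[ and the energy in ]-oo, +oo]. *)
Definition conformal_energy (R : realType) (g : R[i] -> R[i]) : \bar R :=
  (- (2 * pi ^+ 2)^-1)%R%:E *
  \int[lebesgue_measure \x lebesgue_measure]_(p in
      `[0%R, (2 * pi)%R]%classic `*` `[0%R, (2 * pi)%R]%classic)
    (ln (ComplexField.Normc.normc (g (expi p.1) - g (expi p.2)))
     * cos (p.1 - p.2))%R%:E.
Local Close Scope ereal_scope.

Definition mobius (R : realType) (zeta a w : R[i]) : R[i] :=
  zeta * ((w - a) / (1 - a^* * w)).

(* [b] has, on the circle, the values of a Moebius transformation of the unit
   disk. *)
Definition mobius_boundary (R : realType) (b : R[i] -> R[i]) : Prop :=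
  exists zeta a : R[i],
    [/\ `|zeta| = 1, `|a| < 1 & forall w, circle w -> b w = mobius zeta a w].

(* Main.v *)
(* Write g (e^(it)) = e^(i phi t).  Expanding the logarithm, with an Abel
   regularization, gives 4 pi^2 E(g) = \sum_k (|A_k|^2 + |B_k|^2) / k, where A_k and
   B_k are the integrals over a period of e^(i (k phi t + t)) and e^(i (k phi t - t)).
   The difference \sum_k (|B_k|^2 - |A_k|^2) / k comes from the kernel
   \sum_k sin (k u) / k, which is affine on ]0, 2 pi[, and so does not depend on g.
   Hence E(g) - E(id) = (2 pi^2)^-1 \sum_k |A_k|^2 / k.

   If all A_k vanish, the boundary values h of g^-1 have no Fourier coefficient of
   negative index, so h^n has mean a^n where a is the mean of h.  These means
   determine the Fourier coefficients of phi t - t, and g is a Moebius map.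

   Otherwise E(id) < E(go), and some B_k is nonzero as well.  Let a and b be the least
   indices with A_a <> 0 and B_b <> 0.  Moving go along the vector field
   Im (c e^(i (a + b) x)) with c the conjugate of A_a B_b decreases the energy at first
   order by a multiple of |A_a B_b|^2.  The family is the identity for t < 1/2 and this
   small deformation of go, of size proportional to 1 - t, afterwards. *)
Require Import Defs.
From mathcomp Require Import all_boot all_order all_algebra.
From mathcomp Require Import complex.
From mathcomp Require Import all_classical all_reals all_analysis.
From mathcomp Require Import measurable_realfun.
From mathcomp Require Import ring lra zify.
Import Order.TTheory GRing.Theory Num.Theory numFieldNormedType.Exports.
Local Open Scope classical_set_scope.
Local Open Scope complex_scope.
Local Open Scope ring_scope.

Set Implicit Arguments.
Unset Strict Implicit.
Unset Printing Implicit Defensive.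

(** * Integrals over a period and over its square *)

(** The descent direction works because of the bilinear shape of the first variation: along Im (c
    e^(inx)) it is, up to sign, a positive combination of the numbers Re (c A_j B_k) with j + k = n.
    For n = a + b every pair other than (a, b) has j < a or k < b, so that minimality of both
    indices leaves the single product A_a B_b, and c is chosen to make it positive.

    The obstacle is the lack of regularity: [go] is only continuous, and finite energy gives no more
    than integrability of a logarithmic singularity. The series are therefore used only at radius r
    < 1, with errors uniform on the square, and the limit r -> 1 is taken by domination or by
    Fatou's lemma. The variation is estimated pointwise: the difference of the two singular
    integrands is bounded, because the displacement w satisfies w^2 = O (tau^2 (1 - cos u)). In the
    rigidity part Fejer kernels replace the theory of Hardy spaces.

    The conditions on the family are limits at its two ends and a strict inequality in between, so
    its two pieces may be joined by a jump at 1/2. *)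

Section BoundedMeasurable.
Context d (X : measurableType d) (R : realType).
Implicit Types (D : set X) (f g : X -> R).

(** A class closed under products, unlike integrability, and integrable on every set of finite
    measure. *)
Definition bmeas D f := measurable_fun D f /\ exists M, forall x, D x -> `|f x| <= M.

Lemma bmeas_cst D (c : R) : bmeas D (cst c).
Proof. by split; [exact: measurable_cst|exists `|c|]. Qed.

Lemma bmeasD D f g : bmeas D f -> bmeas D g -> bmeas D (fun x => f x + g x).
Proof.
move=> [mf [M fM]] [mg [N gN]]; split; first exact: measurable_funD.
exists (M + N) => x Dx; rewrite (le_trans (ler_normD _ _))// lerD//; [exact: fM|exact: gN].
Qed.

Lemma bmeasN D f : bmeas D f -> bmeas D (fun x => - f x).
Proof.
move=> [mf [M fM]]; split; first exact: measurableT_comp.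
by exists M => x Dx; rewrite normrN fM.
Qed.

Lemma bmeasB D f g : bmeas D f -> bmeas D g -> bmeas D (fun x => f x - g x).
Proof. by move=> bf bg; apply: bmeasD => //; exact: bmeasN. Qed.

Lemma bmeasM D f g : bmeas D f -> bmeas D g -> bmeas D (fun x => f x * g x).
Proof.
move=> [mf [M fM]] [mg [N gN]]; split; first exact: measurable_funM.
by exists (M * N) => x Dx; rewrite normrM ler_pM// ?fM ?gN.
Qed.

Lemma bmeas_sum D (I : Type) (s : seq I) (f : I -> X -> R) :
  (forall i, bmeas D (f i)) -> bmeas D (fun x => \sum_(i <- s) f i x).
Proof.
move=> bf; elim: s => [|i s ih].
  by under eq_fun do rewrite big_nil; exact: bmeas_cst.
by under eq_fun do rewrite big_cons; exact: bmeasD.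
Qed.

Lemma bmeas_cos D f : measurable_fun D f -> bmeas D (fun x => cos (f x)).
Proof.
move=> mf; split; last by exists 1 => x _; exact: cos_max.
by apply: measurableT_comp => //; apply: continuous_measurable_fun; exact: continuous_cos.
Qed.

Lemma bmeas_sin D f : measurable_fun D f -> bmeas D (fun x => sin (f x)).
Proof.
move=> mf; split; last by exists 1 => x _; exact: sin_max.
by apply: measurableT_comp => //; apply: continuous_measurable_fun; exact: continuous_sin.
Qed.

Lemma bmeas_integrable (mu : {measure set X -> \bar R}) D f : measurable D ->
  (mu D < +oo)%E -> bmeas D f -> mu.-integrable D (EFin \o f).
Proof.
move=> mD Dfin [mf [M fM]]; apply: measurable_bounded_integrable => //.
exists M; split; first exact: num_real.
move=> N MN x Dx; have := fM _ Dx; move: (ltW MN) => MN1 h; exact: le_trans h MN1.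
Qed.

Lemma integrableD_EFin (mu : {measure set X -> \bar R}) D f g : measurable D ->
  mu.-integrable D (EFin \o f) -> mu.-integrable D (EFin \o g) ->
  mu.-integrable D (EFin \o (fun x => f x + g x)).
Proof. by move=> mD fi gi; exact: (integrableD mD fi gi). Qed.

Lemma integrableN_EFin (mu : {measure set X -> \bar R}) D f : measurable D ->
  mu.-integrable D (EFin \o f) -> mu.-integrable D (EFin \o (fun x => - f x)).
Proof.
move=> mD fi; have := integrableN fi.
by apply: eq_integrable => // x _ /=; rewrite EFinN.
Qed.

Lemma integrable_setDnull (mu : {measure set X -> \bar R}) D (N : set X) f :
  measurable N -> measurable D -> measurable_fun D f -> mu N = 0%E ->
  mu.-integrable (D `\` N) (EFin \o f) -> mu.-integrable D (EFin \o f).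
Proof.
move=> mN mD mf N0; apply: (negligible_integrable mN mD _ N0).2.
exact/measurable_EFinP.
Qed.

(** The exceptional null set [N] is explicit because all limits below are checked off the same set
    [exc_set]. *)
Lemma Rdominated_convergence (mu : {measure set X -> \bar R}) D (N : set X)
    (f_ : nat -> X -> R) f g : measurable D ->
  measurable N -> mu N = 0%E ->
  (forall n, measurable_fun D (f_ n)) -> measurable_fun D f ->
  (forall x, D x -> ~ N x -> f_ n x @[n --> \oo] --> f x) ->
  mu.-integrable D (EFin \o g) ->
  (forall n x, D x -> ~ N x -> `|f_ n x| <= g x) ->
  mu.-integrable D (EFin \o f) /\
  (\int[mu]_(x in D) f_ n x) @[n --> \oo] --> \int[mu]_(x in D) f x.
Proof.
move=> mD mN N0 mf_ mf f_f ig f_g.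
have neN (P : X -> Prop) : (forall x, ~ N x -> P x) -> {ae mu, forall x, P x}.
  move=> NP; exists N; split => // x /= nPx; apply: contrapT => nNx; exact/nPx/NP.
have [] := @dominated_convergence _ _ _ mu D mD (fun n => EFin \o f_ n) (EFin \o f) (EFin \o g).
- by move=> n; exact/measurable_EFinP.
- exact/measurable_EFinP.
- by apply: neN => x Nx Dx; apply: cvg_EFin; [exact: nearW|exact: f_f].
- exact: ig.
- by apply: neN => x Nx n Dx /=; rewrite lee_fin f_g.
move=> intf _ H; split => //.
have : fine (\int[mu]_(x in D) (f_ n x)%:E)%E @[n --> \oo] --> fine (\int[mu]_(x in D) (f x)%:E)%E.
  by apply: fine_cvg; rewrite fineK//; exact: integrable_fin_num.
by [].
Qed.

End BoundedMeasurable.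

Section Product.
Context (R : realType).
Notation mu := (@lebesgue_measure R).
Notation mu2 := (mu \x mu)%E.
Implicit Types (u v f g a b : R -> R) (F : R * R -> R).

Definition circ : set R := `[0, 2 * pi]%classic.
Definition circ2 : set (R * R) := circ `*` circ.

Lemma measurable_circ : measurable circ.
Proof. exact: measurable_itv. Qed.

Lemma measurable_circ2 : measurable circ2.
Proof. by apply: measurableX; exact: measurable_circ. Qed.

Lemma lebesgue_circ : mu circ = (2 * pi)%:E.
Proof.
rewrite /circ lebesgue_measure_itv/= lte_fin.
by rewrite mulr_gt0 ?pi_gt0// -EFinB subr0.
Qed.

Lemma lebesgue_circ2 : mu2 circ2 = ((2 * pi) ^+ 2)%:E.
Proof.
transitivity (mu circ * mu circ)%E; last by rewrite lebesgue_circ -EFinM expr2.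
by apply: product_measure1E; exact: measurable_circ.
Qed.

Lemma circ_fin : (mu circ < +oo)%E.
Proof. by rewrite lebesgue_circ ltry. Qed.

Lemma circ2_fin : (mu2 circ2 < +oo)%E.
Proof. by rewrite lebesgue_circ2 ltry. Qed.

Lemma bmeas_circ_int f : bmeas circ f -> mu.-integrable circ (EFin \o f).
Proof. by move=> bf; exact: (@bmeas_integrable _ _ R mu _ _ measurable_circ circ_fin bf). Qed.

Lemma bmeas_circ2_int (f : R * R -> R) : bmeas circ2 f -> mu2.-integrable circ2 (EFin \o f).
Proof. by move=> bf; exact: (@bmeas_integrable _ _ R mu2 _ _ measurable_circ2 circ2_fin bf). Qed.

Definition I1 (f : R -> R) : R := \int[mu]_(x in circ) f x.
Definition I2 (f : R * R -> R) : R := \int[mu2]_(x in circ2) f x.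

Lemma bmeas_fst u : bmeas circ u -> bmeas circ2 (fun p : R * R => u p.1).
Proof.
move=> [mu_ [M uM]]; split; last by exists M => -[x y] [/= Ix _]; exact: uM.
apply: (measurable_comp measurable_circ _ mu_) => //.
  by move=> _ [[x y] [/= Ix _] <-].
apply: (measurable_funS measurableT) => //; exact: measurable_fst.
Qed.

Lemma bmeas_snd u : bmeas circ u -> bmeas circ2 (fun p : R * R => u p.2).
Proof.
move=> [mu_ [M uM]]; split; last by exists M => -[x y] [/= _ Iy]; exact: uM.
apply: (measurable_comp measurable_circ _ mu_) => //.
  by move=> _ [[x y] [/= _ Iy] <-].
apply: (measurable_funS measurableT) => //; exact: measurable_snd.
Qed.

(** Fubini's theorem for the extension [G] of [F] by 0 to the whole plane. *)
Lemma I2_iter F : bmeas circ2 F -> I2 F = I1 (fun x => I1 (fun y => F (x, y))).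
Proof.
move=> bF; have [mF [M FM]] := bF.
pose G := F \_ circ2.
have mG : measurable_fun setT G.
  by apply/(measurable_restrictT _ measurable_circ2).
have GM p : `|G p| <= `|M|.
  rewrite /G patchE; case: ifPn => [/set_mem /FM h|_]; last by rewrite normr0.
  by rewrite (le_trans h)// ler_norm.
have GE x y : circ x -> circ y -> G (x, y) = F (x, y).
  by move=> Ix Iy; rewrite /G patchE mem_set.
have G0 x y : ~ (circ x /\ circ y) -> G (x, y) = 0.
  by move=> h; rewrite /G patchE memNset.
have iG : mu2.-integrable setT (EFin \o G).
  have := bmeas_circ2_int bF.
  move/(@integrable_mkcond _ _ R mu2 circ2 (EFin \o F) measurable_circ2).
  by apply: eq_integrable => // p _; rewrite /G/= !patchE; case: ifP.
transitivity (\int[mu2]_p G p); first by rewrite /I2 Rintegral_mkcond.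
rewrite {1}/Rintegral.
have -> : (fun p => (G p)%:E) = EFin \o G by [].
rewrite -(integral12_prod_meas1 iG).
rewrite /I1 [RHS]Rintegral_mkcond /Rintegral; congr fine.
apply: eq_integral => x _; rewrite /fubini_F patchE.
case: ifPn => [/set_mem Ix|/negP nIx]; last first.
  rewrite integral0_eq// => y _ /=; rewrite G0// => -[Ix _].
  by apply: nIx; exact: mem_set.
have -> : (\int[mu]_y (EFin \o G) (x, y) = \int[mu]_(y in circ) (F (x, y))%:E)%E.
  rewrite [RHS]integral_mkcond; apply: eq_integral => y _; rewrite patchE /=.
  by case: ifPn => [/set_mem Iy|/negP nIy]; [rewrite GE|rewrite G0// => -[_ Iy]; apply: nIy; exact: mem_set].
rewrite fineK//.
have bFx : bmeas circ (fun y => F (x, y)).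
  split; last by exists M => y Iy; apply: FM.
  apply: (eq_measurable_fun (fun y => G (x, y))).
    by move=> y /set_mem Iy; rewrite GE.
  apply: measurable_funTS.
  exact: (measurable_fun_pair2 x mG).
apply: integrable_fin_num; first exact: measurable_circ.
exact: bmeas_circ_int bFx.
Qed.

Lemma I2_sep u v : bmeas circ u -> bmeas circ v -> I2 (fun p => u p.1 * v p.2) = I1 u * I1 v.
Proof.
move=> bu bv; rewrite I2_iter; last by apply: bmeasM; [exact: bmeas_fst|exact: bmeas_snd].
rewrite /= /I1 -RintegralZr; [|exact: measurable_circ|exact: bmeas_circ_int].
apply: eq_Rintegral => x _; rewrite RintegralZl//; [exact: measurable_circ|exact: bmeas_circ_int].
Qed.

Lemma I1D f g : bmeas circ f -> bmeas circ g -> I1 (fun x => f x + g x) = I1 f + I1 g.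
Proof. by move=> bf bg; rewrite /I1 RintegralD; [by []|exact: measurable_circ|exact: bmeas_circ_int|exact: bmeas_circ_int]. Qed.
Lemma I1B f g : bmeas circ f -> bmeas circ g -> I1 (fun x => f x - g x) = I1 f - I1 g.
Proof. by move=> bf bg; rewrite /I1 RintegralB; [by []|exact: measurable_circ|exact: bmeas_circ_int|exact: bmeas_circ_int]. Qed.
Lemma I1Z c f : bmeas circ f -> I1 (fun x => c * f x) = c * I1 f.
Proof. by move=> bf; rewrite /I1 RintegralZl; [by []|exact: measurable_circ|exact: bmeas_circ_int]. Qed.
Lemma I1c c : I1 (fun=> c) = 2 * pi * c.
Proof.
rewrite /I1 Rintegral_cst; last exact: measurable_circ.
by rewrite [X in fine X]lebesgue_circ/= mulrC.
Qed.
Lemma I1_le f g : bmeas circ f -> bmeas circ g -> (forall x, circ x -> f x <= g x) -> I1 f <= I1 g.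
Proof. by move=> bf bg h; rewrite /I1 le_Rintegral//; [exact: measurable_circ|exact: bmeas_circ_int|exact: bmeas_circ_int]. Qed.
Lemma eq_I1 f g : (forall x, circ x -> f x = g x) -> I1 f = I1 g.
Proof. by move=> fg; apply: eq_Rintegral => x /set_mem; exact: fg. Qed.

Lemma I2D (f g : R * R -> R) : bmeas circ2 f -> bmeas circ2 g -> I2 (fun x => f x + g x) = I2 f + I2 g.
Proof. by move=> bf bg; rewrite /I2 RintegralD; [by []|exact: measurable_circ2|exact: bmeas_circ2_int|exact: bmeas_circ2_int]. Qed.
Lemma I2B (f g : R * R -> R) : bmeas circ2 f -> bmeas circ2 g -> I2 (fun x => f x - g x) = I2 f - I2 g.
Proof. by move=> bf bg; rewrite /I2 RintegralB; [by []|exact: measurable_circ2|exact: bmeas_circ2_int|exact: bmeas_circ2_int]. Qed.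
Lemma I2Z c F : bmeas circ2 F -> I2 (fun x => c * F x) = c * I2 F.
Proof. by move=> bf; rewrite /I2 RintegralZl; [by []|exact: measurable_circ2|exact: bmeas_circ2_int]. Qed.
Lemma I2c c : I2 (fun=> c) = (2 * pi) ^+ 2 * c.
Proof.
rewrite /I2 Rintegral_cst; last exact: measurable_circ2.
by rewrite [X in fine X]lebesgue_circ2/= mulrC.
Qed.
Lemma I2_le (f g : R * R -> R) : bmeas circ2 f -> bmeas circ2 g -> (forall x, circ2 x -> f x <= g x) -> I2 f <= I2 g.
Proof. by move=> bf bg h; rewrite /I2 le_Rintegral//; [exact: measurable_circ2|exact: bmeas_circ2_int|exact: bmeas_circ2_int]. Qed.
Lemma eq_I2 (f g : R * R -> R) : (forall x, circ2 x -> f x = g x) -> I2 f = I2 g.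
Proof. by move=> fg; apply: eq_Rintegral => x /set_mem; exact: fg. Qed.
Lemma I2_sum n (f : nat -> R * R -> R) : (forall i, bmeas circ2 (f i)) ->
  I2 (fun x => \sum_(i < n) f i x) = \sum_(i < n) I2 (f i).
Proof.
move=> bf; elim: n => [|n ih].
  by rewrite big_ord0; under eq_I2 do rewrite big_ord0; rewrite I2c mulr0.
rewrite big_ord_recr/= -ih -I2D//; last exact: bmeas_sum.
by apply: eq_I2 => x _; rewrite big_ord_recr.
Qed.
Lemma norm_I2_le (f g : R * R -> R) : bmeas circ2 f -> bmeas circ2 g -> (forall x, circ2 x -> `|f x| <= g x) ->
  `|I2 f| <= I2 g.
Proof.
move=> bf bg fg; rewrite ler_norml; apply/andP; split.
  rewrite -(mulN1r (I2 g)) -I2Z//; apply: I2_le => //; first by apply: bmeasM => //; exact: bmeas_cst.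
  by move=> x sx; rewrite mulN1r; have := fg _ sx; rewrite ler_norml => /andP[].
by apply: I2_le => // x sx; rewrite (le_trans (ler_norm _))// fg.
Qed.

Lemma EFin_I2 F : mu2.-integrable circ2 (EFin \o F) -> (\int[mu2]_(p in circ2) (F p)%:E)%E = (I2 F)%:E.
Proof.
move=> iF; rewrite /I2 /Rintegral fineK//.
by apply: integrable_fin_num; [exact: measurable_circ2|exact: iF].
Qed.

Lemma bmeas_continuous (f : R -> R) : continuous f -> bmeas circ f.
Proof.
move=> cf; split; first by apply: measurable_funTS; exact: continuous_measurable_fun.
have [M [_ HM]] : bounded_set (f @` circ).
  apply: compact_bounded; apply: continuous_compact; last exact: segment_compact.
  exact: continuous_subspaceT.
exists (M + 1) => x Ix; apply: (HM (M + 1)); first by rewrite ltrDl.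
by exists x.
Qed.

Definition Ic a := I1 (fun x => cos (a x)).
Definition Is a := I1 (fun x => sin (a x)).

(** Real part of the product of the integrals of e^(i a) and e^(i b); [I2_sin] is the imaginary
    part. *)
Lemma I2_cos a b : measurable_fun circ a -> measurable_fun circ b ->
  I2 (fun p => cos (a p.1 + b p.2)) = Ic a * Ic b - Is a * Is b.
Proof.
move=> ma mb.
have [ca sa cb sb] : [/\ bmeas circ (cos \o a), bmeas circ (sin \o a), bmeas circ (cos \o b) & bmeas circ (sin \o b)].
  by split; do ?[exact: bmeas_cos|exact: bmeas_sin].
rewrite /Ic /Is -(I2_sep ca cb) -(I2_sep sa sb) -I2B.
- by apply: eq_I2 => p _; rewrite cosD.
- by apply: bmeasM; [exact: (bmeas_fst ca)|exact: (bmeas_snd cb)].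
- by apply: bmeasM; [exact: (bmeas_fst sa)|exact: (bmeas_snd sb)].
Qed.

Lemma I2_sin a b : measurable_fun circ a -> measurable_fun circ b ->
  I2 (fun p => sin (a p.1 + b p.2)) = Is a * Ic b + Ic a * Is b.
Proof.
move=> ma mb.
have [ca sa cb sb] : [/\ bmeas circ (cos \o a), bmeas circ (sin \o a), bmeas circ (cos \o b) & bmeas circ (sin \o b)].
  by split; do ?[exact: bmeas_cos|exact: bmeas_sin].
rewrite /Ic /Is -(I2_sep sa cb) -(I2_sep ca sb) -I2D.
- by apply: eq_I2 => p _; rewrite sinD.
- by apply: bmeasM; [exact: (bmeas_fst sa)|exact: (bmeas_snd cb)].
- by apply: bmeasM; [exact: (bmeas_fst ca)|exact: (bmeas_snd sb)].
Qed.

End Product.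
Arguments circ {R}.
Arguments circ2 {R}.
Arguments measurable_circ {R}.
Arguments measurable_circ2 {R}.

(** * The kernels *)

Section Kernels.
Context (R : realType).
Implicit Types (r u : R) (N : nat).

(* [poisson_den r u] is [|1 - r e^(iu)|^2]; [log_kernel] and [arg_kernel] are the real and the imaginary
   part of [- log (1 - r e^(iu)) = \sum_k r^k e^(iku) / k]. *)
Definition poisson_den r u := 1 - 2 * r * cos u + r ^+ 2.
Definition log_kernel r u := - (ln (poisson_den r u) / 2).
Definition arg_kernel r u := atan (r * sin u / (1 - r * cos u)).

Lemma sqr_cos_sin u : sin u ^+ 2 = 1 - cos u ^+ 2.
Proof. by rewrite -(cos2Dsin2 u) addrC addKr. Qed.

Lemma poisson_den_ge r u : 0 <= r -> (1 - r) ^+ 2 <= poisson_den r u.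
Proof. move=> r0; have := cos_le1 u; rewrite /poisson_den; nra. Qed.

Lemma poisson_den_gt0 r u : 0 <= r < 1 -> 0 < poisson_den r u.
Proof.
move=> /andP[r0 r1]; apply: lt_le_trans (poisson_den_ge u r0).
by rewrite exprn_gt0// subr_gt0.
Qed.

Lemma poisson_den_le4 r u : 0 <= r <= 1 -> poisson_den r u <= 4.
Proof. move=> /andP[r0 r1]; have := cos_geN1 u; rewrite /poisson_den => c1; have : 0 <= r * (1 + cos u) by rewrite mulr_ge0//; lra.
have : r ^+ 2 <= 1 by rewrite expr_le1.
lra. Qed.

Lemma poisson_den1E u : poisson_den 1 u = 2 * (1 - cos u).
Proof. by rewrite /poisson_den; ring. Qed.

(** The difference is (1 - r)^2. All bounds that are uniform as r -> 1 rest on this comparison with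
    r = 1. *)
Lemma poisson_den_ge1 r u : 0 <= r -> r * poisson_den 1 u <= poisson_den r u.
Proof. move=> r0; rewrite poisson_den1E /poisson_den; have := sqr_ge0 (1 - r); nra. Qed.

Lemma rcos_lt1 r u : 0 <= r < 1 -> 0 < 1 - r * cos u.
Proof. move=> /andP[r0 r1]; have := cos_le1 u; nra. Qed.

Lemma is_derive_log_kernel r u : 0 <= r < 1 -> is_derive r 1 (log_kernel ^~ u) ((cos u - r) / poisson_den r u).
Proof.
move=> r01; have q0 := poisson_den_gt0 u r01.
have dq : is_derive r 1 (poisson_den ^~ u) (- 2 * cos u + 2 * r).
  rewrite /poisson_den; apply: is_derive_eq.
  by rewrite /GRing.scale/=; ring.
have := @is_derive1_comp R (@ln R) (poisson_den ^~ u) r _ _ (is_derive1_ln q0) dq.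
move=> dl; have -> : log_kernel ^~ u = (- 2^-1) \*: (@ln R \o poisson_den ^~ u).
  by apply/funext => x; rewrite /log_kernel/= /GRing.scale/=; field.
apply: is_derive_eq; rewrite /GRing.scale/=; field.
by rewrite gt_eqF.
Qed.

Lemma is_derive_arg_kernel r u : 0 <= r < 1 -> is_derive r 1 (arg_kernel ^~ u) (sin u / poisson_den r u).
Proof.
move=> r01; have q0 := poisson_den_gt0 u r01; have c0 := rcos_lt1 u r01.
have c1 : 1 - r * cos u != 0 by rewrite gt_eqF.
have dq : is_derive r 1 (fun x : R => x * sin u * (1 - x * cos u)^-1) (sin u / (1 - r * cos u) ^+ 2).
  have d1 : is_derive r 1 (fun x : R => 1 - x * cos u) (- cos u).
    by apply: is_derive_eq; rewrite /GRing.scale/=; ring.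
  have d2 := @is_deriveV R (fun x : R => 1 - x * cos u) r (- cos u) 1 c1 d1.
  apply: is_derive_eq; rewrite /GRing.scale/=; field.
  exact: c1.
have := @is_derive1_comp R (@atan R) (fun x : R => x * sin u * (1 - x * cos u)^-1) r _ _ (is_derive1_atan _) dq.
move=> h; apply: (is_derive_eq h).
have qE : poisson_den r u = (1 - r * cos u) ^+ 2 + (r * sin u) ^+ 2.
  by rewrite exprMn sqr_cos_sin /poisson_den; ring.
rewrite qE in q0 *; field.
by rewrite c1/= gt_eqF// addrC.
Qed.

(** Real part of the geometric sum \sum_(k<N) r^k z^(k+1), z = e^(iu), multiplied by |1 - r z|^2;
    [sum_rsin] is the imaginary part. *)
Lemma sum_rcos N r u : 
  poisson_den r u * (\sum_(k < N) r ^+ k * cos (u *+ k.+1)) =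
  cos u - r - r ^+ N * (cos (u *+ N.+1) - r * cos (u *+ N)).
Proof.
elim: N => [|N ih].
  by rewrite big_ord0 mulr0 expr0 mulr1n mulr0n cos0; ring.
rewrite big_ord_recr/= mulrDr ih exprS.
have -> : cos (u *+ N.+2) = 2 * cos u * cos (u *+ N.+1) - cos (u *+ N).
  rewrite (_ : u *+ N.+2 = u *+ N.+1 + u); last by rewrite mulrSr.
  rewrite (_ : u *+ N = u *+ N.+1 - u); last by rewrite mulrSr addrK.
  by rewrite cosD cosB; ring.
by rewrite /poisson_den; ring.
Qed.

Lemma sum_rsin N r u :
  poisson_den r u * (\sum_(k < N) r ^+ k * sin (u *+ k.+1)) =
  sin u - r ^+ N * (sin (u *+ N.+1) - r * sin (u *+ N)).
Proof.
elim: N => [|N ih].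
  by rewrite big_ord0 mulr0 expr0 mulr1n mulr0n sin0; ring.
rewrite big_ord_recr/= mulrDr ih exprS.
have -> : sin (u *+ N.+2) = 2 * cos u * sin (u *+ N.+1) - sin (u *+ N).
  rewrite (_ : u *+ N.+2 = u *+ N.+1 + u); last by rewrite mulrSr.
  rewrite (_ : u *+ N = u *+ N.+1 - u); last by rewrite mulrSr addrK.
  by rewrite sinD sinB; ring.
by rewrite /poisson_den; ring.
Qed.

(* Both kernels are controlled through their derivatives in the radius, where
   the power series is geometric. *)
Lemma geom_series_le (c : nat -> R) (f f' : R -> R) N r : 0 <= r < 1 ->
  f 0 = 0 ->
  (forall x : R, 0 <= x < 1 -> is_derive x 1 f (f' x)) ->
  (forall x : R, 0 <= x <= r -> `|f' x - \sum_(k < N) x ^+ k * c k| <= 2 * x ^+ N / (1 - r) ^+ 2) ->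
  `|f r - \sum_(k < N) r ^+ k.+1 / k.+1%:R * c k| <= 2 * r ^+ N / (1 - r) ^+ 2.
Proof.
move=> /andP[r0 r1] f0 df bd.
pose P (x : R) := \sum_(k < N) x ^+ k.+1 / k.+1%:R * c k.
pose P' (x : R) := \sum_(k < N) x ^+ k * c k.
have dP (x : R) : is_derive x 1 P (P' x).
  rewrite /P /P'; elim: N {bd P P'} => [|N ih].
    under eq_fun do rewrite big_ord0.
    by rewrite big_ord0; exact: is_derive_cst.
  under eq_fun do rewrite big_ord_recr/=.
  rewrite big_ord_recr/=.
  apply: is_deriveD.
  have dX : is_derive x 1 (fun y : R => y ^+ N.+1) (N.+1%:R * x ^+ N).
    have := @is_deriveX R R (@id R) N.+1 x 1 1 (is_derive_id _ _).
    by rewrite /GRing.scale/= mulr1 exprfctE.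
  have -> : (fun y : R => y ^+ N.+1 / N.+1%:R * c N) =
      (c N / N.+1%:R) \*: (fun y : R => y ^+ N.+1).
    apply/funext => y; rewrite /GRing.scale/=. by rewrite mulrC mulrA mulrAC.
  apply: is_derive_eq; rewrite /GRing.scale/=; field.
  by rewrite nat1r pnatr_eq0.
have P0 : P 0 = 0 by rewrite /P big1// => k _; rewrite expr0n/= !mul0r.
have dfP (x : R) : x \in `]0, r[ -> is_derive x 1 (f - P) (f' x - P' x).
  rewrite in_itv/= => /andP[x0 xr].
  by apply: is_deriveB; apply: df; rewrite ltW//= (lt_trans xr).
have cfP : {within `[0, r], continuous (f - P)}.
  apply: derivable_within_continuous => x; rewrite in_itv/= => /andP[x0 xr].
  have d1 : is_derive x 1 f (f' x) by apply: df; rewrite x0 (le_lt_trans xr).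
  by case: (@is_deriveB R _ _ f P x 1 _ _ d1 (dP x)).
have [c0 cr] := MVT_segment r0 dfP cfP.
rewrite !fctE f0 P0 !subr0 => ->.
rewrite normrM (ger0_norm r0); move: cr; rewrite in_itv/= => /andP[c00 c0r].
apply: (@le_trans _ _ (2 * c0 ^+ N / (1 - r) ^+ 2 * 1)).
  by apply: ler_pM => //; [apply: bd; rewrite c00|exact: ltW].
rewrite mulr1 ler_wpM2r// ?invr_ge0 ?sqr_ge0// ler_wpM2l//.
by rewrite lerXn2r// ?nnegrE.
Qed.

Lemma quot_le (a q b : R) : 0 < b -> b <= q -> `|a / q| <= `|a| / b.
Proof.
move=> b0 bq; have q0 := lt_le_trans b0 bq.
by rewrite normrM normfV (gtr0_norm q0) ler_wpM2l// lef_pV2// posrE.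
Qed.

Lemma poisson_den_mono x r u : 0 <= x <= r -> r < 1 -> (1 - r) ^+ 2 <= poisson_den x u.
Proof.
move=> /andP[x0 xr] r1; apply: le_trans (poisson_den_ge u x0).
by rewrite lerXn2r// ?nnegrE ?subr_ge0 ?lerB// ltW//; apply: le_lt_trans r1.
Qed.

Lemma trig_le2 (a b x : R) : `|a| <= 1 -> `|b| <= 1 -> 0 <= x <= 1 -> `|a - x * b| <= 2.
Proof.
move=> a1 b1 /andP[x0 x1]; rewrite (le_trans (ler_normB _ _))//.
have -> : 2 = 1 + 1 * 1 :> R by ring.
by rewrite lerD// normrM ler_pM// ger0_norm.
Qed.

Lemma log_kernel_series N r u : 0 <= r < 1 ->
  `|log_kernel r u - \sum_(k < N) r ^+ k.+1 / k.+1%:R * cos (u *+ k.+1)| <= 2 * r ^+ N / (1 - r) ^+ 2.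
Proof.
move=> r01; have /andP[r0 r1] := r01.
apply: (@geom_series_le (fun k => cos (u *+ k.+1)) (log_kernel ^~ u) (fun x => (cos u - x) / poisson_den x u)) => //.
- by rewrite /log_kernel /poisson_den mulr0 mul0r subr0 expr0n addr0 ln1 mul0r oppr0.
- by move=> x x01; exact: is_derive_log_kernel.
move=> x /andP[x0 xr].
have qx : (1 - r) ^+ 2 <= poisson_den x u by apply: poisson_den_mono; rewrite ?x0.
have p0 : 0 < (1 - r) ^+ 2 by rewrite exprn_gt0// subr_gt0.
have q0 := lt_le_trans p0 qx.
have -> : (cos u - x) / poisson_den x u - \sum_(k < N) x ^+ k * cos (u *+ k.+1) =
    (x ^+ N * (cos (u *+ N.+1) - x * cos (u *+ N))) / poisson_den x u.
  have h := sum_rcos N x u; set S := \sum_(k < N) _ in h *.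
  have -> : (cos u - x) / poisson_den x u - S = ((cos u - x) - poisson_den x u * S) / poisson_den x u by field; rewrite gt_eqF.
  by rewrite h; congr (_ / _); ring.
apply: le_trans (quot_le _ p0 qx) _.
apply: ler_wpM2r; first by rewrite invr_ge0 ltW.
rewrite normrM mulrC; apply: ler_pM => //.
- apply: trig_le2; rewrite ?cos_max// x0 (le_trans xr)// ltW//.
- by rewrite normrX ger0_norm.
Qed.

Lemma arg_kernel_series N r u : 0 <= r < 1 ->
  `|arg_kernel r u - \sum_(k < N) r ^+ k.+1 / k.+1%:R * sin (u *+ k.+1)| <= 2 * r ^+ N / (1 - r) ^+ 2.
Proof.
move=> r01; have /andP[r0 r1] := r01.
apply: (@geom_series_le (fun k => sin (u *+ k.+1)) (arg_kernel ^~ u) (fun x => sin u / poisson_den x u)) => //.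
- by rewrite /arg_kernel !mul0r atan0.
- by move=> x x01; exact: is_derive_arg_kernel.
move=> x /andP[x0 xr].
have qx : (1 - r) ^+ 2 <= poisson_den x u by apply: poisson_den_mono; rewrite ?x0.
have p0 : 0 < (1 - r) ^+ 2 by rewrite exprn_gt0// subr_gt0.
have q0 := lt_le_trans p0 qx.
have -> : sin u / poisson_den x u - \sum_(k < N) x ^+ k * sin (u *+ k.+1) =
    (x ^+ N * (sin (u *+ N.+1) - x * sin (u *+ N))) / poisson_den x u.
  have h := sum_rsin N x u; set S := \sum_(k < N) _ in h *.
  have -> : sin u / poisson_den x u - S = (sin u - poisson_den x u * S) / poisson_den x u by field; rewrite gt_eqF.
  by rewrite h; congr (_ / _); ring.
apply: le_trans (quot_le _ p0 qx) _.
apply: ler_wpM2r; first by rewrite invr_ge0 ltW.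
rewrite normrM mulrC; apply: ler_pM => //.
- apply: trig_le2; rewrite ?sin_max// x0 (le_trans xr)// ltW//.
- by rewrite normrX ger0_norm.
Qed.

Lemma poisson_den1_gt0 u : cos u != 1 -> 0 < poisson_den 1 u.
Proof. by move=> u1; rewrite poisson_den1E mulr_gt0// subr_gt0 lt_neqAle u1 cos_le1. Qed.

(** For r >= 1/2 the denominator lies between half its value at r = 1 and 4. The bound serves as a
    domination when r -> 1. *)
Lemma log_kernel_bound r u : 2^-1 <= r <= 1 -> cos u != 1 -> `|log_kernel r u| <= `|log_kernel 1 u| + 2.
Proof.
move=> /andP[r2 r1] /poisson_den1_gt0 q1; have r0 : 0 < r by apply: lt_le_trans r2.
have q0 : 0 < poisson_den r u.
  by apply: lt_le_trans (poisson_den_ge1 u (ltW r0)); rewrite mulr_gt0.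
have q4 : ln (poisson_den r u) <= 4.
  apply: (@le_trans _ _ (ln 4)); last by rewrite ltW// ln_sublinear.
  by rewrite ler_ln ?posrE// poisson_den_le4// (ltW r0).
have ql : ln (poisson_den 1 u) - 2 <= ln (poisson_den r u).
  apply: (@le_trans _ _ (ln (poisson_den 1 u / 2))).
    by rewrite ln_div ?posrE// lerB// ltW// ln_sublinear.
  rewrite ler_ln ?posrE ?divr_gt0//; apply: le_trans (poisson_den_ge1 u (ltW r0)).
  by rewrite mulrC; apply: ler_wpM2r => //; exact: ltW.
rewrite /log_kernel !normrN !normrM (ger0_norm (_ : 0 <= 2^-1 :> R))//.
have := ler_norm (- ln (poisson_den 1 u)); rewrite normrN => h.
have h0 := normr_ge0 (ln (poisson_den 1 u)).
suff : `|ln (poisson_den r u)| <= `|ln (poisson_den 1 u)| + 4 by lra.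
by rewrite ler_norml; apply/andP; split; lra.
Qed.

Lemma arg_kernel_bound r u : `|arg_kernel r u| <= 2.
Proof.
have h := pihalf_lt2 R; have := atan_gtNpi2 (r * sin u / (1 - r * cos u)).
have := atan_ltpi2 (r * sin u / (1 - r * cos u)); rewrite -/(arg_kernel r u) => a b.
by rewrite ler_norml; apply/andP; split; lra.
Qed.

(** The offset starts the sequence at 1/2, where [log_kernel_bound] begins to apply. *)
Definition radius (n : nat) : R := 1 - n.+2%:R^-1.

Lemma radius_itv n : 2^-1 <= radius n < 1.
Proof.
rewrite /radius; apply/andP; split; last by rewrite gtrBl invr_gt0.
have : (n.+2%:R)^-1 <= 2^-1 :> R by rewrite lef_pV2 ?posrE// ler_nat.
by move: (n.+2%:R^-1) => x; lra.
Qed.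

Lemma radius_cvg : radius n @[n --> \oo] --> (1 : R).
Proof.
rewrite /radius -[X in _ --> X]subr0; apply: cvgB; first exact: cvg_cst.
have := @cvg_harmonic R; rewrite -(cvg_shiftS (@harmonic R)); exact.
Qed.

Lemma log_kernel_cvg u : cos u != 1 -> log_kernel (radius n) u @[n --> \oo] --> log_kernel 1 u.
Proof.
move=> /poisson_den1_gt0 q1.
have qc : poisson_den (radius n) u @[n --> \oo] --> poisson_den 1 u.
  apply: cvgD; last by rewrite expr2; apply: cvgM; exact: radius_cvg.
  apply: cvgB; first exact: cvg_cst.
  by apply: cvgM; [apply: cvgM; [exact: cvg_cst|exact: radius_cvg]|exact: cvg_cst].
apply: cvgN; apply: cvgM; last exact: cvg_cst.
exact: (cvg_comp _ _ qc (continuous_ln q1)).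
Qed.

Lemma arg_kernel_cvg u : cos u != 1 -> arg_kernel (radius n) u @[n --> \oo] --> arg_kernel 1 u.
Proof.
move=> u1.
have qc : (radius n * sin u / (1 - radius n * cos u)) @[n --> \oo] --> 1 * sin u / (1 - 1 * cos u).
  apply: cvgM; first by apply: cvgM; [exact: radius_cvg|exact: cvg_cst].
  apply: cvgV; first by rewrite mul1r subr_eq0 eq_sym.
  apply: cvgB; first exact: cvg_cst.
  by apply: cvgM; [exact: radius_cvg|exact: cvg_cst].
exact: (cvg_comp _ _ qc (@continuous_atan R _)).
Qed.

(** The sawtooth: with u = 2 d the quotient sin u / (1 - cos u) is cot d = tan (pi / 2 - d). *)
Lemma arg_kernel1E u : 0 < u < 2 * pi -> arg_kernel 1 u = (pi - u) / 2.
Proof.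
move=> /andP[u0 u2].
pose d := u / 2; have uE : u = d + d by rewrite /d; field.
have sd : 0 < sin d by apply: sin_gt0_pi; rewrite /d; lra.
rewrite /arg_kernel !mul1r.
rewrite -[RHS]tanK; last by rewrite in_itv/=; lra.
congr atan; rewrite (_ : (pi - u) / 2 = - (d - pi / 2)); last by rewrite /d; lra.
rewrite tanN /tan sinBpihalf cosBpihalf uE sinD cosD.
have s2 := sqr_cos_sin d; rewrite !expr2 in s2.
rewrite (_ : 1 - _ = 2 * (sin d * sin d)); last by lra.
by field; rewrite gt_eqF.
Qed.

Lemma arg_kernelN r u : arg_kernel r (- u) = - arg_kernel r u.
Proof. by rewrite /arg_kernel sinN cosN mulrN mulNr atanN. Qed.

End Kernels.

(** * Lifts of circle homeomorphisms *)

Section Lift.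
Context (R : realType).
Notation mu := (@lebesgue_measure R).
Notation mu2 := (mu \x mu)%E.
Implicit Types (phi : R -> R) (p : R * R) (r s : R) (k n N : nat).

Definition circle_lift phi :=
  [/\ continuous phi, {homo phi : x y / x < y} & forall t, phi (t + 2 * pi) = phi t + 2 * pi].

Lemma measurable_cosR : measurable_fun setT (@cos R).
Proof. by apply: continuous_measurable_fun; exact: continuous_cos. Qed.

Lemma measurable_sinR : measurable_fun setT (@sin R).
Proof. by apply: continuous_measurable_fun; exact: continuous_sin. Qed.

Definition lift_diff phi p : R := phi p.1 - phi p.2.
Definition arg_diff p : R := p.1 - p.2.

Lemma sub_lift_itv phi s t : circle_lift phi -> s < t -> t < s + 2 * pi ->
  0 < phi t - phi s < 2 * pi.
Proof.
move=> [_ inc per] st ts; rewrite subr_gt0 inc//= ltrBlDl -per; exact: inc.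
Qed.

(* Off this null set two points of the square have distinct images on the circle. *)
Definition exc_set : set (R * R) := [set p | [\/ p.2 = p.1, p.2 = 0 | p.2 = 2 * pi]].

Lemma measurable_exc_set : measurable exc_set.
Proof.
have meq (f g : R * R -> R) : measurable_fun setT f -> measurable_fun setT g ->
    measurable [set p | f p = g p].
  move=> mf mg; have -> : [set p | f p = g p] = (f \- g) @^-1` [set 0].
    by apply/seteqP; split => p /=; [move=> ->; rewrite subrr|move/eqP; rewrite subr_eq0 => /eqP].
  rewrite -[X in measurable X]setTI; apply: (measurable_funB mf mg) => //.
have -> : exc_set = [set p | p.2 = p.1] `|` [set p | p.2 = cst 0 p] `|` [set p | p.2 = cst (2 * pi) p].
  by apply/seteqP; split => p /=; [case; tauto|move=> [[|]|]; [exact: Or31|exact: Or32|exact: Or33]].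
by apply: measurableU; [apply: measurableU|]; apply: meq => //; exact: measurable_snd.
Qed.

(** Each section at a fixed first coordinate has at most three points. *)
Lemma exc_set0 : mu2 exc_set = 0%E.
Proof.
rewrite /product_measure1 /=.
apply: integral0_eq => x _ /=.
have -> : xsection exc_set x = [set x] `|` ([set 0] `|` [set 2 * pi]).
  apply/seteqP; split=> y; rewrite /xsection/= ?inE /exc_set/=.
    by case=> ->; [left|right; left|right; right].
  by case=> [->|[->|->]]; [exact: Or31|exact: Or32|exact: Or33].
apply: countable_lebesgue_measure0.
apply: finite_set_countable; rewrite !finite_setU; do ?split; exact: finite_set1.
Qed.

(** Excluding the values 0 and 2 pi of [p.2] keeps |p.1 - p.2| below 2 pi. Both differences then
    lie, with the same sign, where the sawtooth formula is affine. *)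
Lemma exc_set_or phi p : circle_lift phi -> circ2 p -> ~ exc_set p ->
  (0 < arg_diff p < 2 * pi /\ 0 < lift_diff phi p < 2 * pi) \/
  (0 < - arg_diff p < 2 * pi /\ 0 < - lift_diff phi p < 2 * pi).
Proof.
move=> lphi [/=]; rewrite /circ/= !in_itv/= /exc_set/= /arg_diff /lift_diff => /andP[a0 a1] /andP[b0 b1] nex.
have b0' : 0 < p.2 by rewrite lt_neqAle b0 andbT eq_sym; apply/eqP => h; apply: nex; exact: Or32.
have b1' : p.2 < 2 * pi by rewrite lt_neqAle b1 andbT; apply/eqP => h; apply: nex; exact: Or33.
have [lt12|lt21|e12] := ltgtP p.1 p.2.
- right; rewrite !opprB; split; first lra.
  by apply: (sub_lift_itv lphi) => //; lra.
- left; split; first lra.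
  by apply: (sub_lift_itv lphi) => //; lra.
- by exfalso; apply: nex; exact: Or31.
Qed.

Lemma cos_neq1 (x : R) : 0 < x < 2 * pi -> cos x != 1.
Proof.
move=> /andP[x0 x2]; have xE : x = x / 2 + x / 2 by field.
have sd : 0 < sin (x / 2) by apply: sin_gt0_pi; lra.
have s2 := sqr_cos_sin (x / 2); rewrite lt_eqF// xE cosD -!expr2.
have : 0 < sin (x / 2) ^+ 2 by rewrite exprn_gt0.
lra.
Qed.

Lemma cos_lift_diff_neq1 phi p : circle_lift phi -> circ2 p -> ~ exc_set p -> cos (lift_diff phi p) != 1.
Proof.
move=> lphi sp np; have [[_ h]|[_ h]] := exc_set_or lphi sp np; first exact: cos_neq1.
by rewrite -cosN; exact: cos_neq1.
Qed.

Lemma lift_id : circle_lift (@id R).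
Proof. by split => // x; exact: cvg_id. Qed.

Lemma measurable_lift phi : circle_lift phi -> measurable_fun setT phi.
Proof. by case=> c _ _; exact: continuous_measurable_fun. Qed.

Lemma measurable_lift_diff phi : circle_lift phi -> measurable_fun setT (lift_diff phi).
Proof.
move=> /measurable_lift mphi; rewrite /lift_diff; apply: measurable_funB.
  exact: (measurableT_comp mphi measurable_fst).
exact: (measurableT_comp mphi measurable_snd).
Qed.

Lemma measurable_arg_diff : measurable_fun setT arg_diff.
Proof. exact: (measurable_lift_diff lift_id). Qed.

Lemma measurable_cos_arg_diff : measurable_fun setT (fun p => cos (arg_diff p)).
Proof. by apply: measurableT_comp measurable_arg_diff; apply: continuous_measurable_fun; exact: continuous_cos. Qed.

Lemma measurable_log_kernel r : measurable_fun setT (@log_kernel R r).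
Proof.
apply: measurableT_comp => //; apply: measurable_funM => //.
apply: measurableT_comp (@measurable_ln R) _.
apply: measurable_funD => //; apply: measurable_funB => //.
by apply: measurable_funM => //; exact: measurable_cosR.
Qed.

(* Division is replaced by an exponential because the library proves no
   measurability of the inverse; at a zero of the denominator [sin u = 0]. *)
Lemma arg_kernel_expR r (u : R) : 0 <= r <= 1 ->
  arg_kernel r u = atan (r * sin u * expR (- ln (1 - r * cos u))).
Proof.
move=> /andP[r0 r1]; rewrite /arg_kernel.
have : 0 <= 1 - r * cos u by have := cos_le1 u; have := cos_geN1 u; nra.
rewrite le_eqVlt => /predU1P[/esym e0|d0]; last by rewrite expRN lnK ?posrE.
have rc1 : r * cos u = 1 by lra.
have s0 : sin u = 0.
  apply/eqP; rewrite -sqrf_eq0 sqr_cos_sin; have := cos_le1 u => c1.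
  have c0 : 0 < cos u by rewrite ltNge; apply/negP => cn; have := mulr_ge0_le0 r0 cn; lra.
  have c2 : r * cos u <= 1 * cos u by apply: ler_wpM2r => //; exact: ltW.
  have -> : cos u = 1 by lra.
  by rewrite expr1n subrr.
by rewrite s0 mulr0 !mul0r.
Qed.

Lemma measurable_arg_kernel r : 0 <= r <= 1 -> measurable_fun setT (@arg_kernel R r).
Proof.
move=> r01; have -> : @arg_kernel R r = (fun u => atan (r * sin u * expR (- ln (1 - r * cos u)))).
  by apply/funext => u; exact: arg_kernel_expR.
apply: measurableT_comp; first by apply: continuous_measurable_fun; exact: continuous_atan.
apply: measurable_funM; first by apply: measurable_funM => //; exact: measurable_sinR.
apply: measurableT_comp => //; apply: measurableT_comp => //.
apply: measurableT_comp (@measurable_ln R) _; apply: measurable_funB => //.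
by apply: measurable_funM => //; exact: measurable_cosR.
Qed.

(** The integrand of [conformal_energy] with the sign changed, since [log_kernel 1 u] is - log |1 -
    e^(iu)|. *)
Definition log_integrand phi p : R := log_kernel 1 (lift_diff phi p) * cos (arg_diff p).

Lemma measurable_log_kernel_cos phi r : circle_lift phi -> measurable_fun setT (fun p => log_kernel r (lift_diff phi p) * cos (arg_diff p)).
Proof.
move=> lphi; apply: measurable_funM; last exact: measurable_cos_arg_diff.
exact: (measurableT_comp (measurable_log_kernel r) (measurable_lift_diff lphi)).
Qed.

Lemma bmeas_log_kernel phi r : 0 <= r < 1 -> circle_lift phi -> bmeas circ2 (fun p => log_kernel r (lift_diff phi p)).
Proof.
move=> r01 lphi; split.
  by apply: measurable_funTS; exact: (measurableT_comp (measurable_log_kernel r) (measurable_lift_diff lphi)).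
have p0 : 0 < (1 - r) ^+ 2 by case/andP: r01 => _ r1; rewrite exprn_gt0// subr_gt0.
exists (4 + `|ln ((1 - r) ^+ 2)|) => p _; rewrite /log_kernel normrN normrM (ger0_norm (_ : 0 <= 2^-1 :> R))//.
have /andP[r0 r1] := r01; have q1 := poisson_den_ge (lift_diff phi p) r0; have q0 := poisson_den_gt0 (lift_diff phi p) r01.
have : poisson_den r (lift_diff phi p) <= 4 by apply: poisson_den_le4; rewrite r0 ltW.
move=> q4; have l4 : ln (poisson_den r (lift_diff phi p)) <= 4.
  apply: (@le_trans _ _ (ln 4)); last by rewrite ltW// ln_sublinear.
  by rewrite ler_ln ?posrE.
have l0 : ln ((1 - r) ^+ 2) <= ln (poisson_den r (lift_diff phi p)) by rewrite ler_ln ?posrE.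
have h1 := ler_norm (- ln ((1 - r) ^+ 2)); rewrite normrN in h1.
have h0 := normr_ge0 (ln ((1 - r) ^+ 2)).
suff : `|ln (poisson_den r (lift_diff phi p))| <= 4 + `|ln ((1 - r) ^+ 2)| by lra.
by rewrite ler_norml; apply/andP; split; lra.
Qed.

Lemma bmeas_arg_kernel phi r : 0 <= r <= 1 -> circle_lift phi -> bmeas circ2 (fun p => arg_kernel r (lift_diff phi p)).
Proof.
move=> r01 lphi; split; last by exists 2 => p _; exact: arg_kernel_bound.
by apply: measurable_funTS; exact: (measurableT_comp (measurable_arg_kernel r01) (measurable_lift_diff lphi)).
Qed.

Lemma bmeas_cos_arg_diff : bmeas circ2 (fun p => cos (arg_diff p)).
Proof. by apply: bmeas_cos; apply: measurable_funTS; exact: measurable_arg_diff. Qed.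

Lemma bmeas_sin_arg_diff : bmeas circ2 (fun p => sin (arg_diff p)).
Proof. by apply: bmeas_sin; apply: measurable_funTS; exact: measurable_arg_diff. Qed.

Lemma eq_I2_ae (f g : R * R -> R) : bmeas circ2 f -> bmeas circ2 g ->
  (forall p, circ2 p -> ~ exc_set p -> f p = g p) -> I2 f = I2 g.
Proof.
move=> bf bg fg; rewrite /I2 /Rintegral; congr fine.
apply: ae_eq_integral.
- exact: measurable_circ2.
- by apply/measurable_EFinP; case: bf.
- by apply/measurable_EFinP; case: bg.
exists exc_set; split; [exact: measurable_exc_set|exact: exc_set0|].
by move=> p /= h; apply: contrapT => np; apply: h => sp; rewrite (fg _ sp np).
Qed.

Lemma Rintegral_FTC (F f : R -> R) (a b : R) : a <= b ->
  (forall x : R, is_derive x 1 F (f x)) -> continuous f ->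
  \int[mu]_(x in `[a, b]) f x = F b - F a.
Proof.
rewrite le_eqVlt => /predU1P[->|ab] dF cf.
  by rewrite set_itv1 Rintegral_set1 subrr.
have cF : continuous F.
  by move=> t; apply/differentiable_continuous/derivable1_diffP; case: (dF t).
rewrite /Rintegral (@continuous_FTC2 R f F)//.
- exact: continuous_subspaceT.
- split; first by move=> x _; case: (dF x).
  + by apply: cvg_at_right_filter; exact: cF.
  + by apply: cvg_at_left_filter; exact: cF.
- by move=> x _; rewrite derive1E; exact: derive_val.
Qed.

Lemma is_derive_cosl (k c t : R) :
  is_derive t 1 (fun x : R => cos (k * x + c)) (- k * sin (k * t + c)).
Proof.
have d1 : is_derive t 1 (fun t : R => k * t + c) k.
  by apply: is_derive_eq; rewrite /GRing.scale/=; ring.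
have d2 := @is_derive1_comp R (@cos R) (fun t : R => k * t + c) t _ _ (is_derive_cos _) d1.
by apply: (is_derive_eq d2); ring.
Qed.

Lemma is_derive_sinl (k c t : R) :
  is_derive t 1 (fun x : R => sin (k * x + c)) (k * cos (k * t + c)).
Proof.
have d1 : is_derive t 1 (fun t : R => k * t + c) k.
  by apply: is_derive_eq; rewrite /GRing.scale/=; ring.
have d2 := @is_derive1_comp R (@sin R) (fun t : R => k * t + c) t _ _ (is_derive_sin _) d1.
by apply: (is_derive_eq d2); ring.
Qed.

Lemma continuous_lin (k c : R) : continuous (fun x : R => k * x + c).
Proof. by move=> x; apply: cvgD; [apply: cvgM; [exact: cvg_cst|exact: cvg_id]|exact: cvg_cst]. Qed.

Lemma continuous_cosl (k c : R) : continuous (fun x : R => cos (k * x + c)).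
Proof. move=> x; exact: (cvg_comp _ _ (@continuous_lin k c x) (@continuous_cos R _)). Qed.

Lemma continuous_sinl (k c : R) : continuous (fun x : R => sin (k * x + c)).
Proof. move=> x; exact: (cvg_comp _ _ (@continuous_lin k c x) (@continuous_sin R _)). Qed.

Lemma cos_per (k : nat) (x : R) : cos (x + k%:R * (2 * pi)) = cos x.
Proof.
rewrite (_ : k%:R * (2 * pi) = (pi *+ 2) *+ k); last by rewrite -[RHS]mulr_natl -[pi *+ 2]mulr_natl.
exact: (periodicn (@cosD2pi R)).
Qed.

Lemma sin_per (k : nat) (x : R) : sin (x + k%:R * (2 * pi)) = sin x.
Proof.
rewrite (_ : k%:R * (2 * pi) = (pi *+ 2) *+ k); last by rewrite -[RHS]mulr_natl -[pi *+ 2]mulr_natl.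
exact: (periodicn (@sinD2pi R)).
Qed.

Lemma cos_le_of_itv (h x : R) : 0 <= h <= pi -> h <= x <= 2 * pi - h -> cos x <= cos h.
Proof.
move=> /andP[h0 hpi] /andP[hx xh]; have [xpi|xpi] := leP x pi.
  by move: hx; rewrite le_eqVlt => /predU1P[->//|mx]; rewrite ltW// ltr_cos// in_itv/=; lra.
have -> : cos x = cos (2 * pi - x).
  by rewrite -[RHS]cosN -(cos_per 1 (- _)) mul1r; congr cos; lra.
have : h <= 2 * pi - x by lra.
by rewrite le_eqVlt => /predU1P[->//|mx']; rewrite ltW// ltr_cos// in_itv/=; lra.
Qed.

Lemma twopi_ge0 : 0 <= 2 * pi :> R.
Proof. by rewrite mulr_ge0// pi_ge0. Qed.

Lemma I1_cos_lin (k : nat) (c : R) : (0 < k)%N -> I1 (fun t => cos (k%:R * t + c)) = 0.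
Proof.
move=> k0; have k1 : (k%:R : R) != 0 by rewrite pnatr_eq0 -lt0n.
have dF (x : R) : is_derive x 1 (k%:R^-1 \*: (fun x : R => sin (k%:R * x + c))) (cos (k%:R * x + c)).
  have d := is_derive_sinl k%:R c x.
  by apply: is_derive_eq; rewrite /GRing.scale/=; field.
rewrite /I1 /circ (Rintegral_FTC twopi_ge0 dF); last exact: continuous_cosl.
by rewrite /= mulr0 add0r [k%:R * _ + c]addrC sin_per subrr.
Qed.

Lemma I1_sin_lin (k : nat) (c : R) : (0 < k)%N -> I1 (fun t => sin (k%:R * t + c)) = 0.
Proof.
move=> k0; rewrite -(I1_cos_lin (c - pi / 2) k0); apply: eq_I1 => t _.
by rewrite addrA cosBpihalf.
Qed.

End Lift.
Arguments exc_set {R}.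
Arguments exc_set0 {R}.
Arguments measurable_exc_set {R}.

(** * Abel regularization of the energy *)

Section Spectral.
Context (R : realType).
Notation mu := (@lebesgue_measure R).
Notation mu2 := (mu \x mu)%E.
Implicit Types (phi : R -> R) (p : R * R) (r s : R) (k n N : nat).

(* [fourier_cos] and [fourier_sin] are the two parts of [\int e^(i (k phi t + s t)) arg_diff]. *)
Definition fourier_cos phi (s : R) k := Ic (fun t => k%:R * phi t + s * t).
Definition fourier_sin phi (s : R) k := Is (fun t => k%:R * phi t + s * t).
Definition fourier_sqr phi s k := fourier_cos phi s k ^+ 2 + fourier_sin phi s k ^+ 2.

Lemma measurable_phase phi (a b : R) : circle_lift phi ->
  measurable_fun circ (fun t => a * phi t + b * t).
Proof.
move=> lphi; apply: measurable_funTS; apply: measurable_funD; apply: measurable_funM => //.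
exact: measurable_lift.
Qed.

Lemma IcN (a : R -> R) : Ic (fun t => - a t) = Ic a.
Proof. by apply: eq_I1 => t _; rewrite cosN. Qed.

Lemma IsN (a : R -> R) : measurable_fun circ a -> Is (fun t => - a t) = - Is a.
Proof.
move=> ma; rewrite /Is -mulN1r -I1Z; last exact: bmeas_sin.
by apply: eq_I1 => t _; rewrite sinN mulN1r.
Qed.

(** The squared modulus of the integral of e^(i f) is the double integral of e^(i (f x - f y)), here
    with f = k phi + s id. *)
Lemma fourier_sqrE phi s k : circle_lift phi ->
  I2 (fun p => cos (k%:R * lift_diff phi p + s * arg_diff p)) = fourier_sqr phi s k.
Proof.
move=> lphi; have ma := measurable_phase k%:R s lphi.
have mb : measurable_fun circ (fun t => - (k%:R * phi t + s * t)).
  by apply: measurableT_comp.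
transitivity (I2 (fun p => cos ((k%:R * phi p.1 + s * p.1) + - (k%:R * phi p.2 + s * p.2)))).
  by apply: eq_I2 => p _; congr cos; rewrite /lift_diff /arg_diff; ring.
by rewrite (I2_cos ma mb) IcN (IsN ma) /fourier_sqr /fourier_cos /fourier_sin; ring.
Qed.

Lemma fourier_sqr_ge0 phi s k : 0 <= fourier_sqr phi s k.
Proof. by rewrite addr_ge0// sqr_ge0. Qed.

(* Abel regularization of [energy - s * (winding term)], with [s = 1] or [s = -1];
   by [abel_energy_series] it is the sum of the [r^k / k * fourier_sqr phi s k]. *)
Definition abel_energy phi s r := I2 (fun p => log_kernel r (lift_diff phi p) * cos (arg_diff p) - s * (arg_kernel r (lift_diff phi p) * sin (arg_diff p))).

Lemma cos_sgn (s x y : R) : s ^+ 2 = 1 -> cos (x + s * y) = cos x * cos y - s * (sin x * sin y).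
Proof.
move=> s2; have [->|->] : s = 1 \/ s = -1.
  by move/eqP: s2; rewrite sqrf_eq1 => /orP[] /eqP; tauto.
- by rewrite !mul1r cosD.
- by rewrite !mulN1r cosB opprK.
Qed.

Lemma bmeas_abel_energy phi s r : 0 <= r < 1 -> circle_lift phi ->
  bmeas circ2 (fun p => log_kernel r (lift_diff phi p) * cos (arg_diff p) - s * (arg_kernel r (lift_diff phi p) * sin (arg_diff p))).
Proof.
move=> r01 lphi; have r01' : 0 <= r <= 1 by case/andP: r01 => -> /ltW.
apply: bmeasB; first by apply: bmeasM; [exact: bmeas_log_kernel|exact: bmeas_cos_arg_diff].
apply: bmeasM; first exact: bmeas_cst.
by apply: bmeasM; [exact: bmeas_arg_kernel|exact: bmeas_sin_arg_diff].
Qed.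

Lemma bmeas_cosk_lift phi s k : circle_lift phi -> bmeas circ2 (fun p => cos (k%:R * lift_diff phi p + s * arg_diff p)).
Proof.
move=> lphi; apply: bmeas_cos; apply: measurable_funTS.
apply: measurable_funD; apply: measurable_funM => //; [exact: measurable_lift_diff|exact: measurable_arg_diff].
Qed.

(** By [cos_sgn] the two kernel series combine term by term into cos (k X + s T), whose integral is
    a [fourier_sqr]. Each kernel leaves a remainder 2 r^N / (1 - r)^2, hence the 4. *)
Lemma abel_energy_series phi s r N : 0 <= r < 1 -> s ^+ 2 = 1 -> circle_lift phi ->
  `|abel_energy phi s r - \sum_(k < N) r ^+ k.+1 / k.+1%:R * fourier_sqr phi s k.+1| <=
  (2 * pi) ^+ 2 * (4 / (1 - r) ^+ 2) * r ^+ N.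
Proof.
move=> r01 s2 lphi.
pose S p := \sum_(k < N) r ^+ k.+1 / k.+1%:R * cos (k.+1%:R * lift_diff phi p + s * arg_diff p).
have bS : bmeas circ2 S.
  by apply: bmeas_sum => k; apply: bmeasM; [exact: bmeas_cst|exact: bmeas_cosk_lift].
have IS : I2 S = \sum_(k < N) r ^+ k.+1 / k.+1%:R * fourier_sqr phi s k.+1.
  rewrite /S (@I2_sum R N (fun k p => r ^+ k.+1 / k.+1%:R * cos (k.+1%:R * lift_diff phi p + s * arg_diff p))).
    by apply: eq_bigr => k _; rewrite I2Z ?fourier_sqrE//; exact: bmeas_cosk_lift.
  by move=> k; apply: bmeasM; [exact: bmeas_cst|exact: bmeas_cosk_lift].
rewrite -IS /abel_energy -I2B//; last exact: bmeas_abel_energy.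
rewrite -mulrA -I2c; apply: norm_I2_le.
- by apply: bmeasB => //; exact: bmeas_abel_energy.
- exact: bmeas_cst.
move=> p _; set X := lift_diff phi p; set T := arg_diff p.
have hk := log_kernel_series N X r01; have hs := arg_kernel_series N X r01.
set K := \sum_(k < N) _ in hk; set L := \sum_(k < N) _ in hs.
have -> : S p = K * cos T - s * (L * sin T).
  rewrite /S /K /L !mulr_suml mulr_sumr -sumrB; apply: eq_bigr => k _.
  by rewrite (cos_sgn _ _ s2) !mulr_natl -/X -/T; ring.
have -> : log_kernel r X * cos T - s * (arg_kernel r X * sin T) - (K * cos T - s * (L * sin T)) =
  (log_kernel r X - K) * cos T - s * ((arg_kernel r X - L) * sin T) by ring.
have s1 : `|s| = 1 by apply/eqP; rewrite -sqrp_eq1// -normrX s2 normr1.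
apply: (le_trans (ler_normB _ _)).
have -> : 4 / (1 - r) ^+ 2 * r ^+ N = 2 * r ^+ N / (1 - r) ^+ 2 * 1 + 1 * (2 * r ^+ N / (1 - r) ^+ 2 * 1) by ring.
rewrite !normrM s1; apply: lerD; first by apply: ler_pM => //; exact: cos_max.
by rewrite !mul1r; apply: ler_pM => //; exact: sin_max.
Qed.

Lemma geom_le (a b c r : R) : 0 <= r < 1 -> (\forall N \near \oo, a <= b + c * r ^+ N) -> a <= b.
Proof.
move=> /andP[r0 r1] H; rewrite -[b]addr0.
have h : (b + c * r ^+ N) @[N --> \oo] --> b + c * 0.
  apply: cvgD; first exact: cvg_cst.
  apply: cvgM; first exact: cvg_cst.
  by apply: cvg_expr; rewrite ger0_norm.
by rewrite mulr0 in h; exact: (cvgr_to_ge h H).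
Qed.

(** All terms of the series are nonnegative, so each of them alone is a lower bound. *)
Lemma abel_energy_ge phi s r k : 0 <= r < 1 -> s ^+ 2 = 1 -> circle_lift phi ->
  r ^+ k.+1 / k.+1%:R * fourier_sqr phi s k.+1 <= abel_energy phi s r.
Proof.
move=> r01 s2 lphi; apply: (@geom_le _ _ ((2 * pi) ^+ 2 * (4 / (1 - r) ^+ 2)) r r01).
exists k.+1 => // N /= kN.
have := abel_energy_series N r01 s2 lphi; rewrite ler_norml => /andP[h _].
have : r ^+ k.+1 / k.+1%:R * fourier_sqr phi s k.+1 <= \sum_(j < N) r ^+ j.+1 / j.+1%:R * fourier_sqr phi s j.+1.
  rewrite (bigD1 (Ordinal kN))//= lerDl sumr_ge0// => j _.
  by rewrite mulr_ge0 ?fourier_sqr_ge0// divr_ge0// exprn_ge0//; case/andP: r01.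
by move: h; rewrite lerNl opprB lerBlDl => h h2; exact: le_trans h2 h.
Qed.

Lemma abel_energy_eq0 phi s r : 0 <= r < 1 -> s ^+ 2 = 1 -> circle_lift phi ->
  (forall k, fourier_sqr phi s k.+1 = 0) -> abel_energy phi s r = 0.
Proof.
move=> r01 s2 lphi A0; apply/eqP; rewrite -normr_le0.
apply: (@geom_le _ _ ((2 * pi) ^+ 2 * (4 / (1 - r) ^+ 2)) r r01).
apply: nearW => N; have := abel_energy_series N r01 s2 lphi.
by rewrite big1 ?subr0 ?add0r// => k _; rewrite A0 mulr0.
Qed.

Lemma radius01 n : 0 <= radius R n < 1.
Proof. by have := radius_itv R n => /andP[a b]; apply/andP; split => //; apply: le_trans a. Qed.

(** The winding term at radius 1; by [arg_integral_lift] it is the same for all lifts. *)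
Definition arg_integral phi : R := I2 (fun p => arg_kernel 1 (lift_diff phi p) * sin (arg_diff p)).

Lemma bmeas_arg_kernel_sin phi r : 0 <= r <= 1 -> circle_lift phi -> bmeas circ2 (fun p => arg_kernel r (lift_diff phi p) * sin (arg_diff p)).
Proof. by move=> r01 lphi; apply: bmeasM; [exact: bmeas_arg_kernel|exact: bmeas_sin_arg_diff]. Qed.

Lemma itv11 : 0 <= (1 : R) <= 1. Proof. by rewrite ler01 lexx. Qed.

Lemma abel_energy_cvg phi s : s ^+ 2 = 1 -> circle_lift phi -> mu2.-integrable circ2 (EFin \o log_integrand phi) ->
  abel_energy phi s (radius R n) @[n --> \oo] --> I2 (log_integrand phi) - s * arg_integral phi.
Proof.
move=> s2 lphi iL.
have s1 : `|s| = 1 by apply/eqP; rewrite -sqrp_eq1// -normrX s2 normr1.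
have bs : bmeas circ2 (fun p => s * (arg_kernel 1 (lift_diff phi p) * sin (arg_diff p))).
  by apply: bmeasM; [exact: bmeas_cst|apply: bmeas_arg_kernel_sin => //; exact: itv11].
have -> : I2 (log_integrand phi) - s * arg_integral phi =
   \int[mu2]_(p in circ2) (log_integrand phi p - s * (arg_kernel 1 (lift_diff phi p) * sin (arg_diff p))).
  rewrite RintegralB; [|exact: measurable_circ2|exact: iL|exact: bmeas_circ2_int].
  congr (_ - _); rewrite /arg_integral -I2Z //; apply: bmeas_arg_kernel_sin => //; exact: itv11.
(* The domination: [log_kernel_bound] costs 2, and the bounded [arg_kernel] another 2. *)
have iN : mu2.-integrable circ2 (EFin \o (fun p => `|log_integrand phi p| + 4)).
  have h1 := integrable_norm iL.
  have h2 : mu2.-integrable circ2 (EFin \o cst (4:R)) by apply: bmeas_circ2_int; exact: bmeas_cst.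
  by apply: integrableD_EFin => //; exact: measurable_circ2.
pose Fn n p := log_kernel (radius R n) (lift_diff phi p) * cos (arg_diff p) - s * (arg_kernel (radius R n) (lift_diff phi p) * sin (arg_diff p)).
pose F p := log_integrand phi p - s * (arg_kernel 1 (lift_diff phi p) * sin (arg_diff p)).
suff h : mu2.-integrable circ2 (EFin \o F) /\
    (\int[mu2]_(p in circ2) Fn n p) @[n --> \oo] --> \int[mu2]_(p in circ2) F p by case: h.
apply: (@Rdominated_convergence _ _ R mu2 circ2 exc_set Fn F (fun p => `|log_integrand phi p| + 4)); [exact: measurable_circ2|exact: measurable_exc_set|exact: exc_set0|..].
- by move=> n; case: (bmeas_abel_energy s (radius01 n) lphi).
- apply: measurable_funB; first by apply: measurable_funTS; exact: measurable_log_kernel_cos.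
  by case: bs.
- move=> p sp np; rewrite /Fn /F; have c1 := cos_lift_diff_neq1 lphi sp np.
  apply: cvgB; first by apply: cvgM; [exact: log_kernel_cvg|exact: cvg_cst].
  apply: cvgM; first exact: cvg_cst.
  by apply: cvgM; [exact: arg_kernel_cvg|exact: cvg_cst].
- exact: iN.
- move=> n p sp np; rewrite /Fn; have c1 := cos_lift_diff_neq1 lphi sp np.
  have /andP[ra rb] := radius_itv R n.
  have hk : `|log_kernel (radius R n) (lift_diff phi p)| <= `|log_kernel 1 (lift_diff phi p)| + 2.
    by apply: log_kernel_bound => //; rewrite ra ltW.
  apply: (le_trans (ler_normB _ _)); rewrite /log_integrand !normrM s1.
  have hc := cos_max (arg_diff p); have hs := sin_max (arg_diff p).
  have hss := arg_kernel_bound (radius R n) (lift_diff phi p).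
  have e1 : `|log_kernel (radius R n) (lift_diff phi p)| * `|cos (arg_diff p)| <= (`|log_kernel 1 (lift_diff phi p)| + 2) * `|cos (arg_diff p)|.
    exact: ler_wpM2r.
  have e2 : `|arg_kernel (radius R n) (lift_diff phi p)| * `|sin (arg_diff p)| <= 2 * 1 by exact: ler_pM.
  lra.
Qed.

End Spectral.

(** * The winding term, integrability by Fatou's lemma, and the energy gap *)

Section Gap.
Context (R : realType).
Notation mu := (@lebesgue_measure R).
Notation mu2 := (mu \x mu)%E.
Implicit Types (phi : R -> R) (p : R * R) (r s : R) (k n N : nat).

(* For [0 < u < 2 pi], [arg_kernel 1 u = (pi - u) / 2] is affine in [u], so that replacing
   [phi] by the identity changes the integrand by separated terms of integral 0. *)
Lemma arg_integral_lift phi : circle_lift phi -> arg_integral phi = arg_integral (@id R).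
Proof.
move=> lphi; have lid := lift_id R.
pose v t : R := phi t - t.
have bv : bmeas circ v.
  apply: bmeas_continuous => t; apply: cvgB; last exact: cvg_id.
  by case: lphi => c _ _; exact: c.
have bco : bmeas circ (@cos R) by apply: bmeas_cos; apply: measurable_funTS; exact: measurable_id.
have bsi : bmeas circ (@sin R) by apply: bmeas_sin; apply: measurable_funTS; exact: measurable_id.
have c0 : I1 (@cos R) = 0.
  by rewrite -(@I1_cos_lin R 1 0 isT); apply: eq_I1 => t _; rewrite mul1r addr0.
have s0 : I1 (@sin R) = 0.
  by rewrite -(@I1_sin_lin R 1 0 isT); apply: eq_I1 => t _; rewrite mul1r addr0.
have bw : bmeas circ2 (fun p => (v p.1 - v p.2) * sin (arg_diff p)).
  apply: bmeasM; last exact: bmeas_sin_arg_diff.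
  by apply: bmeasB; [exact: bmeas_fst|exact: bmeas_snd].
have bid := bmeas_arg_kernel_sin (itv11 R) lid.
(* After expansion of the sine each product separates with a factor [cos] or [sin], whose integral
   over the period is 0. *)
have w0 : I2 (fun p => (v p.1 - v p.2) * sin (arg_diff p)) = 0.
  transitivity (I2 (fun p => ((v p.1 * sin p.1) * cos p.2 - (v p.1 * cos p.1) * sin p.2) -
     (sin p.1 * (v p.2 * cos p.2) - cos p.1 * (v p.2 * sin p.2)))).
    by apply: eq_I2 => p _; rewrite /arg_diff sinB; ring.
  have b1 := bmeasM bv bsi; have b2 := bmeasM bv bco.
  have q1 := bmeasM (bmeas_fst b1) (bmeas_snd bco).
  have q2 := bmeasM (bmeas_fst b2) (bmeas_snd bsi).
  have q3 := bmeasM (bmeas_fst bsi) (bmeas_snd b2).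
  have q4 := bmeasM (bmeas_fst bco) (bmeas_snd b1).
  rewrite (I2B (bmeasB q1 q2) (bmeasB q3 q4)) (I2B q1 q2) (I2B q3 q4).
  rewrite (I2_sep b1 bco) (I2_sep b2 bsi) (I2_sep bsi b2) (I2_sep bco b1).
  by rewrite c0 s0 !mulr0 !mul0r !subr0.
transitivity (I2 (fun p => arg_kernel 1 (lift_diff id p) * sin (arg_diff p) - 2^-1 * ((v p.1 - v p.2) * sin (arg_diff p)))).
  apply: eq_I2_ae.
  - by apply: bmeas_arg_kernel_sin => //; exact: itv11.
  - by apply: bmeasB => //; apply: bmeasM => //; exact: bmeas_cst.
  move=> p sp np; rewrite mulrA -mulrBl; congr (_ * _).
  have [[h1 h2]|[h1 h2]] := exc_set_or lphi sp np.
    by rewrite !arg_kernel1E// /v /lift_diff /=; field.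
  rewrite -[lift_diff phi p]opprK -[lift_diff id p]opprK (arg_kernelN _ (- lift_diff phi p)) (arg_kernelN _ (- lift_diff id p)) !arg_kernel1E//.
  by rewrite /v /lift_diff /=; field.
rewrite I2B//; last by apply: bmeasM => //; exact: bmeas_cst.
by rewrite I2Z// w0 mulr0 subr0.
Qed.

Lemma cos_lt0_itv (x : R) : 0 <= x <= 2 * pi -> cos x < 0 -> pi / 2 <= x <= 3 * pi / 2.
Proof.
move=> /andP[x0 x2] cx; have p0 := pi_gt0 R.
apply/andP; split; rewrite leNgt; apply/negP => h.
  have : 0 <= cos x by apply: cos_ge0_pihalf; lra.
  lra.
have : 0 <= cos (x - 1%:R * (2 * pi)) by apply: cos_ge0_pihalf; rewrite mul1r; lra.
by rewrite -(cos_per 1 (x - _)) subrK; lra.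
Qed.

(** Where the weight [cos (arg_diff p)] is negative the images stay apart, so that the logarithmic
    singularity meets only positive weights. The constant is the minimum of
    [phi (t + pi / 2) - phi t], attained by compactness and positive by monotonicity. *)
Lemma lift_sep phi : circle_lift phi -> exists2 m : R, 0 < m <= pi &
  forall p, circ2 p -> cos (arg_diff p) < 0 -> cos (lift_diff phi p) <= cos m.
Proof.
move=> lphi; have [cphi inc per] := lphi; have p0 := pi_gt0 R.
have h0 : 0 <= 2 * pi :> R by exact: twopi_ge0.
have cf : {within `[0, 2 * pi], continuous (fun t => phi (t + pi / 2) - phi t)}.
  apply: continuous_subspaceT => t; apply: cvgB; last exact: cphi.
  have hs : (t0 + pi / 2) @[t0 --> t] --> t + pi / 2 by apply: cvgD; [exact: cvg_id|exact: cvg_cst].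
  exact: (cvg_comp _ _ hs (cphi _)).
have [c circ_ cmin] := EVT_min h0 cf.
pose m := phi (c + pi / 2) - phi c.
have m0 : 0 < m by rewrite subr_gt0 inc//; lra.
(* A quarter turn from [s] ends before [t], and a quarter turn from [t] ends before [s + 2 * pi]. *)
have key s t : 0 <= s <= 2 * pi -> 0 <= t <= 2 * pi -> pi / 2 <= t - s <= 3 * pi / 2 ->
    m <= phi t - phi s <= 2 * pi - m.
  move=> /andP[s0 s2] /andP[t0 t2] /andP[a b].
  have hs : m <= phi (s + pi / 2) - phi s by apply: cmin; rewrite in_itv/= s0.
  have ht : m <= phi (t + pi / 2) - phi t by apply: cmin; rewrite in_itv/= t0.
  have mono x y : x <= y -> phi x <= phi y.
    by rewrite le_eqVlt => /predU1P[->//|/inc/ltW].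
  have h1 : phi (s + pi / 2) <= phi t by apply: mono; lra.
  have h2 : phi (t + pi / 2) <= phi (s + 2 * pi) by apply: mono; lra.
  rewrite per in h2; apply/andP; split; lra.
(* For two points half a turn apart [key] gives m <= 2 pi - m. *)
have mpi : m <= pi.
  have := key 0 pi; rewrite lexx subr0 => /(_ _ _ _)/andP[]; first lra.
  - by apply/andP; split; lra.
  - by apply/andP; split; lra.
  - lra.
exists m; first by rewrite m0.
have cosle (x : R) : m <= x <= 2 * pi - m -> cos x <= cos m.
  by apply: cos_le_of_itv; rewrite (ltW m0).
move=> p [/=]; rewrite /circ/= !in_itv/= /arg_diff /lift_diff => /andP[a0 a1] /andP[b0 b1] ct.
have [le12|lt21] := leP p.1 p.2.
  rewrite -cosN opprB; apply: cosle; apply: key; rewrite ?a0 ?b0//.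
  by apply: cos_lt0_itv; [lra|rewrite -cosN opprB].
apply: cosle; apply: key; rewrite ?a0 ?b0//.
by apply: cos_lt0_itv => //; lra.
Qed.

(** For a nonnegative weight the denominator is at most 4; for a negative one [lift_sep] keeps it
    away from 0. Fatou's lemma uses the uniformity in [r], and [energy_lt_integrable] the case r =
    1. *)
Lemma log_kernel_cos_ge phi : circle_lift phi -> exists C : R, forall r p,
  2^-1 <= r <= 1 -> circ2 p -> - C <= log_kernel r (lift_diff phi p) * cos (arg_diff p).
Proof.
move=> lphi; have [m /andP[m0 mpi] Hm] := lift_sep lphi.
have cm : cos m < 1.
  have c1 : cos m != 1 by apply: cos_neq1; apply/andP; split; have := pi_gt0 R; lra.
  by rewrite lt_neqAle c1 cos_le1.
pose C := 4 + `|ln (1 - cos m)|.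
have C4 : 4 <= C by rewrite lerDl normr_ge0.
exists C => r p /andP[r2 r1] sp; have r0 : 0 < r by lra.
have l4 : ln (poisson_den r (lift_diff phi p)) <= 4.
  have [q0|q0] := leP (poisson_den r (lift_diff phi p)) 0; first by rewrite ln0.
  apply: (@le_trans _ _ (ln 4)); last by rewrite ltW// ln_sublinear.
  by rewrite ler_ln ?posrE// poisson_den_le4// (ltW r0).
have c1 := cos_le1 (arg_diff p); have cN1 := cos_geN1 (arg_diff p).
rewrite /log_kernel; set l := ln _ in l4 *.
have [ct|ct] := leP 0 (cos (arg_diff p)).
  have : l * cos (arg_diff p) <= 4 * 1 by have := ler_wpM2r ct l4; nra.
  lra.
have hq : 1 - cos m <= poisson_den r (lift_diff phi p).
  apply: le_trans (poisson_den_ge1 (lift_diff phi p) (ltW r0)).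
  by rewrite poisson_den1E; have := Hm p sp ct; have := cos_le1 (lift_diff phi p); nra.
have hl : ln (1 - cos m) <= l by rewrite ler_ln ?posrE; lra.
have hn := ler_norm (- ln (1 - cos m)); rewrite normrN in hn.
have : (- l) * (- cos (arg_diff p)) <= C * 1.
  have : - l <= C by rewrite /C; lra.
  have [l0|l0] := leP 0 (- l); first by move=> lC; apply: ler_pM => //; lra.
  move=> _; have : - l * - cos (arg_diff p) <= 0 by rewrite mulr_le0_ge0//; lra.
  lra.
lra.
Qed.

(* Fatou's lemma, applied after a constant is added to make the integrands nonnegative. *)
Lemma log_integrand_int phi (K : R) : circle_lift phi ->
  (forall n, I2 (fun p => log_kernel (radius R n) (lift_diff phi p) * cos (arg_diff p)) <= K) ->
  mu2.-integrable circ2 (EFin \o log_integrand phi).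
Proof.
move=> lphi HK; have [C HC] := log_kernel_cos_ge lphi.
(* Off [exc_set] the regularized integrands converge pointwise. *)
pose D : set (R * R) := circ2 `\` exc_set.
have mD : measurable D by apply: measurableD; [exact: measurable_circ2|exact: measurable_exc_set].
have mL : measurable_fun circ2 (log_integrand phi) by apply: measurable_funTS; exact: measurable_log_kernel_cos.
pose h n p : \bar R := (log_kernel (radius R n) (lift_diff phi p) * cos (arg_diff p) + C)%:E.
have mh n : measurable_fun circ2 (h n).
  apply/measurable_EFinP; apply: measurable_funD => //.
  by apply: measurable_funTS; exact: measurable_log_kernel_cos.
have h0 n p : circ2 p -> (0 <= h n p)%E.
  move=> sp; rewrite lee_fin -lerBlDr sub0r; apply: HC => //.
  by have /andP[-> /ltW] := radius_itv R n.
have hF := @fatou _ _ R mu2 D mD h.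
have hle n : (\int[mu2]_(p in D) h n p <= (K + (2 * pi) ^+ 2 * C)%:E)%E.
  apply: (@le_trans _ _ (\int[mu2]_(p in circ2) h n p)%E).
    by apply: ge0_subset_integral => //; solve [exact: measurable_circ2|exact: subDsetl|exact: mh|by move=> p sp; exact: h0|by move=> p []].
  have b1 : bmeas circ2 (fun p => log_kernel (radius R n) (lift_diff phi p) * cos (arg_diff p)).
    by apply: bmeasM; [apply: bmeas_log_kernel => //; exact: radius01|exact: bmeas_cos_arg_diff].
  have b2 := bmeasD b1 (bmeas_cst circ2 C).
  rewrite /h (EFin_I2 (bmeas_circ2_int b2)) lee_fin (I2D b1 (bmeas_cst circ2 C)) I2c lerD2r.
  exact: HK.
have hK : (\int[mu2]_(p in D) (log_integrand phi p + C)%:E <= (K + (2 * pi) ^+ 2 * C)%:E)%E.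
  have -> : (\int[mu2]_(p in D) (log_integrand phi p + C)%:E = \int[mu2]_(p in D) limn_einf (h ^~ p))%E.
    apply: eq_integral => p /set_mem [sp np].
    have hc : h n p @[n --> \oo] --> (log_integrand phi p + C)%:E.
      apply: cvg_EFin; first exact: nearW.
      apply: cvgD; last exact: cvg_cst.
      by apply: cvgM; [apply: log_kernel_cvg; exact: cos_lift_diff_neq1|exact: cvg_cst].
    by have [-> _] := cvg_limn_einf_sup hc.
  apply: le_trans (hF _ _) _.
  - by move=> n; apply: measurable_funS (mh n); [exact: measurable_circ2|exact: subDsetl].
  - by move=> n p [sp _]; exact: h0.
  rewrite limn_einf_lim; apply: lime_le; first exact: is_cvg_einfs.
  apply: nearW => n; apply: le_trans (hle n).
  by apply: ereal_inf_lbound; exists n => /=.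
have mLC : measurable_fun circ2 (fun p => log_integrand phi p + C) by apply: measurable_funD.
have iD : mu2.-integrable circ2 (EFin \o (fun p => log_integrand phi p + C)).
  apply: (@integrable_setDnull _ _ R mu2 circ2 exc_set (fun p => log_integrand phi p + C)) => //; [exact: measurable_exc_set|exact: measurable_circ2|exact: exc_set0|].
  apply/integrableP; split.
    apply/measurable_EFinP; apply: measurable_funS mLC; [exact: measurable_circ2|exact: subDsetl].
  apply: le_lt_trans (_ : ((K + (2 * pi) ^+ 2 * C)%:E < +oo)%E); last exact: ltry.
  apply: le_trans hK; apply: ge0_le_integral => //=.
  - by apply/measurable_EFinP; apply: measurableT_comp => //; apply: measurable_funS mLC; [exact: measurable_circ2|exact: subDsetl].
  - by apply/measurable_EFinP; apply: measurable_funS mLC; [exact: measurable_circ2|exact: subDsetl].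
  - move=> p [sp _]; rewrite lee_fin ger0_norm// -lerBlDr sub0r.
    by apply: HC => //; lra.
have iC : mu2.-integrable circ2 (EFin \o cst (- C)) by apply: bmeas_circ2_int; exact: bmeas_cst.
have : mu2.-integrable circ2 (EFin \o (fun p => log_integrand phi p + C + cst (- C) p)).
  by apply: integrableD_EFin => //; exact: measurable_circ2.
by congr (_.-integrable _ _); apply/funext => p /=; rewrite addrK.
Qed.

Lemma fourier_sqr_id k : fourier_sqr (@id R) 1 k.+1 = 0.
Proof.
rewrite /fourier_sqr /fourier_cos /fourier_sin /Ic /Is.
have e (t : R) : k.+1%:R * t + 1 * t = k.+2%:R * t + 0 by rewrite -[k.+2]addn1 natrD; ring.
under eq_I1 do rewrite e; rewrite I1_cos_lin//.
by under eq_I1 do rewrite e; rewrite I1_sin_lin// expr0n addr0.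
Qed.

Lemma fourier_sqrN_id : fourier_sqr (@id R) (-1) 1 = (2 * pi) ^+ 2.
Proof.
rewrite /fourier_sqr /fourier_cos /fourier_sin /Ic /Is.
have e (t : R) : 1%:R * t + -1 * t = 0 by ring.
under eq_I1 do rewrite e cos0; rewrite I1c.
by under eq_I1 do rewrite e sin0; rewrite I1c mulr0 mulr1 expr0n addr0.
Qed.

(** All A_k of the identity vanish, so its regularized logarithmic integral equals the winding term,
    which is at most 2 (2 pi)^2; Fatou's lemma concludes. *)
Lemma log_integrand_id_int : mu2.-integrable circ2 (EFin \o log_integrand (@id R)).
Proof.
have lid := lift_id R.
apply: (@log_integrand_int _ ((2 * pi) ^+ 2 * 2) lid) => n.
have b1 : bmeas circ2 (fun p => log_kernel (radius R n) (lift_diff id p) * cos (arg_diff p)).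
  by apply: bmeasM; [apply: bmeas_log_kernel => //; exact: radius01|exact: bmeas_cos_arg_diff].
have r1 : 0 <= radius R n <= 1 by case/andP: (radius01 R n) => -> /ltW.
have b2 := bmeas_arg_kernel_sin r1 lid.
have := abel_energy_eq0 (radius01 R n) (expr1n R 2) lid fourier_sqr_id.
rewrite /abel_energy.
under eq_I2 do rewrite mul1r.
rewrite (I2B b1 b2) => /eqP; rewrite subr_eq0 => /eqP ->.
rewrite -I2c; apply: I2_le; [exact: b2|exact: bmeas_cst|].
move=> p _; apply: le_trans (ler_norm _) _; rewrite normrM.
apply: (@le_trans _ _ (2 * 1)); last by rewrite mulr1.
by apply: ler_pM => //; [exact: arg_kernel_bound|exact: sin_max].
Qed.

Definition log_energy phi : R := I2 (log_integrand phi).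

(** For the identity the Abel energy of sign 1 is 0 at every radius, and its limit is the difference
    of the two sides. *)
Lemma log_energy_id : log_energy (@id R) = arg_integral (@id R).
Proof.
have lid := lift_id R.
have h := abel_energy_cvg (expr1n R 2) lid log_integrand_id_int.
have e : (fun n => abel_energy (@id R) 1 (radius R n)) = cst 0.
  by apply/funext => n /=; rewrite (abel_energy_eq0 (radius01 R n) (expr1n R 2) lid fourier_sqr_id).
rewrite e in h; have : I2 (log_integrand (@id R)) - 1 * arg_integral (@id R) = 0.
  by apply: (@cvg_unique _ (@Rhausdorff R) _ _ _ _ h); exact: cvg_cst.
by move=> /eqP; rewrite mul1r subr_eq0 => /eqP.
Qed.

Lemma radiusX_cvg k (a : R) : radius R n ^+ k * a @[n --> \oo] --> a.
Proof.
rewrite -[X in _ --> X]mul1r; apply: cvgM; last exact: cvg_cst.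
elim: k => [|k ih]; first exact: cvg_cst.
rewrite (_ : (fun n => radius R n ^+ k.+1) = (fun n => radius R n * radius R n ^+ k)); last first.
  by apply/funext => n; rewrite exprS.
by rewrite -[X in _ --> X]mulr1; apply: cvgM; [exact: radius_cvg|exact: ih].
Qed.

(** The winding term of [phi] is that of the identity, hence by [log_energy_id] the energy of the
    identity. The sign s = 1 gives the gap, and s = -1 the positivity below. *)
Lemma abel_energy_lim_ge phi s k : s ^+ 2 = 1 -> circle_lift phi -> mu2.-integrable circ2 (EFin \o log_integrand phi) ->
  fourier_sqr phi s k.+1 / k.+1%:R <= log_energy phi - s * log_energy (@id R).
Proof.
move=> s2 lphi iL; rewrite log_energy_id -(arg_integral_lift lphi).
have h := abel_energy_cvg s2 lphi iL.
apply: (ler_cvg_to (@radiusX_cvg k.+1 _) h); apply: nearW => n.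
rewrite (_ : _ * _ = radius R n ^+ k.+1 / k.+1%:R * fourier_sqr phi s k.+1); last by ring.
by apply: abel_energy_ge => //; exact: radius01.
Qed.

(** The sign -1 for the identity itself: B_1 = 2 pi yields (2 pi)^2 <= 2 [log_energy id]. *)
Lemma log_energy_id_gt0 : 0 < log_energy (@id R).
Proof.
have := @abel_energy_lim_ge (@id R) (-1) 0 _ (lift_id R) log_integrand_id_int.
rewrite sqrrN expr1n fourier_sqrN_id mulN1r opprK divr1 => /(_ erefl) h.
have : 0 < (2 * pi) ^+ 2 :> R by rewrite exprn_gt0// mulr_gt0// pi_gt0.
lra.
Qed.

Lemma energy_gap phi k : circle_lift phi -> mu2.-integrable circ2 (EFin \o log_integrand phi) ->
  log_energy (@id R) + fourier_sqr phi 1 k.+1 / k.+1%:R <= log_energy phi.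
Proof.
move=> lphi iL; have := abel_energy_lim_ge k (expr1n R 2) lphi iL.
by rewrite mul1r lerBrDl.
Qed.

(* Otherwise the energies of [phi] and of the identity would be opposite. *)
Lemma fourier_sqrN_neq0 phi : circle_lift phi -> mu2.-integrable circ2 (EFin \o log_integrand phi) ->
  exists k, fourier_sqr phi (-1) k.+1 != 0.
Proof.
move=> lphi iL; apply: contrapT => nex.
have s2 : (-1) ^+ 2 = 1 :> R by rewrite sqrrN expr1n.
have A0 k : fourier_sqr phi (-1) k.+1 = 0.
  by apply/eqP; apply: contrapT => h; apply: nex; exists k; apply/negP.
have h := abel_energy_cvg s2 lphi iL.
have e : (fun n => abel_energy phi (-1) (radius R n)) = cst 0.
  by apply/funext => n /=; rewrite (abel_energy_eq0 (radius01 R n) s2 lphi A0).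
rewrite e in h; have : I2 (log_integrand phi) - -1 * arg_integral phi = 0.
  by apply: (@cvg_unique _ (@Rhausdorff R) _ _ _ _ h); exact: cvg_cst.
rewrite (arg_integral_lift lphi) -log_energy_id mulN1r opprK => e0.
have := energy_gap 0 lphi iL; have := log_energy_id_gt0; have := fourier_sqr_ge0 phi 1 1.
rewrite divr1 /log_energy; rewrite /log_energy in e0; lra.
Qed.

End Gap.

(** * The conformal energy of a map expressed through its lift *)

Section ConformalEnergy.
Context (R : realType).
Notation mu := (@lebesgue_measure R).
Notation mu2 := (mu \x mu)%E.
Implicit Types (phi : R -> R) (p : R * R) (r s : R) (g : R[i] -> R[i]).

Lemma ln_normc_expi (a b : R) :
  ln (ComplexField.Normc.normc (expi a - expi b)) = - log_kernel 1 (a - b).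
Proof.
rewrite /expi /log_kernel opprK /=.
have -> : (cos a - cos b) ^+ 2 + (sin a - sin b) ^+ 2 = poisson_den 1 (a - b).
  rewrite poisson_den1E cosB; have := cos2Dsin2 a; have := cos2Dsin2 b; lra.
have q0 : 0 <= poisson_den 1 (a - b) by rewrite poisson_den1E mulr_ge0// subr_ge0 cos_le1.
(* For coinciding points both sides are 0, since [ln 0 = 0]. *)
move: q0; rewrite le_eqVlt => /predU1P[<-|q0]; first by rewrite sqrtr0 ln0// mul0r.
have s0 : 0 < Num.sqrt (poisson_den 1 (a - b)) by rewrite sqrtr_gt0.
have -> : ln (poisson_den 1 (a - b)) = 2 * ln (Num.sqrt (poisson_den 1 (a - b))).
  by rewrite -{1}(sqr_sqrtr (ltW q0)) lnXn// mulr_natl.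
by field.
Qed.

Lemma energy_integral phi g : (forall t, g (expi t) = expi (phi t)) ->
  conformal_energy g = ((- (2 * pi ^+ 2)^-1)%:E * \int[mu2]_(p in circ2) (- log_integrand phi p)%:E)%E.
Proof.
move=> gphi; rewrite /conformal_energy; congr (_ * _)%E.
by apply: eq_integral => p _; rewrite !gphi ln_normc_expi /log_integrand mulNr.
Qed.

Definition energy_const : R := (2 * pi ^+ 2)^-1.

Lemma energy_const_gt0 : 0 < energy_const.
Proof. by rewrite invr_gt0 mulr_gt0// exprn_gt0// pi_gt0. Qed.

Lemma energyE phi g : (forall t, g (expi t) = expi (phi t)) ->
  mu2.-integrable circ2 (EFin \o log_integrand phi) ->
  conformal_energy g = (energy_const * log_energy phi)%:E.
Proof.
move=> gphi iL; rewrite (energy_integral gphi).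
have -> : (\int[mu2]_(p in circ2) (- log_integrand phi p)%:E = - (\int[mu2]_(p in circ2) (log_integrand phi p)%:E))%E.
  have iN : mu2.-integrable circ2 (EFin \o (fun p => - log_integrand phi p)).
    by apply: integrableN_EFin => //; exact: measurable_circ2.
  rewrite (EFin_I2 iN) (EFin_I2 iL) -EFinN; congr EFin; rewrite -mulN1r /I2.
  rewrite -RintegralZl//; last exact: measurable_circ2.
  by apply: eq_Rintegral => p _; rewrite mulN1r.
by rewrite (EFin_I2 iL) -EFinN -EFinM mulrNN.
Qed.

(** The integrand is bounded above, so its positive part has a finite integral. An infinite negative
    part would make the integral -oo and the energy +oo. *)
Lemma energy_lt_integrable phi g : circle_lift phi -> (forall t, g (expi t) = expi (phi t)) ->
  (conformal_energy g < +oo)%E -> mu2.-integrable circ2 (EFin \o log_integrand phi).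
Proof.
move=> lphi gphi; rewrite (energy_integral gphi) => fin.
have [C HC] := log_kernel_cos_ge lphi.
have mL : measurable_fun circ2 (log_integrand phi) by apply: measurable_funTS; exact: measurable_log_kernel_cos.
have mE : measurable_fun circ2 (EFin \o (fun p => - log_integrand phi p)).
  by apply/measurable_EFinP; exact: measurableT_comp.
have LC p : circ2 p -> - log_integrand phi p <= C.
  by move=> sp; rewrite lerNl; apply: HC => //; lra.
pose F := EFin \o (fun p => - log_integrand phi p).
have mpos : (\int[mu2]_(p in circ2) F^\+ p < +oo)%E.
  apply: (@le_lt_trans _ _ (\int[mu2]_(p in circ2) (`|C|%:E)))%E; last first.
    rewrite integral_cst; last exact: measurable_circ2.
    by rewrite lte_mul_pinfty// circ2_fin.
  apply: ge0_le_integral => //.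
  - exact: measurable_circ2.
  - exact: measurable_funepos.
  - move=> p sp; rewrite /F funeposE /= -EFin_max lee_fin ge_max normr_ge0 andbT.
    by rewrite (le_trans (LC _ sp))// ler_norm.
have ppos : (\int[mu2]_(p in circ2) F^\+ p)%E \is a fin_num.
  by rewrite ge0_fin_numE//; apply: integral_ge0.
have mneg : (\int[mu2]_(p in circ2) F^\- p < +oo)%E.
  rewrite ltey; apply/eqP => ni.
  have e : (\int[mu2]_(p in circ2) (- log_integrand phi p)%:E = -oo)%E.
    by rewrite integralE -/F ni -(fineK ppos).
  move: fin; rewrite e mulrNy ltr0_sg; last by rewrite oppr_lt0 energy_const_gt0.
  by rewrite EFinN mulN1e.
have iF : mu2.-integrable circ2 (EFin \o (fun p => - log_integrand phi p)).
  apply/integrableP; split => //.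
  have -> : (\int[mu2]_(p in circ2) `|F p| =
    \int[mu2]_(p in circ2) F^\+ p + \int[mu2]_(p in circ2) F^\- p)%E.
    rewrite -ge0_integralD//.
    - by apply: eq_integral => p _; rewrite -[LHS]/((abse \o F) p) fune_abse.
    - exact: measurable_circ2.
    - exact: measurable_funepos.
    - exact: measurable_funeneg.
  exact: lte_add_pinfty.
have : mu2.-integrable circ2 (EFin \o (fun p => - - log_integrand phi p)).
  by apply: integrableN_EFin => //; exact: measurable_circ2.
by congr (_.-integrable _ _); apply/funext => p /=; rewrite opprK.
Qed.

End ConformalEnergy.

(** * Variations of a lift *)

Section Variation.
Context (R : realType).
Notation mu := (@lebesgue_measure R).
Notation mu2 := (mu \x mu)%E.
Implicit Types (phi : R -> R) (p : R * R) (j n : nat).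

(** The derivative is bounded on a symmetric interval around 0, so that the quadratic estimates
    below follow by taking one end point 0 and [M] = |w|. *)
Lemma le_dist_derive (f f' : R -> R) (M a b : R) : (forall x : R, is_derive x 1 f (f' x)) ->
  (forall x, `|x| <= Num.max `|a| `|b| -> `|f' x| <= M) -> `|f a - f b| <= M * `|a - b|.
Proof.
move=> df; wlog ab : a b / a <= b => [H bM|bM].
  have [ab|/ltW ba] := leP a b; first exact: H.
  by rewrite distrC (distrC a); apply: H => // x; rewrite maxC; exact: bM.
have cf : {within `[a, b], continuous f}.
  apply: derivable_within_continuous => x _; by case: (df x).
have [c /[!in_itv]/= /andP[ac cb]] := MVT_segment ab (fun x _ => df x) cf.
rewrite distrC (distrC a) => ->; rewrite normrM; apply: ler_wpM2r => //; apply: bM.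
rewrite le_max; have [c0|c0] := leP 0 c.
  by rewrite (ger0_norm c0) (le_trans cb (ler_norm b)) orbT.
have : `|c| <= `|a| by rewrite (ltr0_norm c0); have := ler_norm (- a); rewrite normrN; lra.
by move=> ->.
Qed.

Lemma dist_sin_le (a b : R) : `|sin a - sin b| <= `|a - b|.
Proof.
rewrite -[leRHS]mul1r; by apply: (@le_dist_derive _ (@cos R)) => x _; exact: cos_max.
Qed.

Lemma dist_cos_le (a b : R) : `|cos a - cos b| <= `|a - b|.
Proof.
rewrite -[leRHS]mul1r; by apply: (@le_dist_derive _ (fun x : R => - sin x)) => x _; rewrite normrN sin_max.
Qed.

Lemma one_sub_cos_le (w : R) : `|1 - cos w| <= w ^+ 2.
Proof.
have := @le_dist_derive (@cos R) (fun x => - sin x) `|w| 0 w (fun x => is_derive_cos x).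
rewrite cos0 sub0r normrN -expr2 -normrX (ger0_norm (sqr_ge0 _)); apply => x.
rewrite normr0 max_r// => xw; rewrite normrN; apply: le_trans xw.
by have := dist_sin_le x 0; rewrite sin0 !subr0.
Qed.

Lemma sin_sub_le (w : R) : `|sin w - w| <= w ^+ 2.
Proof.
have dF (x : R) : is_derive x 1 (@sin R - @id R) (cos x - 1) by apply: is_deriveB.
have := @le_dist_derive _ (fun x => cos x - 1) `|w| w 0 dF.
rewrite !fctE sin0 !subr0 -expr2 -normrX (ger0_norm (sqr_ge0 _)); apply => x.
rewrite normr0 max_l// => xw; apply: le_trans xw.
by have := dist_cos_le x 0; rewrite cos0 subr0.
Qed.

Lemma ln1D_le (x : R) : `|x| <= 2^-1 -> `|ln (1 + x) - x| <= 2 * x ^+ 2.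
Proof.
rewrite ler_norml => /andP[x0 x1].
have h1 : ln (1 + x) <= x by apply: le_ln1Dx; lra.
have p1 : 0 < 1 + x by lra.
(* The lower bound is the upper one applied to 1 / (1 + x). *)
have h2 : ln (1 + - (x / (1 + x))) <= - (x / (1 + x)).
  apply: le_ln1Dx; rewrite ltrN2 ltr_pdivrMr//; lra.
have e : 1 + - (x / (1 + x)) = (1 + x)^-1 by field; rewrite gt_eqF.
rewrite e lnV ?posrE// in h2.
have h3 : x - 2 * x ^+ 2 <= x / (1 + x).
  rewrite ler_pdivlMr//; have := sqr_ge0 x; rewrite !expr2; nra.
by rewrite ler_norml; apply/andP; split; have := sqr_ge0 x; lra.
Qed.

Section Field.
Context (r q : R) (n : nat).

(** Real part of (r + i q) e^(it), and [wave_sin] is the imaginary part; r + i q is the coefficient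
    c of the vector field. *)
Definition wave_cos (mixed_phase : R) := r * cos mixed_phase - q * sin mixed_phase.
Definition wave_sin (mixed_phase : R) := r * sin mixed_phase + q * cos mixed_phase.
Definition vfield (x : R) := wave_sin (n%:R * x).
(** Leads from n y at j = 0 to n x at j = n in steps of x - y. *)
Definition mixed_phase (x y : R) (j : nat) : R := j%:R * x + (n%:R - j%:R) * y.
(** Off the diagonal this is (v x - v y) cot ((x - y) / 2) / 2, minus the first variation of
    [log_kernel 1]. As a trigonometric polynomial it is bounded and makes sense on the diagonal too,
    and its integral reduces to products A_j B_k. *)
Definition vfield_quot (x y : R) := 2^-1 * \sum_(j < n) (wave_cos (mixed_phase x y j.+1) + wave_cos (mixed_phase x y j)).
(** One constant for the bound of [vfield_quot], for [vfield_sqr] and for the Lipschitz estimate of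
    [vfield]; the summand 1 keeps it away from 0. *)
Definition vfield_bound := n%:R * (`|r| + `|q|) + 1.

Lemma mixed_phaseS x y j : mixed_phase x y j.+1 = mixed_phase x y j + (x - y).
Proof. by rewrite /mixed_phase -natr1; ring. Qed.

Lemma vfield_sum x y : vfield x - vfield y = \sum_(j < n) (wave_sin (mixed_phase x y j.+1) - wave_sin (mixed_phase x y j)).
Proof.
rewrite -(big_mkord xpredT (fun j => wave_sin (mixed_phase x y j.+1) - wave_sin (mixed_phase x y j))) telescope_sumr//.
by rewrite /vfield /mixed_phase; congr (wave_sin _ - wave_sin _); ring.
Qed.

(** For a single telescoping step, half angles give (S (t + u) - S t) sin u = (C (t + u) + C t) (1 -
    cos u), where S and C are [wave_sin] and [wave_cos]. *)
Lemma vfield_vfield_quot x y : (vfield x - vfield y) * sin (x - y) = 2 * vfield_quot x y * (1 - cos (x - y)).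
Proof.
rewrite vfield_sum /vfield_quot mulrA mulfV ?mul1r// !mulr_suml; apply: eq_bigr => j _.
rewrite mixed_phaseS; set t := mixed_phase x y j; set u := x - y.
have e : sin u * sin u = (1 - cos u) * (1 + cos u) by rewrite -expr2 sqr_cos_sin; ring.
rewrite /wave_sin /wave_cos sinD cosD.
have -> : (r * (sin t * cos u + cos t * sin u) + q * (cos t * cos u - sin t * sin u) -
  (r * sin t + q * cos t)) * sin u = (r * cos t - q * sin t) * (sin u * sin u) -
  (r * sin t + q * cos t) * (1 - cos u) * sin u by ring.
by rewrite e; ring.
Qed.

Lemma vfield_quot_le x y : `|vfield_quot x y| <= vfield_bound.
Proof.
rewrite /vfield_quot /vfield_bound normrM (ger0_norm (_ : 0 <= 2^-1 :> R))//.
have hC t : `|wave_cos t| <= `|r| + `|q|.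
  rewrite (le_trans (ler_normB _ _))// !normrM lerD// ler_piMr// ?cos_max ?sin_max//.
have : `|\sum_(j < n) (wave_cos (mixed_phase x y j.+1) + wave_cos (mixed_phase x y j))| <= \sum_(j < n) (2 * (`|r| + `|q|)).
  apply: (le_trans (ler_norm_sum _ _ _)); apply: ler_sum => j _.
  by rewrite (le_trans (ler_normD _ _))// mulrDl mul1r lerD.
rewrite sumr_const card_ord -mulr_natl; lra.
Qed.

(** Each of the [n] telescoping steps is at most |c| times the chord |e^(iu) - 1|. The factor 1 -
    cos u is what allows a division by it in [log_kernel1_variation]. *)
Lemma vfield_sqr x y : (vfield x - vfield y) ^+ 2 <= 2 * vfield_bound ^+ 2 * (1 - cos (x - y)).
Proof.
set u := x - y; pose K := (r ^+ 2 + q ^+ 2) * (2 * (1 - cos u)).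
have c1 : 0 <= 1 - cos u by rewrite subr_ge0 cos_le1.
have K0 : 0 <= K by rewrite mulr_ge0 ?addr_ge0 ?sqr_ge0 ?mulr_ge0.
have step j : `|wave_sin (mixed_phase x y j.+1) - wave_sin (mixed_phase x y j)| <= Num.sqrt K.
  rewrite -sqrtr_sqr ler_wsqrtr// mixed_phaseS -/u; set t := mixed_phase x y j.
  have -> : wave_sin (t + u) - wave_sin t = - wave_sin t * (1 - cos u) + wave_cos t * sin u.
    by rewrite /wave_sin /wave_cos sinD cosD; ring.
  have e1 : wave_sin t ^+ 2 + wave_cos t ^+ 2 = r ^+ 2 + q ^+ 2.
    transitivity ((r ^+ 2 + q ^+ 2) * (cos t ^+ 2 + sin t ^+ 2)); first by rewrite /wave_sin /wave_cos; ring.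
    by rewrite cos2Dsin2 mulr1.
  have e2 : (1 - cos u) ^+ 2 + sin u ^+ 2 = 2 * (1 - cos u) by rewrite sqr_cos_sin; ring.
  rewrite /K -e1 -e2 -subr_ge0.
  (* Lagrange's identity, which gives the Cauchy-Schwarz inequality. *)
  rewrite (_ : _ - _ = (wave_sin t * sin u + wave_cos t * (1 - cos u)) ^+ 2); last by ring.
  exact: sqr_ge0.
have h : `|vfield x - vfield y| <= n%:R * Num.sqrt K.
  rewrite vfield_sum; apply: (le_trans (ler_norm_sum _ _ _)).
  have -> : n%:R * Num.sqrt K = \sum_(j < n) Num.sqrt K by rewrite sumr_const card_ord mulr_natl.
  by apply: ler_sum => j _; exact: step.
rewrite -real_normK ?num_real//.
have : `|vfield x - vfield y| ^+ 2 <= (n%:R * Num.sqrt K) ^+ 2.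
  by rewrite lerXn2r// ?nnegrE ?mulr_ge0// sqrtr_ge0.
move=> h2; apply: le_trans h2 _; rewrite exprMn sqr_sqrtr// /K.
rewrite mulrA [leRHS](_ : _ = vfield_bound ^+ 2 * (2 * (1 - cos u))); last by ring.
apply: ler_wpM2r; first by rewrite mulr_ge0.
apply: (@le_trans _ _ ((n%:R * (`|r| + `|q|)) ^+ 2)).
  rewrite exprMn ler_wpM2l ?sqr_ge0// sqrrD !real_normK ?num_real//.
  by rewrite lerD2r lerDl mulrn_wge0// mulr_ge0.
by rewrite lerXn2r// ?nnegrE ?addr_ge0 ?mulr_ge0 ?addr_ge0// /vfield_bound lerDl.
Qed.

Lemma vfield_bound_ge1 : 1 <= vfield_bound.
Proof. by rewrite /vfield_bound lerDr mulr_ge0 ?addr_ge0. Qed.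

(* With [w = tau (v x - v y)], the quotient of [1 - cos (x - y + w)] by
   [1 - cos (x - y)] is [1 + 2 tau Q + O(tau^2)] uniformly in [x, y]. *)
Lemma log_kernel1_variation x y (tau : R) : cos (x - y) != 1 -> 0 <= tau -> 16 * tau * vfield_bound <= 1 ->
  `|log_kernel 1 (x - y + tau * (vfield x - vfield y)) - log_kernel 1 (x - y) + tau * vfield_quot x y| <= 11 * vfield_bound ^+ 2 * tau ^+ 2.
Proof.
set u := x - y; set w := tau * _ => cu t0 tM.
have M1 := vfield_bound_ge1.
have c0 : 0 < 1 - cos u by rewrite subr_gt0 lt_neqAle cu cos_le1.
(* The second-order part of 1 - cos (u + w), relative to 1 - cos u; the first-order part w sin u is
   2 tau Q (1 - cos u). *)
pose err := (cos u * (1 - cos w) + sin u * (sin w - w)) / (1 - cos u).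
have w2 : w ^+ 2 <= 2 * vfield_bound ^+ 2 * tau ^+ 2 * (1 - cos u).
  rewrite /w exprMn; have := vfield_sqr x y; rewrite -/u => h.
  rewrite [leRHS](_ : _ = tau ^+ 2 * (2 * vfield_bound ^+ 2 * (1 - cos u))); last by ring.
  by apply: ler_wpM2l h; exact: sqr_ge0.
have err_le : `|err| <= 4 * vfield_bound ^+ 2 * tau ^+ 2.
  rewrite /err normrM normfV (gtr0_norm c0) ler_pdivrMr//.
  apply: (@le_trans _ _ (w ^+ 2 + w ^+ 2)); last by lra.
  apply: le_trans (ler_normD _ _) _; rewrite !normrM; apply: lerD.
    rewrite -[leRHS]mul1r; apply: ler_pM => //; [exact: cos_max|exact: one_sub_cos_le].
  by rewrite -[leRHS]mul1r; apply: ler_pM => //; [exact: sin_max|exact: sin_sub_le].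
pose z := 2 * tau * vfield_quot x y + err.
have qE : poisson_den 1 (u + w) = poisson_den 1 u * (1 + z).
  have h := vfield_vfield_quot x y; rewrite -/u in h.
  have e : w * sin u = 2 * tau * vfield_quot x y * (1 - cos u) by rewrite /w -mulrA h; ring.
  rewrite !poisson_den1E /z /err cosD.
  rewrite -[2 * tau * vfield_quot x y](mulfK (lt0r_neq0 c0)) -e; field.
  exact: lt0r_neq0.
have tQ : `|tau * vfield_quot x y| <= tau * vfield_bound.
  by rewrite normrM (ger0_norm t0); apply: ler_wpM2l => //; exact: vfield_quot_le.
have tM0 : 0 <= tau * vfield_bound by rewrite mulr_ge0//; lra.
have tM2 : vfield_bound ^+ 2 * tau ^+ 2 = (tau * vfield_bound) ^+ 2 by ring.
have z3 : `|z| <= 3 * (tau * vfield_bound).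
  apply: le_trans (ler_normD _ _) _; rewrite -mulrA normrM (ger0_norm (_ : 0 <= 2 :> R))//.
  have : 4 * vfield_bound ^+ 2 * tau ^+ 2 <= tau * vfield_bound by rewrite -mulrA tM2 expr2; nra.
  lra.
have z2 : `|z| <= 2^-1 by lra.
have zz : z ^+ 2 <= 9 * (vfield_bound ^+ 2 * tau ^+ 2).
  rewrite tM2 -real_normK ?num_real// (_ : 9 * _ = (3 * (tau * vfield_bound)) ^+ 2); last by ring.
  by rewrite lerXn2r// nnegrE// mulr_ge0.
have p1 : 0 < 1 + z by move: z2; rewrite ler_norml => /andP[]; lra.
(* In units of M^2 tau^2 the logarithm contributes 2 * 9 and [err] contributes 4; half of the sum is
   11. *)
have hl := ln1D_le z2.
rewrite /log_kernel qE lnM ?posrE//; last by rewrite poisson_den1E mulr_gt0.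
rewrite (_ : _ + _ = - (2^-1 * ((ln (1 + z) - z) + err))); last by rewrite /z; field.
rewrite normrN normrM (ger0_norm (_ : 0 <= 2^-1 :> R))//.
have := ler_normD (ln (1 + z) - z) err; lra.
Qed.

End Field.
End Variation.

(** * The energy along a deformation *)

Section VariationEnergy.
Context (R : realType).
Notation mu := (@lebesgue_measure R).
Notation mu2 := (mu \x mu)%E.
Implicit Types (phi : R -> R) (p : R * R) (j n : nat).

Lemma I2_le_ae (F G : R * R -> R) : bmeas circ2 F -> bmeas circ2 G ->
  (forall p, circ2 p -> ~ exc_set p -> F p <= G p) -> I2 F <= I2 G.
Proof.
move=> bF bG FG.
pose E p := if p \in @exc_set R then 0 else 1 : R.
have bE : bmeas circ2 E.
  split; last by exists 1 => p _; rewrite /E; case: ifP; rewrite ?normr0 ?normr1.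
  apply: measurable_funTS.
  have -> : E = cst 1 \- \1_exc_set.
    by apply/funext => p /=; rewrite /E indicE; case: (p \in exc_set); rewrite ?subrr ?subr0.
  by apply: measurable_funB => //; apply: measurable_indic; exact: measurable_exc_set.
have EE H : bmeas circ2 H -> I2 H = I2 (fun p => E p * H p).
  move=> bH; apply: eq_I2_ae => //; first exact: bmeasM.
  by move=> p _ np; rewrite /E memNset// mul1r.
rewrite (EE F bF) (EE G bG); apply: I2_le; [exact: bmeasM|exact: bmeasM|].
move=> p sp; rewrite /E; case: ifPn => [_|/negP np]; first by rewrite !mul0r.
by rewrite !mul1r; apply: FG => // ep; apply: np; exact: mem_set.
Qed.

Lemma norm_I2_le_ae (F G : R * R -> R) : bmeas circ2 F -> bmeas circ2 G ->
  (forall p, circ2 p -> ~ exc_set p -> `|F p| <= G p) -> `|I2 F| <= I2 G.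
Proof.
move=> bF bG FG; rewrite ler_norml; apply/andP; split.
  rewrite -(mulN1r (I2 G)) -I2Z//; apply: I2_le_ae => //; first by apply: bmeasM => //; exact: bmeas_cst.
  by move=> p sp np; rewrite mulN1r; have := FG _ sp np; rewrite ler_norml => /andP[].
by apply: I2_le_ae => // p sp np; rewrite (le_trans (ler_norm _))// FG.
Qed.

Section Field.
Context (r q : R) (n : nat).
Notation vfield := (vfield r q n).
Notation vfield_quot := (vfield_quot r q n).
Notation vfield_bound := (vfield_bound r q n).

Definition deform (tau : R) (x : R) := x + tau * vfield x.

Lemma vfield_lip x y : `|vfield x - vfield y| <= vfield_bound * `|x - y|.
Proof.
have e : vfield x - vfield y = r * (sin (n%:R * x) - sin (n%:R * y)) + q * (cos (n%:R * x) - cos (n%:R * y)).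
  by rewrite /vfield /wave_sin; ring.
have d : `|n%:R * x - n%:R * y| = n%:R * `|x - y| by rewrite -mulrBr normrM ger0_norm.
have h1 := dist_sin_le (n%:R * x) (n%:R * y); have h2 := dist_cos_le (n%:R * x) (n%:R * y).
rewrite d in h1 h2; rewrite e; apply: (le_trans (ler_normD _ _)); rewrite !normrM /vfield_bound.
have e1 := ler_wpM2l (normr_ge0 r) h1; have e2 := ler_wpM2l (normr_ge0 q) h2.
have := normr_ge0 (x - y); lra.
Qed.

Lemma continuous_vfield : continuous vfield.
Proof.
move=> x; have h : n%:R * z @[z --> x] --> n%:R * x by apply: cvgM; [exact: cvg_cst|exact: cvg_id].
apply: cvgD; (apply: cvgM; first exact: cvg_cst).
  exact: (cvg_comp _ _ h (@continuous_sin R _)).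
exact: (cvg_comp _ _ h (@continuous_cos R _)).
Qed.

Lemma vfield_per x : vfield (x + 2 * pi) = vfield x.
Proof. by rewrite /vfield /wave_sin mulrDr cos_per sin_per. Qed.

(** The added term has Lipschitz constant at most 1/16 in [phi], so the sum is still increasing. *)
Lemma deform_lift phi tau : circle_lift phi -> 0 <= tau -> 16 * tau * vfield_bound <= 1 ->
  circle_lift (fun t => deform tau (phi t)).
Proof.
move=> [c inc per] t0 tM; split.
- move=> t; apply: cvgD; first exact: c.
  apply: cvgM; first exact: cvg_cst.
  have cv := @continuous_vfield (phi t).
  exact: (cvg_comp phi vfield (c t) cv).
- move=> x y /inc xy; rewrite /deform.
  have d : `|phi x - phi y| = phi y - phi x by rewrite ltr0_norm ?subr_lt0// opprB.
  have h := vfield_lip (phi x) (phi y); rewrite d in h.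
  have h2 := ler_wpM2l t0 (le_trans (ler_norm _) h).
  have xy0 : 0 <= phi y - phi x by rewrite subr_ge0 ltW.
  have h3 := ler_wpM2r xy0 tM; lra.
- by move=> t; rewrite /deform per vfield_per; ring.
Qed.

Context (phi : R -> R) (lphi : circle_lift phi).
Context (iL : mu2.-integrable circ2 (EFin \o log_integrand phi)).

(* Minus the derivative at [tau = 0] of the energy of [deform tau \o phi]. *)
Definition vfield_moment p := vfield_quot (phi p.1) (phi p.2) * cos (arg_diff p).

Lemma bmeas_phase2 (f : R -> R) (a b c d : R) : (forall m, measurable_fun circ2 m -> bmeas circ2 (fun p => f (m p))) ->
  bmeas circ2 (fun p => f (a * phi p.1 + b * phi p.2 + c * p.1 + d * p.2)).
Proof.
move=> H; apply: H; apply: measurable_funTS.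
have mphi := measurable_lift lphi.
have m1 := measurableT_comp mphi measurable_fst; have m2 := measurableT_comp mphi measurable_snd.
apply: measurable_funD.
  apply: measurable_funD.
    by apply: measurable_funD; apply: measurable_funM => //; [exact: m1|exact: m2].
  by apply: measurable_funM => //; exact: measurable_fst.
by apply: measurable_funM => //; exact: measurable_snd.
Qed.

Lemma bmeas_wave_cos j : bmeas circ2 (fun p => wave_cos r q (mixed_phase n (phi p.1) (phi p.2) j)).
Proof.
have e p : mixed_phase n (phi p.1) (phi p.2) j = j%:R * phi p.1 + (n%:R - j%:R) * phi p.2 + 0 * p.1 + 0 * p.2.
  by rewrite /mixed_phase; ring.
have bc := bmeas_phase2 j%:R (n%:R - j%:R) 0 0 (@bmeas_cos _ _ R circ2).
have bs := bmeas_phase2 j%:R (n%:R - j%:R) 0 0 (@bmeas_sin _ _ R circ2).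
rewrite /wave_cos; under eq_fun do rewrite e.
by apply: bmeasB; apply: bmeasM => //; exact: bmeas_cst.
Qed.

Lemma bmeas_vfield_moment : bmeas circ2 vfield_moment.
Proof.
apply: bmeasM; last exact: bmeas_cos_arg_diff.
apply: bmeasM; first exact: bmeas_cst.
by apply: bmeas_sum => j; apply: bmeasD; exact: bmeas_wave_cos.
Qed.

(** Both integrands may be unbounded, but by [log_kernel1_variation] their difference is bounded.
    Integrability thus passes to the deformed lift, and the pointwise estimate can be integrated. *)
Lemma energy_variation tau : 0 <= tau -> 16 * tau * vfield_bound <= 1 ->
  let phit := fun t => deform tau (phi t) in
  mu2.-integrable circ2 (EFin \o log_integrand phit) /\
  `|log_energy phit - log_energy phi + tau * I2 vfield_moment| <= (2 * pi) ^+ 2 * (11 * vfield_bound ^+ 2) * tau ^+ 2.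
Proof.
move=> t0 tM phit; have lt := deform_lift lphi t0 tM.
pose D p := log_integrand phit p - log_integrand phi p.
have dE p : lift_diff phit p = lift_diff phi p + tau * (vfield (phi p.1) - vfield (phi p.2)).
  by rewrite /lift_diff /phit /deform; ring.
have hD p : cos (lift_diff phi p) != 1 -> `|D p + tau * vfield_moment p| <= 11 * vfield_bound ^+ 2 * tau ^+ 2.
  move=> cp; rewrite /D /log_integrand dE /vfield_moment.
  rewrite (_ : _ + _ = (log_kernel 1 (lift_diff phi p + tau * (vfield (phi p.1) - vfield (phi p.2))) - log_kernel 1 (lift_diff phi p)
    + tau * vfield_quot (phi p.1) (phi p.2)) * cos (arg_diff p)); last by ring.
  rewrite normrM -[leRHS]mulr1; apply: ler_pM => //; last exact: cos_max.
  exact: log_kernel1_variation.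
(* Where the images coincide [vfield_sqr] forces equal values of the field, so [D] is bounded on the
   whole square. *)
have hD0 p : cos (lift_diff phi p) = 1 -> D p = 0.
  move=> cp; rewrite /D /log_integrand dE.
  have : (vfield (phi p.1) - vfield (phi p.2)) ^+ 2 <= 0.
    by have := vfield_sqr r q n (phi p.1) (phi p.2); rewrite -/(lift_diff phi p) cp subrr mulr0.
  move=> h; have /eqP -> : vfield (phi p.1) - vfield (phi p.2) == 0 by rewrite -sqrf_eq0 eq_le h sqr_ge0.
  by rewrite mulr0 addr0 subrr.
have bD : bmeas circ2 D.
  split.
    by apply: measurable_funTS; apply: measurable_funB; exact: measurable_log_kernel_cos.
  have [_ [M HM]] := bmeas_vfield_moment.
  exists (11 * vfield_bound ^+ 2 * tau ^+ 2 + tau * M) => p sp.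
  have hQ : tau * `|vfield_moment p| <= tau * M by apply: ler_wpM2l => //; exact: HM.
  have Q0 : 0 <= tau * `|vfield_moment p| by rewrite mulr_ge0.
  have [cp|cp] := eqVneq (cos (lift_diff phi p)) 1.
    rewrite hD0// normr0; apply: addr_ge0; last exact: le_trans hQ.
    by rewrite mulr_ge0 ?sqr_ge0// mulr_ge0 ?sqr_ge0.
  have -> : D p = (D p + tau * vfield_moment p) - tau * vfield_moment p by ring.
  apply: (le_trans (ler_normB _ _)); apply: lerD; first exact: hD.
  by rewrite normrM (ger0_norm t0).
have iLt : mu2.-integrable circ2 (EFin \o log_integrand phit).
  have iD := bmeas_circ2_int bD.
  have : mu2.-integrable circ2 (EFin \o (fun p => log_integrand phi p + D p)).
    by apply: integrableD_EFin => //; exact: measurable_circ2.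
  by congr (_.-integrable _ _); apply/funext => p /=; rewrite /D addrC subrK.
split => //.
have e : log_energy phit - log_energy phi = I2 D.
  rewrite /log_energy /I2 -RintegralB//; exact: measurable_circ2.
have btQ : bmeas circ2 (fun p => tau * vfield_moment p) by apply: bmeasM; [exact: bmeas_cst|exact: bmeas_vfield_moment].
rewrite e -I2Z; last exact: bmeas_vfield_moment.
rewrite -I2D// -mulrA -I2c.
apply: norm_I2_le_ae; [exact: bmeasD|exact: bmeas_cst|].
by move=> p sp np; apply: hD; exact: cos_lift_diff_neq1.
Qed.

End Field.
End VariationEnergy.

(** * A direction of descent *)

Section Descent.
Context (R : realType).
Notation mu := (@lebesgue_measure R).
Notation mu2 := (mu \x mu)%E.
Implicit Types (p : R * R) (j n : nat).
Context (phi : R -> R) (lphi : circle_lift phi).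

(* Real and imaginary parts of [A_j B_k], where [A_j] and [B_k] are the Fourier
   integrals of signs [s] and [- s]. *)
Definition ReZ (s : R) (j k : nat) := fourier_cos phi s j * fourier_cos phi (- s) k - fourier_sin phi s j * fourier_sin phi (- s) k.
Definition ImZ (s : R) (j k : nat) := fourier_sin phi s j * fourier_cos phi (- s) k + fourier_cos phi s j * fourier_sin phi (- s) k.

Lemma bmeas_lin2 (j k : nat) (s : R) :
  measurable_fun circ2 (fun p : R * R => (j%:R * phi p.1 + s * p.1) + (k%:R * phi p.2 + - s * p.2)).
Proof.
have mphi := measurable_lift lphi.
have m1 := measurableT_comp mphi measurable_fst; have m2 := measurableT_comp mphi measurable_snd.
apply: measurable_funTS; apply: measurable_funD; apply: measurable_funD; apply: measurable_funM => //.
- exact: m1.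
- exact: m2.
Qed.

(** The weight cos (x - y) shifts the phase j phi x + k phi y by x - y or by its opposite, and each
    shifted exponential separates: into A_j B_k in the first case, into B_j A_k in the second. *)
Lemma I2_wave_cos (r q : R) (j k : nat) :
  I2 (fun p => wave_cos r q (mixed_phase (j + k) (phi p.1) (phi p.2) j) * cos (arg_diff p)) =
  2^-1 * (r * (ReZ 1 j k + ReZ (-1) j k) - q * (ImZ 1 j k + ImZ (-1) j k)).
Proof.
have mp s i := measurable_phase i%:R s lphi.
have bc s := bmeas_cos (bmeas_lin2 j k s); have bs s := bmeas_sin (bmeas_lin2 j k s).
rewrite /ReZ /ImZ /fourier_cos /fourier_sin -!I2_cos// -!I2_sin//.
rewrite -(I2D (bc 1) (bc (-1))) -(I2D (bs 1) (bs (-1))).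
have bc2 := bmeasD (bc 1) (bc (-1)); have bs2 := bmeasD (bs 1) (bs (-1)).
rewrite -(I2Z r bc2) -(I2Z q bs2).
have b1 := bmeasM (bmeas_cst circ2 r) bc2; have b2 := bmeasM (bmeas_cst circ2 q) bs2.
rewrite -(I2B b1 b2) -(I2Z 2^-1 (bmeasB b1 b2)).
apply: eq_I2 => p _; rewrite /cst.
have -> : j%:R * phi p.1 + 1 * p.1 + (k%:R * phi p.2 + - 1 * p.2) = mixed_phase (j + k) (phi p.1) (phi p.2) j + arg_diff p.
  by rewrite /mixed_phase /arg_diff natrD; ring.
have -> : j%:R * phi p.1 + -1 * p.1 + (k%:R * phi p.2 + - -1 * p.2) = mixed_phase (j + k) (phi p.1) (phi p.2) j - arg_diff p.
  by rewrite /mixed_phase /arg_diff natrD; ring.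
by rewrite cosD sinD cosB sinB /wave_cos; field.
Qed.

Lemma fourier_sqr_eq0 s k : fourier_sqr phi s k = 0 -> fourier_cos phi s k = 0 /\ fourier_sin phi s k = 0.
Proof.
by move/eqP; rewrite /fourier_sqr paddr_eq0 ?sqr_ge0// !sqrf_eq0 => /andP[/eqP -> /eqP ->].
Qed.

(** The integral of e^(it) over a period is 0; hence the least indices in [least_neq0] are
    positive. *)
Lemma fourier_sqr_0 (s : R) : s ^+ 2 = 1 -> fourier_sqr phi s 0 = 0.
Proof.
move=> s2; have [->|->] : s = 1 \/ s = -1.
  by move/eqP: s2; rewrite sqrf_eq1 => /orP[] /eqP; tauto.
  rewrite /fourier_sqr /fourier_cos /fourier_sin /Ic /Is.
  have e (t : R) : 0%:R * phi t + 1 * t = 1%:R * t + 0 by ring.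
  under eq_I1 do rewrite e; rewrite I1_cos_lin//.
  by under eq_I1 do rewrite e; rewrite I1_sin_lin// expr0n addr0.
rewrite /fourier_sqr /fourier_cos /fourier_sin.
have e : (fun t : R => 0%:R * phi t + -1 * t) = (fun t => - (1%:R * t + 0)) by apply/funext => t; ring.
rewrite e IcN IsN; last by apply: measurable_funTS; exact: continuous_measurable_fun (@continuous_lin R 1%:R 0).
by rewrite /Ic /Is I1_cos_lin// I1_sin_lin// oppr0 expr0n addr0.
Qed.

Section Least.
Context (a b : nat).
Context (Aa : fourier_sqr phi 1 a != 0).
Context (Bb : fourier_sqr phi (-1) b != 0).
Context (Alt : forall i, (i < a)%N -> fourier_sqr phi 1 i = 0).
Context (Blt : forall i, (i < b)%N -> fourier_sqr phi (-1) i = 0).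

Let r := ReZ 1 a b.
Let q := - ImZ 1 a b.

Lemma ReZC j k : ReZ (-1) j k = ReZ 1 k j.
Proof. by rewrite /ReZ opprK; ring. Qed.

Lemma ImZC j k : ImZ (-1) j k = ImZ 1 k j.
Proof. by rewrite /ImZ opprK; ring. Qed.

(** Either j < a or k < b, so one factor vanishes by minimality. *)
Lemma Z_offdiag j k : (j + k = a + b)%N -> j <> a -> ReZ 1 j k = 0 /\ ImZ 1 j k = 0.
Proof.
move=> jk ja; rewrite /ReZ /ImZ; have [lt|ge] := ltnP j a.
  by have [-> ->] := fourier_sqr_eq0 (Alt lt); rewrite !mul0r subrr addr0.
have kb : (k < b)%N by move: ja jk ge; lia.
by have [-> ->] := fourier_sqr_eq0 (Blt kb); rewrite !mulr0 subrr addr0.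
Qed.

Definition mixed_moment j := I2 (fun p => wave_cos r q (mixed_phase (a + b) (phi p.1) (phi p.2) j) * cos (arg_diff p)).

(** Zero off the pair (a, b), and |A_a B_b|^2 at it by the choice of [r] and [q]. *)
Lemma mixed_moment_term j k : (j + k = a + b)%N -> 0 <= r * ReZ 1 j k - q * ImZ 1 j k.
Proof.
move=> jk; have [ja|ja] := eqVneq j a.
  have kb : k = b by move: jk ja; lia.
  by rewrite ja kb /q mulNr opprK -!expr2 addr_ge0// sqr_ge0.
by have [-> ->] := Z_offdiag jk (elimN eqP ja); rewrite !mulr0 subrr.
Qed.

Lemma mixed_moment_ge0 j : (j <= a + b)%N -> 0 <= mixed_moment j.
Proof.
move=> jn; have e : (j + (a + b - j) = a + b)%N by rewrite subnKC.
rewrite /mixed_moment -e I2_wave_cos ReZC ImZC.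
have h1 := mixed_moment_term e; have h2 := mixed_moment_term (etrans (addnC _ _) e).
lra.
Qed.

Lemma mixed_moment_gt0 : 0 < mixed_moment a.
Proof.
rewrite /mixed_moment I2_wave_cos ReZC ImZC.
have h2 := mixed_moment_term (addnC b a).
have : 0 < r * ReZ 1 a b - q * ImZ 1 a b.
  rewrite -/r /q mulNr opprK -!expr2.
  have -> : r ^+ 2 + ImZ 1 a b ^+ 2 = fourier_sqr phi 1 a * fourier_sqr phi (-1) b.
    by rewrite /r /ReZ /ImZ /fourier_sqr; ring.
  by rewrite mulr_gt0// lt_neqAle fourier_sqr_ge0 eq_sym ?Aa ?Bb.
lra.
Qed.

Lemma vfield_moment_gt0 : (0 < a)%N -> (0 < b)%N -> 0 < I2 (vfield_moment r q (a + b) phi).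
Proof.
move=> a0 b0.
have bW j : bmeas circ2 (fun p => wave_cos r q (mixed_phase (a + b) (phi p.1) (phi p.2) j) * cos (arg_diff p)).
  by apply: bmeasM; [exact: bmeas_wave_cos|exact: bmeas_cos_arg_diff].
have -> : I2 (vfield_moment r q (a + b) phi) = 2^-1 * \sum_(j < a + b) (mixed_moment j.+1 + mixed_moment j).
  transitivity (2^-1 * I2 (fun p => \sum_(j < a + b) (wave_cos r q (mixed_phase (a + b) (phi p.1) (phi p.2) j.+1) * cos (arg_diff p) +
     wave_cos r q (mixed_phase (a + b) (phi p.1) (phi p.2) j) * cos (arg_diff p)))).
    rewrite -I2Z; last by apply: bmeas_sum => j; exact: bmeasD.
    apply: eq_I2 => p _; rewrite /vfield_moment /vfield_quot -mulrA; congr (_ * _).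
    by rewrite mulr_suml; apply: eq_bigr => j _; rewrite mulrDl.
  congr (_ * _).
  rewrite (@I2_sum R (a + b) (fun j p => wave_cos r q (mixed_phase (a + b) (phi p.1) (phi p.2) j.+1) * cos (arg_diff p) +
     wave_cos r q (mixed_phase (a + b) (phi p.1) (phi p.2) j) * cos (arg_diff p))); last by move=> j; exact: bmeasD.
  by apply: eq_bigr => j _; rewrite I2D.
rewrite mulr_gt0//.
(* Since b > 0 the index [a] occurs in the sum over j < a + b. *)
have an : (a < a + b)%N by rewrite -[ltnLHS]addn0 ltn_add2l.
rewrite (bigD1 (Ordinal an))//=.
have h1 := mixed_moment_gt0; have h2 := mixed_moment_ge0 an.
have : 0 <= \sum_(i < a + b | i != Ordinal an) (mixed_moment i.+1 + mixed_moment i).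
  by apply: sumr_ge0 => i _; apply: addr_ge0; apply: mixed_moment_ge0; [exact: ltn_ord|exact/ltnW/ltn_ord].
lra.
Qed.
End Least.

Lemma least_neq0 (s : R) : s ^+ 2 = 1 -> (exists k, fourier_sqr phi s k.+1 != 0) ->
  exists2 a, (0 < a)%N & fourier_sqr phi s a != 0 /\ forall i, (i < a)%N -> fourier_sqr phi s i = 0.
Proof.
move=> s2 [k hk]; have ex : exists k, fourier_sqr phi s k != 0 by exists k.+1.
have amin := ex_minnP ex; case: amin => a ha hmin; exists a.
  by rewrite lt0n; apply/eqP => a0; move: ha; rewrite a0 fourier_sqr_0// eqxx.
split => // i ia; apply/eqP; apply: contraTT isT => hi.
by have := hmin _ hi; rewrite leqNgt ia.
Qed.

Lemma descent : mu2.-integrable circ2 (EFin \o log_integrand phi) -> (exists k, fourier_sqr phi 1 k.+1 != 0) ->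
  exists (r q : R) (n : nat) (t0 d K : R), [/\ 0 < t0, 16 * t0 * vfield_bound r q n <= 1, 0 < d, 0 <= K &
    forall tau, 0 < tau <= t0 ->
      [/\ mu2.-integrable circ2 (EFin \o log_integrand (fun t => deform r q n tau (phi t))),
      log_energy (fun t => deform r q n tau (phi t)) < log_energy phi &
      `|log_energy (fun t => deform r q n tau (phi t)) - log_energy phi| <= K * tau]].
Proof.
move=> iL exA.
have [a a0 [Aa Alt]] := least_neq0 (expr1n R 2) exA.
have s2 : (-1) ^+ 2 = 1 :> R by rewrite sqrrN expr1n.
have [b b0 [Bb Blt]] := least_neq0 s2 (fourier_sqrN_neq0 lphi iL).
have d0 := vfield_moment_gt0 Aa Bb Alt Blt a0 b0.
set r := ReZ 1 a b in d0; set q := - ImZ 1 a b in d0; set n := (a + b)%N in d0.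
set d := I2 _ in d0.
have M1 := vfield_bound_ge1 r q n; set M := vfield_bound r q n in M1.
pose C := (2 * pi) ^+ 2 * (11 * M ^+ 2).
have C0 : 0 <= C by rewrite mulr_ge0 ?sqr_ge0// mulr_ge0 ?sqr_ge0.
(* The first bound is the range of [energy_variation]; the second keeps the error C tau^2 below the
   gain d tau. *)
pose t0 := Num.min (16 * M)^-1 (d / (C + 1) / 2).
have m16 : 0 < 16 * M by rewrite mulr_gt0//; lra.
have t00 : 0 < t0 by rewrite lt_min invr_gt0 m16 !divr_gt0//; lra.
have tM tau : tau <= t0 -> 16 * tau * M <= 1.
  rewrite le_min => /andP[h _]; rewrite mulrAC mulrC -ler_pdivlMr// div1r //.
(* As tau <= 1, the change C tau^2 + d tau is at most (C + d) tau. *)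
exists r, q, n, t0, d, (C + d); split => //; first exact: tM.
  by rewrite addr_ge0// ltW.
move=> tau /andP[tau0 taut].
have [iLt hE] := energy_variation lphi iL (ltW tau0) (tM _ taut).
move: hE; rewrite -/M -/C -/d => hE; split => //.
  have hC : C * tau < d.
    have : tau <= d / (C + 1) / 2 by move: taut; rewrite le_min => /andP[].
    rewrite -[_ / _ / 2]mulrAC ler_pdivlMr; last by lra.
    nra.
  have := ler_norm (log_energy (fun t => deform r q n tau (phi t)) - log_energy phi + tau * d).
  move=> h; have h2 := le_trans h hE; rewrite expr2 in h2; nra.
have -> : log_energy (fun t => deform r q n tau (phi t)) - log_energy phi =
  (log_energy (fun t => deform r q n tau (phi t)) - log_energy phi + tau * d) - tau * d by ring.
have tau1 : tau <= 1.
  have : tau <= (16 * M)^-1 by move: taut; rewrite le_min => /andP[].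
  move=> h; apply: (le_trans h); rewrite invf_le1//; lra.
apply: (le_trans (ler_normB _ _)); rewrite mulrDl; apply: lerD.
  apply: (le_trans hE); apply: ler_wpM2l => //.
  by rewrite expr2 ger_pMl.
have td : 0 <= tau * d by apply: mulr_ge0; exact: ltW.
by rewrite ger0_norm// mulrC.
Qed.

End Descent.

(** * Rigidity: lifts whose positive Fourier integrals vanish *)

Section Tools.
Context (R : realType).
Notation mu := (@lebesgue_measure R).
Notation mu2 := (mu \x mu)%E.
Implicit Types (p : R * R) (j n N : nat).

Lemma I1_swap (F : R * R -> R) : bmeas circ2 F ->
  I1 (fun x => I1 (fun y => F (x, y))) = I1 (fun y => I1 (fun x => F (x, y))).
Proof.
move=> bF; rewrite -I2_iter//.
have [mF [M FM]] := bF.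
pose G := F \_ circ2.
have mG : measurable_fun setT G.
  by apply/(measurable_restrictT _ measurable_circ2).
have GE x y : circ x -> circ y -> G (x, y) = F (x, y).
  by move=> Ix Iy; rewrite /G patchE mem_set.
have G0 x y : ~ (circ x /\ circ y) -> G (x, y) = 0.
  by move=> h; rewrite /G patchE memNset.
have iG : mu2.-integrable setT (EFin \o G).
  have := bmeas_circ2_int bF.
  move/(@integrable_mkcond _ _ R mu2 circ2 (EFin \o F) measurable_circ2).
  by apply: eq_integrable => // p _; rewrite /G/= !patchE; case: ifP.
transitivity (\int[mu2]_p G p); first by rewrite /I2 Rintegral_mkcond.
rewrite {1}/Rintegral.
have -> : (fun p => (G p)%:E) = EFin \o G by [].
rewrite -(integral21_prod_meas1 iG).
rewrite /I1 [RHS]Rintegral_mkcond /Rintegral; congr fine.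
apply: eq_integral => y _; rewrite /fubini_G patchE.
case: ifPn => [/set_mem Iy|/negP nIy]; last first.
  rewrite integral0_eq// => x _ /=; rewrite G0// => -[_ Iy].
  by apply: nIy; exact: mem_set.
have -> : (\int[mu]_x (EFin \o G) (x, y) = \int[mu]_(x in circ) (F (x, y))%:E)%E.
  rewrite [RHS]integral_mkcond; apply: eq_integral => x _; rewrite patchE /=.
  by case: ifPn => [/set_mem Ix|/negP nIx]; [rewrite GE|rewrite G0// => -[Ix _]; apply: nIx; exact: mem_set].
rewrite fineK//.
have bFx : bmeas circ (fun x => F (x, y)).
  split; last by exists M => x Ix; apply: FM.
  apply: (eq_measurable_fun (fun x => G (x, y))).
    by move=> x /set_mem Ix; rewrite GE.
  apply: measurable_funTS.
  exact: (measurable_fun_pair1 y mG).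
apply: integrable_fin_num; first exact: measurable_circ.
exact: bmeas_circ_int bFx.
Qed.

(** Compactness in near-covering form: a [d] that works near each point, for all small d > 0, can be
    chosen once for the segment. *)
Lemma segment_unif_continuous (f : R -> R) (a b e : R) : continuous f -> 0 < e ->
  exists2 d, 0 < d & forall x y, a <= x <= b -> `|x - y| < d -> `|f x - f y| < e.
Proof.
move=> cf e0.
pose P (d x : R) := forall y, `|x - y| < d -> `|f x - f y| < e.
have cK : near_covering (`[a, b]%classic : set R).
  by apply/compact_near_coveringP; exact: segment_compact.
have /= H := cK R (0^'+) P _ _.
have : \forall d \near 0^'+, `[a, b]%classic `<=` P d.
  apply: H => x _.
  have e2 : 0 < e / 2 by rewrite divr_gt0.
  have /cvgrPdist_lt/(_ _ e2)/nbhs_ballP[h /= h0 hball] := cf x.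
  have h2 : 0 < h / 2 by rewrite divr_gt0.
  exists (ball x (h / 2), [set d | d < h / 2]).
    split => /=; first by apply/nbhs_ballP; exists (h / 2).
    exact: nbhs_right_lt.
  move=> [x' d] /= [xx' dh] y yd.
  have e1 : `|f x - f x'| < e / 2 by apply: hball; rewrite /ball/= in xx' *; lra.
  have e3 : `|f x - f y| < e / 2.
    apply: hball; rewrite /ball/= in xx' *.
    have := ler_distD x' x y; lra.
  have := ler_distD (f x) (f x') (f y); rewrite (distrC (f x') (f x)); lra.
move=> Hn; have [d [Hd d0]] : exists d, `[a, b]%classic `<=` P d /\ 0 < d.
  near (0 : R)^'+ => d; exists d; split; first by near: d.
  by near: d; exact: nbhs_right_gt.
exists d => // x y xab; apply: Hd; by rewrite /= in_itv.
Unshelve. all: by end_near. Qed.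

(** This form of the modulus fits the Fejer kernel, whose product with 1 - cos u is bounded. Uniform
    continuity gives [e] for points that are close modulo 2 pi; for the others 1 - cos (x - y) >= 1
    - cos h, and the bound 2 M suffices. *)
Lemma periodic_modulus (f : R -> R) (e : R) : continuous f ->
  (forall x, f (x + 2 * pi) = f x) -> 0 < e ->
  exists2 C, 0 <= C & forall x y, circ x -> circ y -> `|f x - f y| <= e + C * (1 - cos (x - y)).
Proof.
move=> cf per e0; have p0 := pi_gt0 R.
have [d d0 Hd] := segment_unif_continuous (- (2 * pi)) (4 * pi) cf e0.
have [_ [M HM]] := bmeas_continuous cf.
have M0 : 0 <= M.
  apply: le_trans (normr_ge0 (f 0)) (HM 0 _).
  by rewrite /circ/= in_itv/= lexx/=; lra.
pose h := Num.min d pi.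
have h0 : 0 < h by rewrite lt_min d0.
have hpi : h <= pi by rewrite ge_min lexx orbT.
have hd : h <= d by rewrite ge_min lexx.
have ch : 0 < 1 - cos h.
  by rewrite subr_gt0 lt_neqAle cos_le1 andbT; apply: cos_neq1; lra.
exists (2 * M / (1 - cos h)); first by rewrite divr_ge0// ?mulr_ge0// ltW.
have C0 : 0 <= 2 * M / (1 - cos h) by rewrite divr_ge0// ?mulr_ge0// ltW.
suff key x y : circ x -> circ y -> y <= x -> `|f x - f y| <= e + 2 * M / (1 - cos h) * (1 - cos (x - y)).
  move=> x y Ix Iy; have [yx|/ltW xy] := leP y x; first exact: key.
  by rewrite distrC -(cosN (x - y)) opprB; exact: key.
rewrite /circ/= !in_itv/= => /andP[x0 x2] /andP[y0 y2] yx.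
have c0 : 0 <= 1 - cos (x - y) by rewrite subr_ge0 cos_le1.
have small : `|f x - f y| < e -> `|f x - f y| <= e + 2 * M / (1 - cos h) * (1 - cos (x - y)).
  by move=> /ltW h1; rewrite (le_trans h1)// lerDl mulr_ge0.
have [lt1|ge1] := ltP (x - y) h.
  apply: small; apply: Hd; first lra.
  by rewrite ger0_norm; lra.
(* Near a corner of the square [x] is close to [y + 2 * pi]. *)
have [lt2|ge2] := ltP (2 * pi - h) (x - y).
  apply: small; rewrite -(per y); apply: Hd; first lra.
  by rewrite ler0_norm; lra.
have cc : 1 - cos h <= 1 - cos (x - y).
  by rewrite lerB//; apply: cos_le_of_itv; lra.
have b1 : `|f x - f y| <= 2 * M.
  have := HM x; have := HM y; rewrite /circ/= !in_itv/= x0 y0 x2 y2 => /(_ isT) hy /(_ isT) hx.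
  by apply: (le_trans (ler_normB _ _)); lra.
apply: (le_trans b1); rewrite -[leLHS]add0r; apply: lerD; first exact: ltW.
by rewrite -mulrA ler_peMr ?mulr_ge0// mulrC ler_pdivlMr// mul1r.
Qed.

Lemma I1_eq0 (f : R -> R) : continuous f -> (forall x, circ x -> 0 <= f x) -> I1 f <= 0 ->
  forall x, circ x -> f x = 0.
Proof.
move=> cf f0 If x Ix; apply/eqP; rewrite eq_le f0// andbT leNgt; apply/negP => fx.
have p0 := pi_gt0 R.
have fx2 : 0 < f x / 2 by rewrite divr_gt0.
have /cvgrPdist_lt/(_ _ fx2)/nbhs_ballP[h /= h0 hball] := cf x.
move: (Ix); rewrite /circ/= in_itv/= => /andP[x0 x2].
pose a := Num.max 0 (x - h / 2); pose b := Num.min (2 * pi) (x + h / 2).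
have a0 : 0 <= a by rewrite le_max lexx.
have b2 : b <= 2 * pi by rewrite ge_min lexx.
have ax : x - h / 2 <= a by rewrite le_max lexx orbT.
have bx : b <= x + h / 2 by rewrite ge_min lexx orbT.
have ab : a < b by rewrite gt_max !lt_min; apply/andP; split; apply/andP; split; lra.
have sab : `[a, b]%classic `<=` (circ : set R).
  by move=> z /=; rewrite /circ/= !in_itv/= => /andP[za zb]; lra.
pose F := (cst (f x / 2) : R -> R) \_ `[a, b]%classic.
have mab : measurable (`[a, b]%classic : set R) by exact: measurable_itv.
have bF : bmeas circ F.
  split; first by apply: measurable_funTS; apply/(measurable_restrictT _ mab); exact: measurable_cst.
  by exists (f x / 2) => z _; rewrite /F patchE; case: ifP => _; rewrite ?normr0 ?ger0_norm// ltW.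
have IF : I1 F = f x / 2 * (b - a).
  rewrite /I1 /F -Rintegral_mkcondr setIidr// Rintegral_cst//.
  by rewrite [X in fine X]lebesgue_measure_itv/= lte_fin ab.
have : I1 F <= I1 f.
  apply: I1_le => //; first exact: bmeas_continuous.
  move=> z Iz; rewrite /F patchE; case: ifPn => [/set_mem/=|_]; last exact: f0.
  rewrite in_itv/= => /andP[za zb].
  have : `|f x - f z| < f x / 2 by apply: hball; rewrite /ball/= ltr_norml; lra.
  by rewrite ltr_norml => /andP[]; lra.
rewrite IF; have : 0 < f x / 2 * (b - a) by rewrite mulr_gt0// subr_gt0.
lra.
Qed.

End Tools.

(** * Fejer kernels, inverse lifts and integration by parts *)

Section Fejer.
Context (R : realType).
Notation mu := (@lebesgue_measure R).
Notation mu2 := (mu \x mu)%E.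
Implicit Types (p : R * R) (j k n N : nat).

Lemma exists_natS_ge (x : R) : exists N, x <= N.+1%:R.
Proof. by exists (Num.truncn x); apply/ltW/real_truncnS_gt; exact: num_real. Qed.

(** |\sum_(j<N) e^(iju)|^2, which is [N] times the Fejer kernel in its usual normalization. *)
Definition fejer N (u : R) :=
  (\sum_(j < N) cos (j%:R * u)) ^+ 2 + (\sum_(j < N) sin (j%:R * u)) ^+ 2.

Lemma fejer_ge0 N u : 0 <= fejer N u.
Proof. by rewrite addr_ge0// sqr_ge0. Qed.

Lemma fejer_sum N u : fejer N u = \sum_(j < N) \sum_(k < N) cos ((j%:R - k%:R) * u).
Proof.
rewrite /fejer !expr2 !mulr_suml -big_split/=; apply: eq_bigr => j _.
rewrite !mulr_sumr -big_split/=; apply: eq_bigr => k _.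
by rewrite mulrBl cosB.
Qed.

(** Squared modulus of (1 - e^(iu)) \sum_(j<N) e^(iju) = 1 - e^(iNu); [h1] and [h2] are the two
    parts of this equation. *)
Lemma fejer_mul N u : (1 - cos u) * fejer N u = 1 - cos (N%:R * u).
Proof.
have h1 : (\sum_(j < N) cos (j%:R * u)) * (1 - cos u) + (\sum_(j < N) sin (j%:R * u)) * sin u
    = 1 - cos (N%:R * u).
  elim: N => [|N ih]; first by rewrite !big_ord0 !mul0r cos0; ring.
  rewrite !big_ord_recr/= (_ : N.+1%:R * u = N%:R * u + u); last by rewrite -natr1; ring.
  rewrite cosD.
  transitivity (((\sum_(j < N) cos (j%:R * u)) * (1 - cos u) + (\sum_(j < N) sin (j%:R * u)) * sin u)
    + (cos (N%:R * u) * (1 - cos u) + sin (N%:R * u) * sin u)); first by ring.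
  by rewrite ih; ring.
have h2 : (\sum_(j < N) sin (j%:R * u)) * (1 - cos u) - (\sum_(j < N) cos (j%:R * u)) * sin u
    = - sin (N%:R * u).
  elim: N {h1} => [|N ih]; first by rewrite !big_ord0 !mul0r sin0; ring.
  rewrite !big_ord_recr/= (_ : N.+1%:R * u = N%:R * u + u); last by rewrite -natr1; ring.
  rewrite sinD.
  transitivity (((\sum_(j < N) sin (j%:R * u)) * (1 - cos u) - (\sum_(j < N) cos (j%:R * u)) * sin u)
    + (sin (N%:R * u) * (1 - cos u) - cos (N%:R * u) * sin u)); first by ring.
  by rewrite ih; ring.
rewrite /fejer; move: h1 h2; set A := \sum_(j < N) cos _; set B := \sum_(j < N) sin _ => h1 h2.
have e1 : (1 - cos u) ^+ 2 + sin u ^+ 2 = 2 * (1 - cos u) by rewrite sqr_cos_sin; ring.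
have e2 : (1 - cos (N%:R * u)) ^+ 2 + sin (N%:R * u) ^+ 2 = 2 * (1 - cos (N%:R * u)).
  by rewrite sqr_cos_sin; ring.
have e3 : (A ^+ 2 + B ^+ 2) * (2 * (1 - cos u)) = 2 * (1 - cos (N%:R * u)).
  rewrite -e1 -e2 -h1 -[sin (N%:R * u)]opprK -h2; ring.
lra.
Qed.

Lemma bmeas_cosk (c : R) : bmeas circ2 (fun p : R * R => cos (c * arg_diff p)).
Proof.
by apply: bmeas_cos; apply: measurable_funTS; apply: measurable_funM => //; exact: measurable_arg_diff.
Qed.

Lemma bmeas_fejer N : bmeas circ2 (fun p : R * R => fejer N (arg_diff p)).
Proof.
have -> : (fun p : R * R => fejer N (arg_diff p)) = (fun p => \sum_(j < N) \sum_(k < N) cos ((j%:R - k%:R) * arg_diff p)).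
  by apply/funext => p; rewrite fejer_sum.
by apply: bmeas_sum => j; apply: bmeas_sum => k; exact: bmeas_cosk.
Qed.

(** Of the N^2 frequencies j - k only the N with j = k survive. *)
Lemma I2_fejer N (V : R * R -> R) : bmeas circ2 V ->
  (forall k, (0 < k)%N -> I2 (fun p => cos (k%:R * arg_diff p) * V p) = 0) ->
  I2 (fun p => fejer N (arg_diff p) * V p) = N%:R * I2 V.
Proof.
move=> bV V0.
have bcV c := bmeasM (bmeas_cosk c) bV.
transitivity (I2 (fun p => \sum_(j < N) \sum_(k < N) cos ((j%:R - k%:R) * arg_diff p) * V p)).
  apply: eq_I2 => p _; rewrite fejer_sum mulr_suml; apply: eq_bigr => j _.
  by rewrite mulr_suml.
rewrite (@I2_sum R N (fun j p => \sum_(k < N) cos ((j%:R - k%:R) * arg_diff p) * V p)); last first.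
  by move=> j; apply: bmeas_sum.
transitivity (\sum_(j < N) I2 V); last by rewrite sumr_const card_ord mulr_natl.
apply: eq_bigr => j _.
rewrite (@I2_sum R N (fun k p => cos ((j%:R - k%:R) * arg_diff p) * V p))//.
rewrite (bigD1 j)//= big1 ?addr0; last first.
  move=> k kj; have [lt|gt|e] := ltngtP k j.
  - have := V0 (j - k)%N; rewrite subn_gt0 => /(_ lt) <-.
    by apply: eq_I2 => p _; rewrite natrB// ltnW.
  - have := V0 (k - j)%N; rewrite subn_gt0 => /(_ gt) <-.
    apply: eq_I2 => p _; rewrite natrB; last exact: ltnW.
    by rewrite -[in RHS]cosN -mulNr opprB.
  - by move: kj; rewrite -val_eqE /= e eqxx.
by apply: eq_I2 => p _; rewrite subrr mul0r cos0 mul1r.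
Qed.

Lemma I2_cosk_arg_diff k : (0 < k)%N -> I2 (fun p : R * R => cos (k%:R * arg_diff p)) = 0.
Proof.
move=> k0.
have m1 : measurable_fun circ (fun x : R => k%:R * x + 0).
  by apply: measurable_funTS; exact: continuous_measurable_fun (@continuous_lin R _ _).
have m2 : measurable_fun circ (fun x : R => - k%:R * x + 0).
  by apply: measurable_funTS; exact: continuous_measurable_fun (@continuous_lin R _ _).
transitivity (I2 (fun p : R * R => cos ((k%:R * p.1 + 0) + (- k%:R * p.2 + 0)))).
  by apply: eq_I2 => p _; congr cos; rewrite /arg_diff; ring.
by rewrite (I2_cos m1 m2) /Ic /Is I1_cos_lin// I1_sin_lin// !mul0r subrr.
Qed.

(* The Fejer kernel [fejer N] satisfies [(1 - cos u) * fejer N u <= 2], while its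
   mean is [N]; hence the bound on [V] near the diagonal suffices. *)
Lemma fejer_vanish (V : R * R -> R) : bmeas circ2 V ->
  (forall k, (0 < k)%N -> I2 (fun p => cos (k%:R * arg_diff p) * V p) = 0) ->
  (forall e, 0 < e -> exists2 C, 0 <= C & forall p, circ2 p -> `|V p| <= e + C * (1 - cos (arg_diff p))) ->
  I2 V = 0.
Proof.
move=> bV V0 HV; apply/eqP; rewrite -normr_le0; apply/ler_addgt0Pr => e e0; rewrite add0r.
have P0 : 0 < (2 * pi) ^+ 2 :> R by rewrite exprn_gt0// mulr_gt0// pi_gt0.
have e1 : 0 < e / (2 * pi) ^+ 2 / 2 by rewrite !divr_gt0.
have [C C0 HC] := HV _ e1.
set ee := _ / 2 in e1 HC.
(* Division by the order M of the kernel leaves e / 2 + 2 C (2 pi)^2 / M; this choice makes the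
   second summand at most e / 2. *)
have [N HN] := exists_natS_ge (4 * (2 * pi) ^+ 2 * C / e).
have bone := bmeas_cst (@circ2 R) (1 : R).
have h := I2_fejer N.+1 bV V0.
have h1 : I2 (fun p : R * R => fejer N.+1 (arg_diff p)) = N.+1%:R * (2 * pi) ^+ 2.
  rewrite -[(2 * pi) ^+ 2]mulr1 -I2c -(I2_fejer N.+1 bone).
    by apply: eq_I2 => p _; rewrite mulr1.
  by move=> k k0; under eq_I2 do rewrite mulr1; exact: I2_cosk_arg_diff.
have bF := bmeas_fejer N.+1.
have hb : `|I2 (fun p => fejer N.+1 (arg_diff p) * V p)| <= I2 (fun p : R * R => ee * fejer N.+1 (arg_diff p) + 2 * C).
  apply: norm_I2_le; first exact: bmeasM.
    by apply: bmeasD; [apply: bmeasM => //; exact: bmeas_cst|exact: bmeas_cst].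
  move=> p sp; rewrite normrM (ger0_norm (fejer_ge0 _ _)).
  have h2 := ler_wpM2l (fejer_ge0 N.+1 (arg_diff p)) (HC p sp).
  apply: (le_trans h2).
  rewrite mulrDr [fejer _ _ * ee]mulrC lerD2l mulrCA [fejer _ _ * _]mulrC fejer_mul mulrC.
  by apply: ler_wpM2r => //; have := cos_geN1 (N.+1%:R * arg_diff p); lra.
rewrite I2D in hb; [|by apply: bmeasM => //; exact: bmeas_cst|exact: bmeas_cst].
rewrite I2Z// h1 I2c h normrM (ger0_norm (_ : 0 <= N.+1%:R))// in hb.
have eeE : ee * (2 * pi) ^+ 2 = e / 2.
  by rewrite /ee; move: (lt0r_neq0 P0); set P := (2 * pi) ^+ 2 => Pn0; field.
have HN' : 4 * (2 * pi) ^+ 2 * C <= N.+1%:R * e by rewrite -ler_pdivrMr.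
have n0 : 0 < N.+1%:R :> R by [].
rewrite -(ler_pM2l n0); apply: (le_trans hb).
rewrite mulrCA eeE; move: n0 HN'; move: (N.+1%:R) => M; lra.
Qed.

Lemma lift_inv (phi : R -> R) : circle_lift phi ->
  exists psi, [/\ circle_lift psi, cancel phi psi & cancel psi phi].
Proof.
move=> [cphi inc per].
have perN (k : nat) t : phi (t + k%:R * (2 * pi)) = phi t + k%:R * (2 * pi).
  elim: k => [|k ih]; first by rewrite !mul0r !addr0.
  by rewrite -natr1 mulrDl mul1r addrA per ih addrA.
have p0 : 0 < 2 * pi :> R by rewrite mulr_gt0// pi_gt0.
have surj y : exists x, phi x = y.
  have [k Hk] := exists_natS_ge (`|y - phi 0| / (2 * pi)).
  rewrite ler_pdivrMr// ler_norml in Hk; case/andP: Hk => h1 h2.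
  have e1 := perN k.+1 0; have e2 := perN k.+1 (- (k.+1%:R * (2 * pi))); rewrite addNr add0r in e1 e2.
  have k0 : 0 <= k.+1%:R * (2 * pi) :> R by rewrite mulr_ge0// ltW.
  have [|||x _ <-] := @IVT R phi (- (k.+1%:R * (2 * pi))) (k.+1%:R * (2 * pi)) y; last by exists x.
  - lra.
  - exact: continuous_subspaceT.
  - by rewrite ge_min le_max; apply/andP; split; apply/orP; [left|right]; lra.
pose psi y := sval (cid (surj y)).
have psiK : cancel psi phi by move=> y; exact: (svalP (cid (surj y))).
have mono : {mono phi : x y / x < y}.
  move=> x y; apply/idP/idP => [|/inc//]; apply: contraTT; rewrite -!leNgt le_eqVlt.
  by move=> /predU1P[->//|/inc/ltW].
have phiK : cancel phi psi.
  move=> x; apply/eqP; rewrite eq_le !leNgt; apply/andP; split; apply/negP => /inc; by rewrite psiK ltxx.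
exists psi; split => //; split.
- move=> y; apply/cvgrPdist_lt => e e0.
  have h1 : phi (psi y - e) < y by rewrite -{2}(psiK y) mono; lra.
  have h2 : y < phi (psi y + e) by rewrite -{1}(psiK y) mono; lra.
  near=> z.
  have z1 : phi (psi y - e) < z by near: z; exact: lt_nbhsr.
  have z2 : z < phi (psi y + e) by near: z; exact: lt_nbhsl.
  rewrite -(psiK z) mono in z1; rewrite -(psiK z) mono in z2.
  by rewrite ltr_norml; apply/andP; split; lra.
- by move=> x y xy; rewrite -mono !psiK.
- by move=> t; rewrite -{1}(psiK t) -per phiK.
Unshelve. all: by end_near. Qed.

(* Integration by parts for the merely continuous [phi]: Fubini's theorem on the
   region [x <= phi t]. *)
Lemma young_parts (phi psi F f G g : R -> R) : circle_lift phi -> circle_lift psi ->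
  cancel phi psi -> cancel psi phi -> phi 0 = 0 ->
  (forall x : R, is_derive x 1 F (f x)) -> continuous f ->
  (forall x : R, is_derive x 1 G (g x)) -> continuous g ->
  I1 (fun t => F (phi t) * g t) + I1 (fun x => f x * G (psi x)) =
  F (2 * pi) * G (2 * pi) - F 0 * G 0.
Proof.
move=> lphi lpsi phiK psiK phi0 dF cf dG cg.
have [cphi incphi perphi] := lphi; have [cpsi incpsi _] := lpsi.
have cont H h : (forall x : R, is_derive x 1 H (h x)) -> continuous (H : R -> R).
  by move=> dH t; apply/differentiable_continuous/derivable1_diffP; case: (dH t).
have cF := cont _ _ dF; have cG := cont _ _ dG.
have psi0 : psi 0 = 0 by rewrite -{1}phi0 phiK.
have phi2 : phi (2 * pi) = 2 * pi by rewrite -[in LHS](add0r (2 * pi)) perphi phi0 add0r.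
have psi2 : psi (2 * pi) = 2 * pi by rewrite -{1}phi2 phiK.
have lemono (h : R -> R) : {homo h : x y / x < y} -> forall x y, x <= y -> h x <= h y.
  by move=> hh x y; rewrite le_eqVlt => /predU1P[->//|/hh/ltW].
have phile := lemono _ incphi; have psile := lemono _ incpsi.
pose S : set (R * R) := [set p | p.1 <= phi p.2].
have mS : measurable S.
  have -> : S = (fun p : R * R => phi p.2 - p.1) @^-1` `[0, +oo[%classic.
    by apply/seteqP; split => p /=; rewrite /S/= in_itv/= andbT subr_ge0.
  have mf : measurable_fun setT (fun p : R * R => phi p.2 - p.1).
    by apply: measurable_funB => //; exact: (measurableT_comp (measurable_lift lphi) measurable_snd).
  rewrite -[X in measurable X]setTI; apply: mf => //; exact: measurable_itv.
pose Ind p : R := \1_S p.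
have bInd : bmeas circ2 Ind.
  split; last by exists 1 => p _; rewrite /Ind indicE; case: (p \in S); rewrite ?normr0 ?normr1.
  by apply: measurable_funTS; apply: measurable_indic.
have bf := bmeas_continuous cf; have bg := bmeas_continuous cg.
have bH : bmeas circ2 (fun p => Ind p * (f p.1 * g p.2)).
  by apply: bmeasM => //; apply: bmeasM; [exact: bmeas_fst|exact: bmeas_snd].
have sw := I1_swap bH.
(* The region is read as x <= phi t here and as psi x <= t in [in2]; either inner integral is given
   by the fundamental theorem of calculus. *)
have in1 t : circ t -> I1 (fun x => Ind (x, t) * (f x * g t)) = (F (phi t) - F 0) * g t.
  rewrite /circ/= in_itv/= => /andP[t0 t2].
  have pt0 : 0 <= phi t by rewrite -phi0; exact: phile.
  have pt2 : phi t <= 2 * pi by rewrite -phi2; exact: phile.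
  rewrite -(Rintegral_FTC pt0 dF cf) -RintegralZr; last 2 first.
  - exact: measurable_itv.
  - apply: integrableS (bmeas_circ_int bf); [exact: measurable_circ|exact: measurable_itv|].
    by move=> x /=; rewrite /circ/= !in_itv/= => /andP[a b]; rewrite a (le_trans b).
  have -> : (`[0, phi t]%classic : set R) = circ `&` [set x | x <= phi t].
    apply/seteqP; split => x /=; rewrite /circ/= !in_itv/=.
      by move=> /andP[a b]; rewrite a b (le_trans b).
    by move=> [/andP[a _] b]; rewrite a.
  rewrite Rintegral_mkcondr; apply: eq_I1 => x _.
  rewrite patchE /Ind indicE; have [h|h] := boolP (x <= phi t).
    by rewrite !mem_set ?mul1r.
  by rewrite !memNset ?mul0r; [|exact/negP|exact/negP].
have in2 x : circ x -> I1 (fun t => Ind (x, t) * (f x * g t)) = f x * (G (2 * pi) - G (psi x)).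
  rewrite /circ/= in_itv/= => /andP[x0 x2].
  have px0 : 0 <= psi x by rewrite -psi0; exact: psile.
  have px2 : psi x <= 2 * pi by rewrite -psi2; exact: psile.
  rewrite -(Rintegral_FTC px2 dG cg) -RintegralZl; last 2 first.
  - exact: measurable_itv.
  - apply: integrableS (bmeas_circ_int bg); [exact: measurable_circ|exact: measurable_itv|].
    by move=> t /=; rewrite /circ/= !in_itv/= => /andP[a b]; rewrite b (le_trans px0).
  have -> : (`[psi x, 2 * pi]%classic : set R) = circ `&` [set t | x <= phi t].
    apply/seteqP; split => t /=; rewrite /circ/= !in_itv/=.
      move=> /andP[a b]; rewrite b (le_trans px0)//; split => //.
      by rewrite -(psiK x); exact: phile.
    by move=> [/andP[_ b] h]; rewrite b andbT -(phiK t); exact: psile.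
  rewrite Rintegral_mkcondr; apply: eq_I1 => t _.
  rewrite patchE /Ind indicE; have [h|h] := boolP (x <= phi t).
    by rewrite !mem_set ?mul1r.
  by rewrite !memNset ?mul0r; [|exact/negP|exact/negP].
have cFphi : continuous (F \o phi) by move=> t; exact: (cvg_comp _ _ (cphi t) (cF _)).
have cGpsi : continuous (G \o psi) by move=> t; exact: (cvg_comp _ _ (cpsi t) (cG _)).
have bFp : bmeas circ (fun t => F (phi t)) by exact: bmeas_continuous cFphi.
have bGp : bmeas circ (fun x => G (psi x)) by exact: bmeas_continuous cGpsi.
have e1 : I1 (fun t => (F (phi t) - F 0) * g t) = I1 (fun t => F (phi t) * g t) - F 0 * (G (2 * pi) - G 0).
  have Ig : I1 g = G (2 * pi) - G 0 by exact: (Rintegral_FTC (twopi_ge0 R) dG cg).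
  rewrite -Ig -(I1Z (F 0) bg) -(I1B (bmeasM bFp bg) (bmeasM (bmeas_cst circ (F 0)) bg)).
  by apply: eq_I1 => t _; rewrite /cst mulrBl.
have e2 : I1 (fun x => f x * (G (2 * pi) - G (psi x))) = (F (2 * pi) - F 0) * G (2 * pi) - I1 (fun x => f x * G (psi x)).
  have If : I1 f = F (2 * pi) - F 0 by exact: (Rintegral_FTC (twopi_ge0 R) dF cf).
  rewrite -If [I1 f * _]mulrC -(I1Z (G (2 * pi)) bf).
  rewrite -(I1B (bmeasM (bmeas_cst circ (G (2 * pi))) bf) (bmeasM bf bGp)).
  by apply: eq_I1 => t _; rewrite /cst mulrBr [G _ * _]mulrC.
have : I1 (fun t => (F (phi t) - F 0) * g t) = I1 (fun x => f x * (G (2 * pi) - G (psi x))).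
  transitivity (I1 (fun t => I1 (fun x => Ind (x, t) * (f x * g t)))).
    by apply: eq_I1 => t It; rewrite in1.
  by rewrite -sw; apply: eq_I1 => x Ix; rewrite in2.
rewrite e1 e2; move: (I1 _) (I1 _) => x y; lra.
Qed.

End Fejer.

(** * Multiplicativity of means for functions without negative frequencies *)

Section Rigidity.
Context (R : realType).
Notation mu := (@lebesgue_measure R).
Notation mu2 := (mu \x mu)%E.
Implicit Types (p : R * R) (j k n N : nat).

Lemma circle_polar (x y : R) : x ^+ 2 + y ^+ 2 = 1 ->
  exists2 t, 0 <= t <= 2 * pi & x = cos t /\ y = sin t.
Proof.
move=> xy; have p0 := pi_gt0 R.
have x1 : -1 <= x <= 1 by have y2 := sqr_ge0 y; apply/andP; split; nra.
have h1 := acos_ge0 x1; have h2 := acos_lepi x1.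
have hc : cos (acos x) = x by apply: acosK; rewrite in_itv.
have hs : sin (acos x) = `|y|.
  by rewrite sin_acos// -sqrtr_sqr; congr Num.sqrt; lra.
have [y0|y0] := leP 0 y.
  by exists (acos x); [lra|rewrite hc hs ger0_norm].
exists (2 * pi - acos x); first lra.
have e : 2 * pi - acos x = - acos x + 1%:R * (2 * pi) by ring.
by rewrite e cos_per sin_per cosN sinN hc hs ltr0_norm// opprK.
Qed.

Lemma polar (x y : R) : exists r b, [/\ 0 <= r, x = r * cos b & y = r * sin b].
Proof.
pose s := x ^+ 2 + y ^+ 2.
have s0 : 0 <= s by rewrite addr_ge0// sqr_ge0.
have [e|ne] := eqVneq s 0.
  move/eqP: e; rewrite paddr_eq0 ?sqr_ge0// !sqrf_eq0 => /andP[/eqP -> /eqP ->].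
  by exists 0, 0; rewrite !mul0r.
have r0 : 0 < Num.sqrt s by rewrite sqrtr_gt0 lt_neqAle s0 eq_sym ne.
have [|t _ [hx hy]] := @circle_polar (x / Num.sqrt s) (y / Num.sqrt s).
  by rewrite !exprMn !exprVn sqr_sqrtr// -mulrDl mulfV.
exists (Num.sqrt s), t; rewrite -hx -hy; split; first exact: ltW.
  by rewrite mulrCA mulfV ?mulr1// gt_eqF.
by rewrite mulrCA mulfV ?mulr1// gt_eqF.
Qed.

(* [hardy a]: the Fourier coefficients of negative index of [e^(i a)] vanish. *)
Definition hardy (a : R -> R) := forall k, (0 < k)%N ->
  Ic (fun x => a x + k%:R * x) = 0 /\ Is (fun x => a x + k%:R * x) = 0.

Lemma measurable_circ_cont (a : R -> R) : continuous a -> measurable_fun circ a.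
Proof. by move=> ca; apply: measurable_funTS; exact: continuous_measurable_fun. Qed.

Lemma continuous_addlin (a : R -> R) (c : R) : continuous a -> continuous (fun x => a x + c * x).
Proof.
move=> ca x; apply: cvgD; first exact: ca.
by apply: cvgM; [exact: cvg_cst|exact: cvg_id].
Qed.

Lemma I2_cos_split (a b : R -> R) (k : R) : continuous a -> continuous b ->
  I2 (fun p => cos (k * arg_diff p) * cos (a p.1 + b p.2)) =
  2^-1 * (Ic (fun x => a x + k * x) * Ic (fun x => b x + - k * x) -
          Is (fun x => a x + k * x) * Is (fun x => b x + - k * x) +
         (Ic (fun x => a x + - k * x) * Ic (fun x => b x + k * x) -
          Is (fun x => a x + - k * x) * Is (fun x => b x + k * x))).
Proof.
move=> ca cb.
have ma c := measurable_circ_cont (@continuous_addlin a c ca).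
have mb c := measurable_circ_cont (@continuous_addlin b c cb).
rewrite -(I2_cos (ma k) (mb (- k))) -(I2_cos (ma (- k)) (mb k)).
have bc (c d : R) : bmeas circ2 (fun p => cos ((a p.1 + c * p.1) + (b p.2 + d * p.2))).
  apply: bmeas_cos; apply: measurable_funD.
    have [h _] := bmeas_fst (bmeas_continuous (@continuous_addlin a c ca)); exact: h.
  have [h _] := bmeas_snd (bmeas_continuous (@continuous_addlin b d cb)); exact: h.
rewrite -(I2D (bc k (- k)) (bc (- k) k)) -(I2Z _ (bmeasD (bc k (- k)) (bc (- k) k))).
apply: eq_I2 => p _; rewrite /arg_diff.
rewrite (_ : a p.1 + k * p.1 + (b p.2 + - k * p.2) = (a p.1 + b p.2) + k * (p.1 - p.2)); last by ring.
rewrite (_ : a p.1 + - k * p.1 + (b p.2 + k * p.2) = (a p.1 + b p.2) - k * (p.1 - p.2)); last by ring.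
by move: (a p.1 + b p.2) (k * _) => x y; rewrite cosD cosB; field.
Qed.

Lemma Ic_lin k (s : R) : s ^+ 2 = 1 -> (0 < k)%N ->
  Ic (fun x : R => 0 + s * k%:R * x) = 0 /\ Is (fun x : R => 0 + s * k%:R * x) = 0.
Proof.
move=> s2 k0; have [->|->] : s = 1 \/ s = -1.
  by move/eqP: s2; rewrite sqrf_eq1 => /orP[] /eqP; tauto.
  have e : (fun x : R => 0 + 1 * k%:R * x) = (fun x => k%:R * x + 0) by apply/funext => x; ring.
  by rewrite e /Ic /Is I1_cos_lin// I1_sin_lin.
have e : (fun x : R => 0 + -1 * k%:R * x) = (fun x => - (k%:R * x + 0)) by apply/funext => x; ring.
rewrite e IcN IsN; last by apply: measurable_circ_cont; exact: continuous_lin.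
by rewrite /Ic /Is I1_cos_lin// I1_sin_lin// oppr0.
Qed.

(** [V] is the real part of e^(i a x) (e^(i psi y) - e^(i psi x)), so it vanishes on the diagonal.
    Against cos (k (x - y)), k > 0, every separated product has a zero factor: a coefficient of
    index -k for the first term, an integral of e^(iky) or its conjugate for the second.
    [fejer_vanish] then equates the two integrals. *)
Lemma hardy_mul_cos (a psi : R -> R) : continuous a -> circle_lift psi -> hardy a -> hardy psi ->
  2 * pi * Ic (fun x => a x + psi x) = Ic a * Ic psi - Is a * Is psi.
Proof.
move=> ca [cpsi _ per] Ha Hpsi.
have cap : continuous (fun x => a x + psi x) by move=> x; apply: cvgD; [exact: ca|exact: cpsi].
have c0 : continuous (cst 0 : R -> R) by move=> x; exact: cvg_cst.
pose V p := cos (a p.1 + psi p.2) - cos ((a p.1 + psi p.1) + cst 0 p.2).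
have b1 : bmeas circ2 (fun p => cos (a p.1 + psi p.2)).
  apply: bmeas_cos; apply: measurable_funD.
    by have [h _] := bmeas_fst (bmeas_continuous ca).
  by have [h _] := bmeas_snd (bmeas_continuous cpsi).
have b2 : bmeas circ2 (fun p => cos ((a p.1 + psi p.1) + cst 0 p.2)).
  apply: bmeas_cos; apply: measurable_funD; last exact: measurable_cst.
  by have [h _] := bmeas_fst (bmeas_continuous cap).
have bV : bmeas circ2 V by exact: bmeasB.
have V0 k : (0 < k)%N -> I2 (fun p => cos (k%:R * arg_diff p) * V p) = 0.
  move=> k0.
  transitivity (I2 (fun p => cos (k%:R * arg_diff p) * cos (a p.1 + psi p.2) -
      cos (k%:R * arg_diff p) * cos ((a p.1 + psi p.1) + cst 0 p.2))).
    by apply: eq_I2 => p _; rewrite mulrBr.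
  rewrite I2B; [|by apply: bmeasM => //; exact: bmeas_cosk|by apply: bmeasM => //; exact: bmeas_cosk].
  rewrite (I2_cos_split k%:R ca cpsi) (I2_cos_split k%:R cap c0).
  have [-> ->] := Ha k k0; have [-> ->] := Hpsi k k0.
  have [h1 h2] := Ic_lin (expr1n R 2) k0.
  have s2 : (-1) ^+ 2 = 1 :> R by rewrite sqrrN expr1n.
  have [h3 h4] := Ic_lin s2 k0.
  rewrite mul1r in h1 h2; rewrite mulN1r in h3 h4.
  by rewrite h1 h2 h3 h4 !mul0r !mulr0 !subr0 addr0 !mulr0 subrr.
have cc : continuous (fun x => cos (psi x)).
  by move=> x; exact: (cvg_comp _ _ (cpsi x) (@continuous_cos R _)).
have cs : continuous (fun x => sin (psi x)).
  by move=> x; exact: (cvg_comp _ _ (cpsi x) (@continuous_sin R _)).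
have pc x : cos (psi (x + 2 * pi)) = cos (psi x) by rewrite per -(cos_per 1 (psi x)) mul1r.
have ps x : sin (psi (x + 2 * pi)) = sin (psi x) by rewrite per -(sin_per 1 (psi x)) mul1r.
have V_0 : I2 V = 0.
  apply: fejer_vanish => // e e0; have e2 : 0 < e / 2 by rewrite divr_gt0.
  have [C1 C10 H1] := periodic_modulus cc pc e2.
  have [C2 C20 H2] := periodic_modulus cs ps e2.
  exists (C1 + C2); first exact: addr_ge0.
  move=> p [I1_ I2_]; have h1 := H1 _ _ I1_ I2_; have h2 := H2 _ _ I1_ I2_.
  rewrite -/(arg_diff p) in h1 h2; move: (arg_diff p) h1 h2 => D h1 h2.
  rewrite /V /cst addr0 !cosD.
  have -> : cos (a p.1) * cos (psi p.2) - sin (a p.1) * sin (psi p.2) -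
    (cos (a p.1) * cos (psi p.1) - sin (a p.1) * sin (psi p.1)) =
    sin (a p.1) * (sin (psi p.1) - sin (psi p.2)) - cos (a p.1) * (cos (psi p.1) - cos (psi p.2)) by ring.
  apply: (le_trans (ler_normB _ _)); rewrite !normrM.
  have hc := cos_max (a p.1); have hs := sin_max (a p.1).
  have g1 := ler_wpM2r (normr_ge0 (cos (psi p.1) - cos (psi p.2))) hc.
  have g2 := ler_wpM2r (normr_ge0 (sin (psi p.1) - sin (psi p.2))) hs.
  lra.
have := I2B b1 b2; rewrite -/V V_0.
rewrite (I2_cos (measurable_circ_cont ca) (measurable_circ_cont cpsi)).
rewrite (I2_cos (measurable_circ_cont cap) (measurable_circ_cont c0)).
have -> : Ic (cst 0 : R -> R) = 2 * pi by rewrite /Ic; under eq_I1 do rewrite cos0; rewrite I1c mulr1.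
have -> : Is (cst 0 : R -> R) = 0 by rewrite /Is; under eq_I1 do rewrite sin0; rewrite I1c mulr0.
rewrite mulr0 subr0; lra.
Qed.

(** The cosine case with [a] turned by pi / 2. *)
Lemma hardy_mul_sin (a psi : R -> R) : continuous a -> circle_lift psi -> hardy a -> hardy psi ->
  2 * pi * Is (fun x => a x + psi x) = Is a * Ic psi + Ic a * Is psi.
Proof.
move=> ca lpsi Ha Hpsi.
have sh (f : R -> R) : continuous f -> Ic (fun x => f x - pi / 2) = Is f /\ Is (fun x => f x - pi / 2) = - Ic f.
  move=> cf; split; first by apply: eq_I1 => x _; rewrite cosBpihalf.
  have bc : bmeas circ (fun x => cos (f x)) by apply: bmeas_cos; exact: measurable_circ_cont.
  by rewrite -[RHS]mulN1r /Ic -(I1Z _ bc); apply: eq_I1 => x _; rewrite sinBpihalf mulN1r.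
have ca' : continuous (fun x => a x - pi / 2) by move=> x; apply: cvgB; [exact: ca|exact: cvg_cst].
have Ha' : hardy (fun x => a x - pi / 2).
  move=> k k0; have [h1 h2] := Ha k k0.
  have [s1 s2] := sh _ (@continuous_addlin a k%:R ca).
  have e : (fun x => a x - pi / 2 + k%:R * x) = (fun x => a x + k%:R * x - pi / 2).
    by apply/funext => x; ring.
  by rewrite e s1 s2 h1 h2 oppr0.
have := hardy_mul_cos ca' lpsi Ha' Hpsi.
have [-> ->] := sh _ ca; rewrite mulNr opprK => <-; congr (_ * _).
by apply: eq_I1 => x _; rewrite addrAC cosBpihalf.
Qed.

Lemma hardy_shift (a : R -> R) k : hardy a -> hardy (fun x => a x + k%:R * x).
Proof.
move=> Ha j j0; have := Ha (k + j)%N; rewrite addn_gt0 j0 orbT => /(_ isT).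
have -> // : (fun x => a x + (k + j)%:R * x) = (fun x => a x + k%:R * x + j%:R * x).
by apply/funext => x; rewrite natrD; ring.
Qed.

(** With a = rho e^(i beta), the mean of the power n + 1 is a^(n+1), by multiplicativity. The same
    rule, applied after multiplication by e^(ikx), shows that the next power is again [hardy]: its
    coefficient of index -k is a product with a factor 0. *)
Lemma hardy_pow (psi : R -> R) (rho beta : R) : circle_lift psi -> hardy psi ->
  Ic psi = 2 * pi * (rho * cos beta) -> Is psi = 2 * pi * (rho * sin beta) ->
  forall n, [/\ hardy (fun x => n.+1%:R * psi x),
    Ic (fun x => n.+1%:R * psi x) = 2 * pi * (rho ^+ n.+1 * cos (n.+1%:R * beta)) &
    Is (fun x => n.+1%:R * psi x) = 2 * pi * (rho ^+ n.+1 * sin (n.+1%:R * beta))].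
Proof.
move=> lpsi Hpsi Ec Es; have p2 : 2 * pi != 0 :> R by rewrite mulf_neq0 ?gt_eqF ?pi_gt0.
have [cpsi _ _] := lpsi.
have cn n : continuous (fun x => n%:R * psi x).
  by move=> x; apply: cvgM; [exact: cvg_cst|exact: cpsi].
elim=> [|n [Hn En Fn]].
  have e : (fun x => 1%:R * psi x) = psi by apply/funext => x; rewrite mul1r.
  by rewrite e !mul1r !expr1.
have en : (fun x => n.+2%:R * psi x) = (fun x => n.+1%:R * psi x + psi x).
  by apply/funext => x; rewrite -[n.+2]addn1 natrD; ring.
have eb : n.+2%:R * beta = n.+1%:R * beta + beta by rewrite -[n.+2]addn1 natrD; ring.
split.
- move=> k k0; have [h1 h2] := Hn k k0.
  have ek : (fun x => n.+2%:R * psi x + k%:R * x) = (fun x => (n.+1%:R * psi x + k%:R * x) + psi x).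
    by apply/funext => x; rewrite -[n.+2]addn1 natrD; ring.
  have ca := @continuous_addlin _ k%:R (cn n.+1).
  have m1 := hardy_mul_cos ca lpsi (hardy_shift k Hn) Hpsi.
  have m2 := hardy_mul_sin ca lpsi (hardy_shift k Hn) Hpsi.
  rewrite h1 h2 !mul0r ?subrr ?addr0 in m1 m2.
  rewrite ek; split; apply: (mulfI p2); by rewrite mulr0.
- apply: (mulfI p2); rewrite en (hardy_mul_cos (cn n.+1) lpsi Hn Hpsi) En Fn Ec Es eb cosD [rho ^+ n.+2]exprSr.
  by ring.
- apply: (mulfI p2); rewrite en (hardy_mul_sin (cn n.+1) lpsi Hn Hpsi) En Fn Ec Es eb sinD [rho ^+ n.+2]exprSr.
  by ring.
Qed.

End Rigidity.

(** * Fourier coefficients of the inverse lift, of the lift and of the argument kernel *)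

Section Rigid.
Context (R : realType).
Notation mu := (@lebesgue_measure R).
Notation mu2 := (mu \x mu)%E.
Implicit Types (p : R * R) (j k n N : nat).

Lemma bmeas_cosl (a c : R) : bmeas circ (fun t : R => cos (a * t + c)).
Proof. exact: bmeas_continuous (@continuous_cosl R a c). Qed.

Lemma bmeas_sinl (a c : R) : bmeas circ (fun t : R => sin (a * t + c)).
Proof. exact: bmeas_continuous (@continuous_sinl R a c). Qed.

(** Integration by parts with F = e^(iKx) and G = e^(it) has no boundary contribution and gives A_K
    = - K times the integral of e^(i (psi x + K x)). [Y1] to [Y4] are the products of real and
    imaginary parts. *)
Lemma hardy_inverse (phi psi : R -> R) : circle_lift phi -> circle_lift psi ->
  cancel phi psi -> cancel psi phi -> phi 0 = 0 ->
  (forall k, fourier_sqr phi 1 k.+1 = 0) -> hardy psi.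
Proof.
move=> lphi lpsi phiK psiK phi0 A0 [//|k] _.
have [hc hs] := fourier_sqr_eq0 (A0 k).
pose K : R := k.+1%:R.
have K0 : K != 0 by rewrite pnatr_eq0.
have cosC := @is_derive_cosl R K 0; have sinC := @is_derive_sinl R K 0.
have dc (t : R) : is_derive t 1 (fun t : R => - cos t) (sin t).
  have h := is_deriveN (is_derive_cos t).
  by apply: (is_derive_eq h); rewrite opprK.
have cc := @continuous_cos R; have cs := @continuous_sin R.
have cms : continuous (fun x : R => - K * sin (K * x + 0)).
  by move=> x; apply: cvgM; [exact: cvg_cst|exact: continuous_sinl].
have cmc : continuous (fun x : R => K * cos (K * x + 0)).
  by move=> x; apply: cvgM; [exact: cvg_cst|exact: continuous_cosl].
have Y1 := young_parts lphi lpsi phiK psiK phi0 cosC cms (@is_derive_sin R) cc.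
have Y2 := young_parts lphi lpsi phiK psiK phi0 sinC cmc dc cs.
have Y3 := young_parts lphi lpsi phiK psiK phi0 sinC cmc (@is_derive_sin R) cc.
have Y4 := young_parts lphi lpsi phiK psiK phi0 cosC cms dc cs.
have e2 : K * (2 * pi) + 0 = 0 + k.+1%:R * (2 * pi) by rewrite addrC.
have e0 : K * 0 + 0 = 0 by rewrite mulr0 addr0.
have s2 : sin (2 * pi) = 0 :> R by have := sin_per 1 (0 : R); rewrite add0r mul1r sin0.
have c2 : cos (2 * pi) = 1 :> R by have := cos_per 1 (0 : R); rewrite add0r mul1r cos0.
rewrite e2 e0 cos_per ?sin_per sin0 cos0 s2 ?c2 in Y1.
rewrite e2 e0 sin_per sin0 cos0 ?s2 ?c2 in Y2.
rewrite e2 e0 sin_per sin0 s2 in Y3.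
rewrite e2 e0 cos_per cos0 c2 in Y4.
have [cphi _ _] := lphi; have [cpsi _ _] := lpsi.
have ccomp (f h : R -> R) : continuous f -> continuous h -> continuous (fun t => f (h t)).
  by move=> cf ch t; exact: (cvg_comp _ _ (ch t) (cf _)).
have bcp := bmeas_continuous (ccomp _ _ (@continuous_cosl R K 0) cphi).
have bsp := bmeas_continuous (ccomp _ _ (@continuous_sinl R K 0) cphi).
have bcs := bmeas_continuous (ccomp _ _ cc cpsi).
have bss := bmeas_continuous (ccomp _ _ cs cpsi).
have bc := bmeas_continuous cc; have bs := bmeas_continuous cs.
have bcx := bmeas_cosl K 0; have bsx := bmeas_sinl K 0.
have ec : fourier_cos phi 1 k.+1 = I1 (fun t => cos (K * phi t + 0) * cos t) - I1 (fun t => sin (K * phi t + 0) * sin t).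
  rewrite -(I1B (bmeasM bcp bc) (bmeasM bsp bs)); apply: eq_I1 => t _.
  by rewrite mul1r cosD addr0.
have es : fourier_sin phi 1 k.+1 = I1 (fun t => sin (K * phi t + 0) * cos t) + I1 (fun t => cos (K * phi t + 0) * sin t).
  rewrite -(I1D (bmeasM bsp bc) (bmeasM bcp bs)); apply: eq_I1 => t _.
  by rewrite mul1r sinD addr0.
have f1 : I1 (fun x => - K * sin (K * x + 0) * sin (psi x)) = - K * I1 (fun x => sin (K * x + 0) * sin (psi x)).
  by rewrite -(I1Z _ (bmeasM bsx bss)); apply: eq_I1 => x _; rewrite mulrA.
have f2 : I1 (fun x => K * cos (K * x + 0) * - cos (psi x)) = - K * I1 (fun x => cos (K * x + 0) * cos (psi x)).
  by rewrite -(I1Z _ (bmeasM bcx bcs)); apply: eq_I1 => x _; ring.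
have f3 : I1 (fun x => K * cos (K * x + 0) * sin (psi x)) = K * I1 (fun x => cos (K * x + 0) * sin (psi x)).
  by rewrite -(I1Z _ (bmeasM bcx bss)); apply: eq_I1 => x _; rewrite mulrA.
have f4 : I1 (fun x => - K * sin (K * x + 0) * - cos (psi x)) = K * I1 (fun x => sin (K * x + 0) * cos (psi x)).
  by rewrite -(I1Z _ (bmeasM bsx bcs)); apply: eq_I1 => x _; ring.
rewrite f1 in Y1; rewrite f2 in Y2; rewrite f3 in Y3; rewrite f4 in Y4.
have gc : Ic (fun x => psi x + k.+1%:R * x) =
    I1 (fun x => cos (K * x + 0) * cos (psi x)) - I1 (fun x => sin (K * x + 0) * sin (psi x)).
  rewrite -(I1B (bmeasM bcx bcs) (bmeasM bsx bss)); apply: eq_I1 => x _.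
  by rewrite addrC cosD addr0.
have gs : Is (fun x => psi x + k.+1%:R * x) =
    I1 (fun x => sin (K * x + 0) * cos (psi x)) + I1 (fun x => cos (K * x + 0) * sin (psi x)).
  rewrite -(I1D (bmeasM bsx bcs) (bmeasM bcx bss)); apply: eq_I1 => x _.
  by rewrite addrC sinD addr0.
by split; apply: (mulfI K0); rewrite mulr0 ?gc ?gs mulrBr || rewrite mulr0 gs mulrDr; lra.
Qed.

(* [young_parts] with [F = id]. *)
Lemma moment_lift (phi psi : R -> R) (n : nat) (c : R) : circle_lift phi -> circle_lift psi ->
  cancel phi psi -> cancel psi phi -> phi 0 = 0 ->
  n%:R * I1 (fun t => phi t * cos (n%:R * t + c)) = 2 * pi * sin c - I1 (fun x => sin (n%:R * psi x + c)).
Proof.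
move=> lphi lpsi phiK psiK phi0.
have cmc : continuous (fun x : R => n%:R * cos (n%:R * x + c)).
  by move=> x; apply: cvgM; [exact: cvg_cst|exact: continuous_cosl].
have c1 : continuous (cst 1 : R -> R) by move=> x; exact: cvg_cst.
have Y := young_parts lphi lpsi phiK psiK phi0 (fun x => is_derive_id x 1) c1 (@is_derive_sinl R n%:R c) cmc.
rewrite /= mul0r subr0 [n%:R * (2 * pi) + c]addrC sin_per in Y.
have bp := bmeasM (bmeas_continuous (let: And3 cphi _ _ := lphi in cphi)) (bmeas_cosl n%:R c).
rewrite -(I1Z _ bp).
have -> : I1 (fun t => n%:R * (phi t * cos (n%:R * t + c))) = I1 (fun t => phi t * (n%:R * cos (n%:R * t + c))).
  by apply: eq_I1 => t _; ring.
have -> : I1 (fun x => sin (n%:R * psi x + c)) = I1 (fun x => 1 * sin (n%:R * psi x + c)).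
  by apply: eq_I1 => t _; rewrite mul1r.
move: Y; rewrite /cst; lra.
Qed.

Lemma I1_sin_cos (m n : nat) (b c : R) : (0 < m)%N -> (0 < n)%N ->
  I1 (fun t => sin (m%:R * (t - b)) * cos (n%:R * t + c)) =
  if m == n then - pi * sin (n%:R * b + c) else 0.
Proof.
move=> m0 n0.
have -> : I1 (fun t => sin (m%:R * (t - b)) * cos (n%:R * t + c)) =
  2^-1 * (I1 (fun t => sin ((m + n)%:R * t + (c - m%:R * b))) + I1 (fun t => sin ((m%:R - n%:R) * t + (- c - m%:R * b)))).
  rewrite -(I1D (bmeas_sinl _ _) (bmeas_sinl _ _)) -I1Z; last by apply: bmeasD; exact: bmeas_sinl.
  apply: eq_I1 => t _.
  rewrite (_ : (m + n)%:R * t + (c - m%:R * b) = m%:R * (t - b) + (n%:R * t + c)); last by rewrite natrD; ring.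
  rewrite (_ : (m%:R - n%:R) * t + (- c - m%:R * b) = m%:R * (t - b) - (n%:R * t + c)); last by ring.
  by move: (m%:R * _) (n%:R * _ + c) => x y; rewrite sinD sinB; field.
rewrite I1_sin_lin ?addn_gt0 ?m0// add0r; have [->|mn] := eqVneq m n.
  rewrite subrr; under eq_I1 do rewrite mul0r add0r.
  by rewrite I1c (_ : - c - n%:R * b = - (n%:R * b + c)) ?sinN; [field|ring].
have [lt|gt|e] := ltngtP m n; last by rewrite e eqxx in mn.
  have e (t : R) : (m%:R - n%:R) * t + (- c - m%:R * b) = - ((n - m)%:R * t + (c + m%:R * b)).
    by rewrite natrB ?(ltnW lt)//; ring.
  have -> : I1 (fun t => sin ((m%:R - n%:R) * t + (- c - m%:R * b))) = -1 * I1 (fun t => sin ((n - m)%:R * t + (c + m%:R * b))).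
    by rewrite -(I1Z _ (bmeas_sinl _ _)); apply: eq_I1 => t _; rewrite e sinN mulN1r.
  by rewrite I1_sin_lin ?subn_gt0// !mulr0.
have e (t : R) : (m%:R - n%:R) * t + (- c - m%:R * b) = (m - n)%:R * t + (- c - m%:R * b).
  by rewrite natrB// ltnW.
by under eq_I1 do rewrite e; rewrite I1_sin_lin ?subn_gt0// mulr0.
Qed.

Lemma continuous_arg_kernel (r b : R) : 0 <= r < 1 -> continuous (fun t => arg_kernel r (t - b)).
Proof.
move=> r01 x; have c0 := rcos_lt1 (x - b) r01.
have hx : t - b @[t --> x] --> x - b by apply: cvgB; [exact: cvg_id|exact: cvg_cst].
have hs : sin (t - b) @[t --> x] --> sin (x - b) by exact: (cvg_comp _ _ hx (@continuous_sin R _)).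
have hc : cos (t - b) @[t --> x] --> cos (x - b) by exact: (cvg_comp _ _ hx (@continuous_cos R _)).
have h : (r * sin (t - b) / (1 - r * cos (t - b))) @[t --> x] --> r * sin (x - b) / (1 - r * cos (x - b)).
  apply: cvgM; first by apply: cvgM; [exact: cvg_cst|exact: hs].
  apply: cvgV; first by rewrite gt_eqF.
  by apply: cvgB; [exact: cvg_cst|apply: cvgM; [exact: cvg_cst|exact: hc]].
exact: (cvg_comp _ _ h (@continuous_atan R _)).
Qed.

(** Integration of the sine series term by term: orthogonality leaves the index n + 1, and the
    remainder is uniform in t. *)
Lemma arg_kernel_coef (r b c : R) (n : nat) : 0 <= r < 1 ->
  I1 (fun t => arg_kernel r (t - b) * cos (n.+1%:R * t + c)) = - (r ^+ n.+1 / n.+1%:R) * pi * sin (n.+1%:R * b + c).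
Proof.
move=> r01; apply/eqP; rewrite -subr_eq0 -normr_le0.
apply: (@geom_le _ _ _ (2 * pi * (2 / (1 - r) ^+ 2)) r r01).
exists n.+1 => // N /= nN.
pose q (t : R) := cos (n.+1%:R * t + c).
have bq : bmeas circ q by exact: bmeas_cosl.
have bw := bmeas_continuous (@continuous_arg_kernel r b r01).
have bsk k : bmeas circ (fun t : R => sin (k%:R * (t - b))).
  have e : (fun t : R => sin (k%:R * (t - b))) = (fun t => sin (k%:R * t + - (k%:R * b))).
    by apply/funext => t; rewrite mulrBr.
  by rewrite e; exact: bmeas_sinl.
have bterm k : bmeas circ (fun t => r ^+ k.+1 / k.+1%:R * (sin (k.+1%:R * (t - b)) * q t)).
  by apply: bmeasM; [exact: bmeas_cst|exact: bmeasM].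
have bS : bmeas circ (fun t => \sum_(k < N) r ^+ k.+1 / k.+1%:R * (sin (k.+1%:R * (t - b)) * q t)).
  by apply: bmeas_sum => k; exact: bterm.
have IS : I1 (fun t => \sum_(k < N) r ^+ k.+1 / k.+1%:R * (sin (k.+1%:R * (t - b)) * q t)) =
    - (r ^+ n.+1 / n.+1%:R) * pi * sin (n.+1%:R * b + c).
  transitivity (\sum_(k < N) I1 (fun t => r ^+ k.+1 / k.+1%:R * (sin (k.+1%:R * (t - b)) * q t))).
    elim: {nN bS} N => [|N ih].
      by rewrite big_ord0; under eq_I1 do rewrite big_ord0; rewrite I1c mulr0.
    rewrite big_ord_recr/= -ih -I1D//; last by apply: bmeas_sum => k; exact: bterm.
    by apply: eq_I1 => t _; rewrite big_ord_recr.
  rewrite (bigD1 (Ordinal nN))//= big1 ?addr0.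
    by rewrite I1Z ?I1_sin_cos ?eqxx//; [ring|exact: bmeasM].
  move=> k kn; rewrite I1Z ?I1_sin_cos//; last exact: bmeasM.
  by rewrite eqSS; move: kn; rewrite -val_eqE/= => /negbTE ->; rewrite mulr0.
rewrite add0r -IS -(I1B (bmeasM bw bq) bS).
have bD := bmeasB (bmeasM bw bq) bS.
have bound t : `|arg_kernel r (t - b) * q t - \sum_(k < N) r ^+ k.+1 / k.+1%:R * (sin (k.+1%:R * (t - b)) * q t)| <= 2 * r ^+ N / (1 - r) ^+ 2.
  have h := arg_kernel_series N (t - b) r01.
  have -> : \sum_(k < N) r ^+ k.+1 / k.+1%:R * (sin (k.+1%:R * (t - b)) * q t) =
     (\sum_(k < N) r ^+ k.+1 / k.+1%:R * sin ((t - b) *+ k.+1)) * q t.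
    by rewrite mulr_suml; apply: eq_bigr => k _; rewrite mulr_natl mulrA.
  rewrite -mulrBl normrM -[leRHS]mulr1; apply: ler_pM => //; exact: cos_max.
rewrite ler_norml -mulrA -I1c; apply/andP; split.
  rewrite -mulN1r -I1Z; last exact: bmeas_cst.
  apply: I1_le => //; first by apply: bmeasM; exact: bmeas_cst.
  by move=> t _; rewrite mulN1r; have := bound t; rewrite mulrAC ler_norml => /andP[].
apply: I1_le => //; first exact: bmeas_cst.
by move=> t _; have := bound t; rewrite mulrAC ler_norml => /andP[].
Qed.

End Rigid.

(** * Determination of the lifts whose A_k all vanish *)

Section LiftRigid.
Context (R : realType).
Notation mu := (@lebesgue_measure R).
Notation mu2 := (mu \x mu)%E.
Implicit Types (p : R * R) (j k n N : nat).

(** Uniqueness of Fourier coefficients through [fejer_vanish], applied to (D x - D y)^2. The result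
    2 pi \int D^2 = (\int D)^2 is the case of equality in Cauchy-Schwarz, so [D] equals its mean. *)
Lemma fourier_const (D : R -> R) : continuous D -> (forall x, D (x + 2 * pi) = D x) ->
  (forall n c, I1 (fun t => D t * cos (n.+1%:R * t + c)) = 0) ->
  exists m, forall x, circ x -> D x = m.
Proof.
move=> cD per D0; have p0 := pi_gt0 R.
have bD := bmeas_continuous cD; have bD2 := bmeasM bD bD.
have b1 := bmeas_fst bD; have b2 := bmeas_snd bD.
have b11 := bmeas_fst bD2; have b22 := bmeas_snd bD2; have b12 := bmeasM b1 b2.
pose V p := (D p.1 * D p.1 + D p.2 * D p.2) - 2 * (D p.1 * D p.2).
have b212 := bmeasM (bmeas_cst circ2 2) b12.
have bV : bmeas circ2 V by apply: bmeasB b212; exact: bmeasD.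
have Dsin n : I1 (fun t => D t * sin (n.+1%:R * t + 0)) = 0.
  transitivity (I1 (fun t => D t * cos (n.+1%:R * t + - (pi / 2)))); last exact: D0.
  by apply: eq_I1 => t _; rewrite addr0 cosBpihalf.
have V0 k : (0 < k)%N -> I2 (fun p => cos (k%:R * arg_diff p) * V p) = 0.
  case: k => // k _.
  have bc := bmeas_cosl k.+1%:R (0 : R); have bs := bmeas_sinl k.+1%:R (0 : R).
  pose c t : R := cos (k.+1%:R * t + 0); pose s t : R := sin (k.+1%:R * t + 0).
  have c0 : I1 c = 0 by exact: I1_cos_lin.
  have s0 : I1 s = 0 by exact: I1_sin_lin.
  have Dc : I1 (fun t => D t * c t) = 0 by exact: D0.
  have Ds : I1 (fun t => D t * s t) = 0 by exact: Dsin.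
  have bDc := bmeasM bD bc; have bDs := bmeasM bD bs.
  have bDDc := bmeasM bD2 bc; have bDDs := bmeasM bD2 bs.
  have q1 := bmeasM (bmeas_fst bDDc) (bmeas_snd bc).
  have q2 := bmeasM (bmeas_fst bDDs) (bmeas_snd bs).
  have q3 := bmeasM (bmeas_fst bc) (bmeas_snd bDDc).
  have q4 := bmeasM (bmeas_fst bs) (bmeas_snd bDDs).
  have q5 := bmeasM (bmeas_fst bDc) (bmeas_snd bDc).
  have q6 := bmeasM (bmeas_fst bDs) (bmeas_snd bDs).
  have q56 := bmeasM (bmeas_cst circ2 2) (bmeasD q5 q6).
  transitivity (I2 (fun p => ((D p.1 * D p.1 * c p.1) * c p.2 + (D p.1 * D p.1 * s p.1) * s p.2 +
      (c p.1 * (D p.2 * D p.2 * c p.2) + s p.1 * (D p.2 * D p.2 * s p.2))) -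
      2 * ((D p.1 * c p.1) * (D p.2 * c p.2) + (D p.1 * s p.1) * (D p.2 * s p.2)))).
    apply: eq_I2 => p _; rewrite /c /s /V.
    rewrite (_ : k.+1%:R * arg_diff p = (k.+1%:R * p.1 + 0) - (k.+1%:R * p.2 + 0)); last by rewrite /arg_diff; ring.
    by rewrite cosB; ring.
  have z1 := I2_sep bDDc bc; rewrite [X in _ = _ * X]c0 mulr0 in z1.
  have z2 := I2_sep bDDs bs; rewrite [X in _ = _ * X]s0 mulr0 in z2.
  have z3 := I2_sep bc bDDc; rewrite [X in _ = X * _]c0 mul0r in z3.
  have z4 := I2_sep bs bDDs; rewrite [X in _ = X * _]s0 mul0r in z4.
  have z5 := I2_sep bDc bDc; rewrite [X in _ = X * _]Dc mul0r in z5.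
  have z6 := I2_sep bDs bDs; rewrite [X in _ = X * _]Ds mul0r in z6.
  rewrite (I2B (bmeasD (bmeasD q1 q2) (bmeasD q3 q4)) q56) (I2D (bmeasD q1 q2) (bmeasD q3 q4)) (I2D q1 q2) (I2D q3 q4).
  rewrite (I2Z 2 (bmeasD q5 q6)) (I2D q5 q6).
  by rewrite [X in X + _ + _ - _]z1 z2 z3 z4 z5 z6 !addr0 mulr0 subrr.
have [_ [M HM]] := bD.
have M0 : 0 <= M.
  apply: le_trans (normr_ge0 (D 0)) (HM 0 _).
  by rewrite /circ/= in_itv/= lexx/=; lra.
have V_0 : I2 V = 0.
  apply: fejer_vanish => // e e0.
  have e1 : 0 < e / (2 * M + 1) by rewrite divr_gt0//; lra.
  have [C C0 HC] := periodic_modulus cD per e1.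
  exists (2 * M * C); first by rewrite !mulr_ge0.
  move=> p [Ia Ib]; have h := HC _ _ Ia Ib; rewrite -/(arg_diff p) in h.
  have -> : V p = (D p.1 - D p.2) ^+ 2 by rewrite /V; ring.
  have hb : `|D p.1 - D p.2| <= 2 * M.
    by apply: (le_trans (ler_normB _ _)); have := HM _ Ia; have := HM _ Ib; lra.
  rewrite normrX expr2.
  have h2 : `|D p.1 - D p.2| * `|D p.1 - D p.2| <= 2 * M * (e / (2 * M + 1) + C * (1 - cos (arg_diff p))).
    exact: ler_pM.
  have hM : 2 * M * (e / (2 * M + 1)) <= e by rewrite mulrA ler_pdivrMr; lra.
  by apply: (le_trans h2); rewrite mulrDr; apply: lerD => //; rewrite mulrA.
pose m := I1 D / (2 * pi); exists m.
have hI : 2 * pi * I1 (fun t => D t * D t) = I1 D * I1 D.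
  move: V_0; rewrite /V (I2B (bmeasD b11 b22) b212) (I2D b11 b22) (I2Z 2 b12) (I2_sep bD bD).
  have bone := bmeas_cst (@circ R) (1 : R).
  have -> : I2 (fun p => D p.1 * D p.1) = I1 (fun t => D t * D t) * (2 * pi).
    rewrite -[2 * pi]mulr1 -I1c -(I2_sep bD2 bone); apply: eq_I2 => p _; by rewrite mulr1.
  have -> : I2 (fun p => D p.2 * D p.2) = (2 * pi) * I1 (fun t => D t * D t).
    rewrite -[2 * pi]mulr1 -I1c -(I2_sep bone bD2); apply: eq_I2 => p _; by rewrite mul1r.
  lra.
have cf : continuous (fun x => (D x - m) * (D x - m)).
  by move=> x; apply: cvgM; (apply: cvgB; [exact: cD|exact: cvg_cst]).
have If : I1 (fun x => (D x - m) * (D x - m)) <= 0.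
  have -> : I1 (fun x => (D x - m) * (D x - m)) = I1 (fun t => D t * D t) - 2 * m * I1 D + 2 * pi * (m * m).
    rewrite -(I1Z _ bD) -I1c -(I1B bD2 (bmeasM (bmeas_cst circ (2 * m)) bD)).
    rewrite -(I1D (bmeasB bD2 (bmeasM (bmeas_cst circ (2 * m)) bD)) (bmeas_cst circ (m * m))).
    by apply: eq_I1 => x _; rewrite /cst; ring.
  have -> : I1 (fun t => D t * D t) = I1 D * I1 D / (2 * pi).
    by rewrite -hI [2 * pi * _]mulrC mulfK// mulf_neq0 ?gt_eqF.
  have p2 : 2 * pi != 0 :> R by rewrite mulf_neq0 ?gt_eqF.
  rewrite /m le_eqVlt; apply/orP; left; apply/eqP.
  by move: (2 * pi) p2 => P P0; field.
have f0 x : circ x -> 0 <= (D x - m) * (D x - m) by move=> _; rewrite -expr2 sqr_ge0.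
move=> x Ix; have /eqP := I1_eq0 cf f0 If Ix.
by rewrite mulf_eq0 orbb subr_eq0 => /eqP.
Qed.

(* All powers of [e^(i psi)], [psi] the inverse of [phi], have the mean of a power of
   [a = r e^(ib)]; these means are the Fourier coefficients of [phi - id], and those of
   [2 * arg_kernel r (t - b)] coincide with them. *)
Lemma lift_rigid0 (phi : R -> R) : circle_lift phi -> phi 0 = 0 ->
  (forall k, fourier_sqr phi 1 k.+1 = 0) ->
  exists r b c, 0 <= r < 1 /\ forall t, circ t -> phi t = t + 2 * arg_kernel r (t - b) + c.
Proof.
move=> lphi phi0 A0; have p0 := pi_gt0 R; have [cphi incphi perphi] := lphi.
have [psi [lpsi phiK psiK]] := lift_inv lphi.
have [cpsi _ _] := lpsi.
have Hpsi := hardy_inverse lphi lpsi phiK psiK phi0 A0.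
have [r [b [r0 ec es]]] := polar (Ic psi / (2 * pi)) (Is psi / (2 * pi)).
have p2 : 2 * pi != 0 :> R by rewrite mulf_neq0 ?gt_eqF.
have Ec : Ic psi = 2 * pi * (r * cos b) by rewrite -ec mulrCA mulfV ?mulr1.
have Es : Is psi = 2 * pi * (r * sin b) by rewrite -es mulrCA mulfV ?mulr1.
have bcp : bmeas circ (fun x => cos (psi x)) by apply: bmeas_cos; exact: measurable_circ_cont.
have bsp : bmeas circ (fun x => sin (psi x)) by apply: bmeas_sin; exact: measurable_circ_cont.
(* If r >= 1, the mean of cos (psi - b) is at least 1, so psi = b modulo 2 pi throughout; but [psi]
   takes both values 0 and pi. *)
have r1 : r < 1.
  rewrite ltNge; apply/negP => r1.
  have cf : continuous (fun x => 1 - cos (psi x - b)).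
    move=> x; apply: cvgB; first exact: cvg_cst.
    have h : psi y - b @[y --> x] --> psi x - b by apply: cvgB; [exact: cpsi|exact: cvg_cst].
    exact: (cvg_comp _ _ h (@continuous_cos R _)).
  have If : I1 (fun x => 1 - cos (psi x - b)) <= 0.
    have -> : I1 (fun x => 1 - cos (psi x - b)) = 2 * pi * 1 - (cos b * Ic psi + sin b * Is psi).
      have q1 := bmeasM (bmeas_cst circ (cos b)) bcp; have q2 := bmeasM (bmeas_cst circ (sin b)) bsp.
      rewrite /Ic /Is -(I1Z _ bcp) -(I1Z _ bsp) -(I1D q1 q2) -I1c -(I1B (bmeas_cst circ 1) (bmeasD q1 q2)).
      by apply: eq_I1 => x _; rewrite /cst cosB; ring.
    rewrite Ec Es.
    have -> : cos b * (2 * pi * (r * cos b)) + sin b * (2 * pi * (r * sin b)) = 2 * pi * r * (cos b ^+ 2 + sin b ^+ 2) by ring.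
    by rewrite cos2Dsin2; nra.
  have f0 x : circ x -> 0 <= 1 - cos (psi x - b) by move=> _; rewrite subr_ge0 cos_le1.
  have phi2 : phi (2 * pi) = 2 * pi by rewrite -[in LHS](add0r (2 * pi)) perphi phi0 add0r.
  have Ipi : circ (phi pi).
    rewrite /circ/= in_itv/= -{1}phi0 -phi2; apply/andP; split; apply: ltW; apply: incphi => //; lra.
  have I0 : circ (0 : R) by rewrite /circ/= in_itv/= lexx/=; lra.
  have psi0 : psi 0 = 0 by rewrite -{1}phi0 phiK.
  have h1 := I1_eq0 cf f0 If I0; have h2 := I1_eq0 cf f0 If Ipi.
  rewrite psi0 sub0r cosN in h1; rewrite phiK cosB cospi sinpi in h2; lra.
have r01 : 0 <= r < 1 by rewrite r0.
have Hpow := hardy_pow lpsi Hpsi Ec Es.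
pose D t := phi t - t - 2 * arg_kernel r (t - b).
have css := @continuous_arg_kernel R r b r01.
have cD : continuous D.
  move=> t; apply: cvgB; first by apply: cvgB; [exact: cphi|exact: cvg_id].
  by apply: cvgM; [exact: cvg_cst|exact: css].
have perD x : D (x + 2 * pi) = D x.
  have e : x + 2 * pi - b = x - b + 1%:R * (2 * pi) by ring.
  by rewrite /D perphi e /arg_kernel cos_per sin_per; ring.
have D0 n c : I1 (fun t => D t * cos (n.+1%:R * t + c)) = 0.
  have n0 : n.+1%:R != 0 :> R by rewrite pnatr_eq0.
  have m1 := moment_lift n.+1 c lphi lpsi phiK psiK phi0.
  have idK : cancel (@id R) id by [].
  (* The identity is its own inverse, and the terms 2 pi sin c cancel in the difference of [m1] and
     [m2]. *)
  have m2 := moment_lift n.+1 c (lift_id R) (lift_id R) idK idK erefl.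
  rewrite I1_sin_lin// subr0 in m2.
  have m3 := arg_kernel_coef b c n r01.
  have [_ en fn] := Hpow n.
  have s1 : I1 (fun x => sin (n.+1%:R * psi x + c)) = 2 * pi * (r ^+ n.+1 * sin (n.+1%:R * b + c)).
    have cn : continuous (fun x => n.+1%:R * psi x) by move=> x; apply: cvgM; [exact: cvg_cst|exact: cpsi].
    have q1 : bmeas circ (fun x => cos (n.+1%:R * psi x)) by apply: bmeas_cos; exact: measurable_circ_cont.
    have q2 : bmeas circ (fun x => sin (n.+1%:R * psi x)) by apply: bmeas_sin; exact: measurable_circ_cont.
    transitivity (cos c * Is (fun x => n.+1%:R * psi x) + sin c * Ic (fun x => n.+1%:R * psi x)).
      rewrite /Ic /Is -(I1Z _ q1) -(I1Z _ q2).
      rewrite -(I1D (bmeasM (bmeas_cst circ (cos c)) q2) (bmeasM (bmeas_cst circ (sin c)) q1)).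
      by apply: eq_I1 => x _; rewrite /cst sinD; ring.
    by rewrite en fn sinD; ring.
  rewrite s1 in m1.
  have bphi := bmeasM (bmeas_continuous cphi) (bmeas_cosl n.+1%:R c).
  have bid : bmeas circ (@id R) by apply: bmeas_continuous => x; exact: cvg_id.
  have bidc := bmeasM bid (bmeas_cosl n.+1%:R c).
  have bs := bmeasM (bmeas_continuous css) (bmeas_cosl n.+1%:R c).
  have b2s := bmeasM (bmeas_cst circ 2) bs.
  have -> : I1 (fun t => D t * cos (n.+1%:R * t + c)) =
     I1 (fun t => phi t * cos (n.+1%:R * t + c)) - I1 (fun t => t * cos (n.+1%:R * t + c)) -
     2 * I1 (fun t => arg_kernel r (t - b) * cos (n.+1%:R * t + c)).
    rewrite -(I1Z _ bs) -(I1B bphi bidc) -(I1B (bmeasB bphi bidc) b2s).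
    by apply: eq_I1 => t _; rewrite /D /cst; ring.
  apply: (mulfI n0); rewrite mulr0 !mulrBr m1 m2 m3.
  by field; rewrite nat1r pnatr_eq0.
have [m Hm] := fourier_const cD perD D0.
exists r, b, m; split => // t It; have := Hm t It; rewrite /D; lra.
Qed.

End LiftRigid.

(** * Maps of the circle *)

Section CircleMaps.
Context (R : realType).
Implicit Types (phi psi : R -> R) (w z : R[i]).

Lemma realC_gt0 (e : R[i]) : 0 < e -> exists2 r : R, 0 < r & e = r%:C.
Proof.
by case: e => a b; rewrite ltcE /= => /andP[/eqP b0 a0]; exists a => //; rewrite b0.
Qed.

Lemma normc_expiB (a b : R) : `|expi a - expi b| = (Num.sqrt (2 * (1 - cos (a - b))))%:C.
Proof.
rewrite normc_def /expi /=; congr (Num.sqrt _)%:C; rewrite cosB.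
have := cos2Dsin2 a; have := cos2Dsin2 b; lra.
Qed.

Lemma norm_expi (a : R) : `|expi a| = 1.
Proof. by rewrite normc_def /expi /= cos2Dsin2 sqrtr1. Qed.

Lemma circle_expi (a : R) : circle (expi a).
Proof. exact: norm_expi. Qed.

Lemma expiD (a b : R) : expi (a + b) = expi a * expi b.
Proof. by rewrite /expi cosD sinD; simpc; congr (_ +i* _); ring. Qed.

Lemma normc_expiB_le (a b e : R) : 0 < e -> `|a - b| <= e -> `|expi a - expi b| < (2 * e)%:C.
Proof.
move=> e0 ab; rewrite normc_expiB ltcR.
have h : 1 - cos (a - b) <= e ^+ 2.
  have := one_sub_cos_le (a - b) => h; apply: le_trans (ler_norm _) (le_trans h _).
  by rewrite -real_normK ?num_real// lerXn2r// ?nnegrE// ltW.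
have -> : 2 * e = Num.sqrt ((2 * e) ^+ 2) by rewrite sqrtr_sqr ger0_norm ?mulr_ge0// ltW.
rewrite ltr_sqrt ?exprn_gt0 ?mulr_gt0// exprMn.
have : 0 < e ^+ 2 by rewrite exprn_gt0.
lra.
Qed.

Lemma circle_arg w : circle w -> exists t, 0 <= t <= 2 * pi /\ w = expi t.
Proof.
case: w => x y; rewrite /circle/= normc_def/= => -[] h.
have xy : x ^+ 2 + y ^+ 2 = 1.
  by rewrite -(sqr_sqrtr (_ : 0 <= x ^+ 2 + y ^+ 2)) ?addr_ge0 ?sqr_ge0// h expr1n.
by have [t It [-> ->]] := circle_polar xy; exists t.
Qed.

Lemma expi_per (k : nat) (a : R) : expi (a + k%:R * (2 * pi)) = expi a.
Proof. by rewrite /expi cos_per sin_per. Qed.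

Lemma expi_inj_le (a b : R) : a <= b -> expi a = expi b -> exists k : nat, b = a + k%:R * (2 * pi).
Proof.
move=> ab [c s]; have p0 : 0 < 2 * pi :> R by rewrite mulr_gt0// pi_gt0.
have c1 : cos (b - a) = 1 by rewrite cosB c s -!expr2 cos2Dsin2.
have d0 : 0 <= (b - a) / (2 * pi) by rewrite divr_ge0 ?subr_ge0// ltW.
have /andP[] := truncn_itv d0; set k := Num.truncn _.
rewrite ler_pdivlMr// ltr_pdivrMr// => h1 h2; exists k.
move: h1; rewrite le_eqVlt => /predU1P[e|h1]; first by rewrite e; ring.
have : cos (b - a - k%:R * (2 * pi)) != 1.
  apply: cos_neq1; move: h2; rewrite -natr1 mulrDl mul1r => h2.
  by apply/andP; split; lra.
by rewrite -(cos_per k) subrK c1 eqxx.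
Qed.

Lemma lift_perN phi (k : nat) t : circle_lift phi -> phi (t + k%:R * (2 * pi)) = phi t + k%:R * (2 * pi).
Proof.
move=> [_ _ per]; elim: k => [|k ih]; first by rewrite !mul0r !addr0.
by rewrite -natr1 mulrDl mul1r addrA per ih addrA.
Qed.

Lemma lift_expi phi (a b : R) : circle_lift phi -> expi a = expi b -> expi (phi a) = expi (phi b).
Proof.
move=> lphi; wlog ab : a b / a <= b => [H|] e.
  by have [/H|/ltW/H] := leP a b; [exact|move=> h; rewrite h].
by have [k ->] := expi_inj_le ab e; rewrite lift_perN// expi_per.
Qed.

(** An arbitrary argument; by [lift_map_expi] the choice does not affect [lift_map]. *)
Definition argc w : R := xget 0 [set t | w = expi t].

Lemma argcK w : circle w -> w = expi (argc w).
Proof.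
move=> /circle_arg[t [_ wt]]; rewrite /argc.
by have := @xgetPex R 0 [set t | w = expi t]; apply; exists t.
Qed.

Definition lift_map phi w : R[i] := expi (phi (argc w)).

Lemma lift_map_expi phi t : circle_lift phi -> lift_map phi (expi t) = expi (phi t).
Proof. by move=> lphi; apply: lift_expi => //; rewrite -argcK//; exact: circle_expi. Qed.

(** Since [argc] need not be continuous, the continuity of [lift_map] is tested with an argument of
    [w] chosen near [t]. *)
Lemma expi_near (t d : R) : 0 < d -> exists2 e : R, 0 < e & forall w, circle w ->
  `|expi t - w| < e%:C -> exists2 s, w = expi s & `|t - s| < d.
Proof.
move=> d0; have p0 := pi_gt0 R.
pose h := Num.min d pi.
have h0 : 0 < h by rewrite lt_min d0.
have hpi : h <= pi by rewrite ge_min lexx orbT.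
have hd : h <= d by rewrite ge_min lexx.
have ch : 0 < 1 - cos h.
  by rewrite subr_gt0 lt_neqAle cos_le1 andbT; apply: cos_neq1; lra.
(* The chord of the angle [h]; a shorter chord has an angle less than [h] away from 0 modulo 2
   pi. *)
exists (Num.sqrt (2 * (1 - cos h))); first by rewrite sqrtr_gt0 mulr_gt0.
move=> w cw.
have [u [/andP[u0 u2] eu]] : exists u, 0 <= u <= 2 * pi /\ w = expi (t + u).
  have cz : circle (expi (- t) * w) by rewrite /circle/= normrM norm_expi mul1r.
  have [u [Iu e]] := circle_arg cz.
  by exists u; split => //; rewrite expiD -e mulrA -expiD subrr /expi cos0 sin0 mul1r.
rewrite eu normc_expiB ltcR ltr_sqrt ?mulr_gt0// ltr_pM2l// ltrD2l ltrN2.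
rewrite opprD addrA subrr add0r cosN => ch'.
have [lt|ge] := ltP u h.
  by exists (t + u) => //; rewrite opprD addrA subrr add0r normrN ger0_norm//; lra.
have [lt2|ge2] := ltP (2 * pi - h) u.
  exists (t + u - 2 * pi).
    by rewrite -(expi_per 1 (t + u - 2 * pi)) mul1r subrK.
  by rewrite (_ : _ - _ = 2 * pi - u) ?ger0_norm; [lra|lra|ring].
exfalso; move: ch'; apply/negP; rewrite -leNgt.
by apply: cos_le_of_itv; lra.
Qed.

Lemma lift_map_continuous phi : circle_lift phi -> {within @circle R, continuous (lift_map phi)}.
Proof.
move=> lphi; have [cphi _ _] := lphi.
apply/subspace_continuousP => w cw; apply/cvg_ballP => _/realC_gt0[e e0 ->].
rewrite (argcK cw); set t := argc w.
have e4 : 0 < e / 4 by rewrite divr_gt0.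
have /cvgrPdist_lt/(_ _ e4)/nbhs_ballP[d /= d0 hd] := cphi t.
have [e' e'0 He'] := expi_near t d0.
have ee : (0 : R[i]) < e'%:C by rewrite ltcR.
apply/nbhs_ballP; exists (e'%:C) => //= z zb cz.
have [s sz ts] := He' z cz zb.
change (is_true (`|lift_map phi (expi t) - lift_map phi z| < e%:C)); rewrite sz !lift_map_expi//; apply: lt_le_trans (normc_expiB_le e4 _) _.
  exact/ltW/hd.
by rewrite lecR; lra.
Qed.

Lemma lift_map_homeo phi : circle_lift phi -> circle_homeo (lift_map phi).
Proof.
move=> lphi; have [psi [lpsi phiK psiK]] := lift_inv lphi.
exists (lift_map psi); split.
- by split; [move=> w _; exact: circle_expi|exact: lift_map_continuous].
- by split; [move=> w _; exact: circle_expi|exact: lift_map_continuous].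
- by move=> w /argcK ->; rewrite !lift_map_expi// phiK.
- by move=> w /argcK ->; rewrite !lift_map_expi// psiK.
Qed.

(** The increment over a period is a positive multiple of 2 pi. Were it 4 pi or more,
    [phi s = phi t + 2 * pi] for some s strictly inside the period, against the injectivity of
    [g]. *)
Lemma homeo_lift g phi : circle_homeo g -> continuous phi -> {homo phi : x y / x < y} ->
  (forall t, g (expi t) = expi (phi t)) -> circle_lift phi.
Proof.
move=> [h [_ _ hg _]] cphi inc gphi; split => // t; have p0 := pi_gt0 R.
have inj a b : expi (phi a) = expi (phi b) -> expi a = expi b.
  move=> e; rewrite -(hg (expi a)); last exact: circle_expi.
  by rewrite gphi e -gphi hg//; exact: circle_expi.
have lt : phi t < phi (t + 2 * pi) by apply: inc; lra.
have e : expi (phi t) = expi (phi (t + 2 * pi)).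
  by rewrite -!gphi -(expi_per 1 t) mul1r.
have [k Hk] := expi_inj_le (ltW lt) e.
case: k Hk => [|[|k]] Hk; first by move: lt; rewrite Hk mul0r addr0 ltxx.
  by rewrite Hk mul1r.
exfalso.
have k0 : 0 <= k%:R * (2 * pi) :> R by rewrite mulr_ge0//; lra.
have Hk2 : phi (t + 2 * pi) = phi t + 2 * (2 * pi) + k%:R * (2 * pi).
  by rewrite Hk -[k.+2]addn2 natrD; ring.
have [|||s] := @IVT R phi t (t + 2 * pi) (phi t + 2 * pi).
- lra.
- exact: continuous_subspaceT.
- by rewrite ge_min le_max; apply/andP; split; apply/orP; [left|right]; lra.
rewrite in_itv/= => /andP[ts st] es.
have ts' : t < s by rewrite lt_neqAle ts andbT; apply/eqP => e1; move: es; rewrite e1; lra.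
have st' : s < t + 2 * pi by rewrite lt_neqAle st andbT; apply/eqP => e1; move: es; rewrite e1; lra.
have e1 : expi t = expi s.
  by apply: inj; rewrite es -(expi_per 1 (phi t)) mul1r.
have [j Hj] := expi_inj_le (ltW ts') e1.
case: j Hj => [|j] Hj; first by move: ts'; rewrite Hj mul0r addr0 ltxx.
have j0 : 0 <= j%:R * (2 * pi) :> R by rewrite mulr_ge0//; lra.
by move: st'; rewrite Hj -natr1 mulrDl mul1r; lra.
Qed.

Lemma uniform_circle_cvg (F : set_system R) (g : R -> R[i] -> R[i]) (f : R[i] -> R[i]) : Filter F ->
  (forall e : R, 0 < e -> \forall t \near F, forall w, circle w -> `|f w - g t w| < e%:C) ->
  {uniform @circle R, g @ F --> f}.
Proof.
move=> FF H P /uniform_nbhs[E [entE sub]].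
move: entE; rewrite -entourage_ballE => -[_/realC_gt0[e e0 ->] he].
apply: filterS (H e e0) => t Ht; apply: sub => w cw; apply: he => /=.
exact: Ht.
Qed.

(** [arg_kernel r u] is minus the argument of 1 - r e^(iu), so its double is the argument of the
    quotient of the conjugate by that number. *)
Lemma expi_double_arg_kernel (r u : R) : 0 <= r < 1 ->
  expi (2 * arg_kernel r u) * (1 - r%:C * expi u) = 1 - r%:C * expi (- u).
Proof.
move=> r01; have x0 := rcos_lt1 u r01; pose x := 1 - r * cos u; pose y := r * sin u.
have x1 : x != 0 by rewrite gt_eqF.
pose s := arg_kernel r u.
have ts : tan s = y / x by rewrite /s /arg_kernel atanK.
have ck : (cos s) ^+ 2 * (1 + (y / x) ^+ 2) = 1.
  rewrite /s /arg_kernel cos_atan exprVn sqr_sqrtr; last by rewrite addr_ge0// sqr_ge0.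
  by rewrite mulVf// gt_eqF// ltr_pwDl// sqr_ge0.
have cn0 : cos s != 0.
  by apply/eqP => c0; move: ck; rewrite c0 expr0n mul0r => /eqP; rewrite eq_sym oner_eq0.
have sE : sin s = cos s * (y / x) by rewrite -ts /tan mulrCA mulfV ?mulr1.
have c2 : cos (2 * s) = cos s ^+ 2 * (1 - (y / x) ^+ 2).
  by rewrite (_ : 2 * s = s + s) ?cosD ?sE; ring.
have s2 : sin (2 * s) = 2 * cos s ^+ 2 * (y / x).
  by rewrite (_ : 2 * s = s + s) ?sinD ?sE; ring.
rewrite /expi cosN sinN -/s c2 s2; simpc.
rewrite -/x -/y.
have ck' : cos s ^+ 2 = x ^+ 2 / (x ^+ 2 + y ^+ 2).
  have d0 : x ^+ 2 + y ^+ 2 != 0 by rewrite gt_eqF// ltr_pwDl ?exprn_gt0 ?sqr_ge0.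
  rewrite -[LHS]mulr1; apply: (mulIf (_ : 1 + (y / x) ^+ 2 != 0)).
    by rewrite gt_eqF// ltr_pwDl// sqr_ge0.
  by rewrite mulr1 ck; field; rewrite x1 d0.
have d0 : x ^+ 2 + y ^+ 2 != 0 by rewrite gt_eqF// ltr_pwDl ?exprn_gt0 ?sqr_ge0.
rewrite ck'; congr (_ +i* _); field; rewrite x1 d0 //.
Qed.

End CircleMaps.

(** Normalizing [phi 0 = 0] is a rotation, which changes no [fourier_sqr] and is absorbed in the
    unimodular factor. The kernel with parameters r and b gives the Moebius factor with a = r
    e^(ib). *)
Lemma rigid_mobius (R : realType) (phi : R -> R) (g : R[i] -> R[i]) :
  circle_lift phi -> (forall t, g (expi t) = expi (phi t)) ->
  (forall k, fourier_sqr phi 1 k.+1 = 0) -> mobius_boundary g.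
Proof.
move=> lphi gphi A0; pose phi0 t := phi t - phi 0.
have lphi0 : circle_lift phi0.
  have [c inc per] := lphi; split.
  - by move=> t; apply: cvgB; [exact: c|exact: cvg_cst].
  - by move=> x y xy; rewrite /phi0 ltrD2r inc.
  - by move=> t; rewrite /phi0 per; ring.
have A00 k : fourier_sqr phi0 1 k.+1 = 0.
  rewrite -fourier_sqrE// -(A0 k) -fourier_sqrE//; apply: eq_I2 => p _.
  by congr cos; rewrite /lift_diff /phi0; ring.
have phi00 : phi0 0 = 0 by rewrite /phi0 subrr.
have [r [b [c [r01 Hphi]]]] := lift_rigid0 lphi0 phi00 A00.
have /andP[r0 r1] := r01.
exists (expi (c + phi 0)), (r%:C * expi b); split.
- exact: norm_expi.
- by rewrite normrM norm_expi mulr1 ger0_norm ?lecR// ltcR.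
move=> w /circle_arg[t [It ->]]; rewrite gphi.
have -> : phi t = (c + phi 0) + (t + 2 * arg_kernel r (t - b)).
  have : phi0 t = t + 2 * arg_kernel r (t - b) + c by apply: Hphi; rewrite /circ/= in_itv.
  by rewrite /phi0; lra.
rewrite /mobius expiD; congr (_ * _).
have cj : (r%:C * expi b)^* = r%:C * expi (- b).
  by rewrite /expi cosN sinN; simpc.
have h1 : expi (- b) * expi t = expi (t - b) by rewrite -expiD addrC.
have h2 : expi t - r%:C * expi b = expi t * (1 - r%:C * expi (- (t - b))).
  by rewrite mulrBr mulr1 mulrCA -expiD opprB addrCA subrr addr0.
have ne : 1 - r%:C * expi (t - b) != 0.
  rewrite subr_eq0; apply/eqP => e; move: r1.
  have : `|r%:C * expi (t - b)| = 1 by rewrite -e normr1.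
  rewrite normrM norm_expi mulr1 ger0_norm ?lecR// => -[->].
  by rewrite ltxx.
by rewrite cj -mulrA h1 h2 -(expi_double_arg_kernel _ r01) expiD -mulrA mulfK.
Qed.

Theorem theorem5 (R : realType) (go : R[i] -> R[i])
  (go_homeo : circle_homeo go)
  (go_orient : orientation_preserving go)
  (go_energy : (conformal_energy go < +oo)%E)
  (go_not_mobius : ~ mobius_boundary go) :
  exists g : R -> R[i] -> R[i],
    (forall t, 0 <= t < 1 -> circle_homeo (g t)) /\
    [/\ {uniform @circle R, g @ 1^'- --> go},
        (forall t, 0 <= t < 1 ->
          (conformal_energy (g t) < conformal_energy go)%E) /\
        conformal_energy (g t) @[t --> 1^'-] --> conformal_energy go
      & exists b : R[i] -> R[i],
          mobius_boundary b /\ {uniform @circle R, g @ 0^'+ --> b}].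
Proof.
have [phi [cphi inc gphi]] := go_orient.
have lphi := homeo_lift go_homeo cphi inc gphi.
have iL := energy_lt_integrable lphi gphi go_energy.
have exA : exists k, fourier_sqr phi 1 k.+1 != 0.
  apply: contrapT => nex; apply: go_not_mobius; apply: (rigid_mobius lphi gphi) => k.
  by apply/eqP; apply: contrapT => h; apply: nex; exists k; apply/negP.
have [r [q [n [t0 [d [K [t00 tM d0 K0 Hd]]]]]]] := descent lphi iL exA.
have Ego := energyE gphi iL.
pose tau t := t0 * (1 - t).
pose phit t x := deform r q n (tau t) (phi x).
have half t : 2^-1 <= t < 1 -> 0 < tau t <= t0.
  move=> /andP[ta tb]; rewrite /tau mulr_gt0 ?subr_gt0//=.
  by rewrite -[leRHS]mulr1; apply: ler_wpM2l; [exact: ltW|lra].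
have M0 : 0 < vfield_bound r q n by have := vfield_bound_ge1 r q n; lra.
have lt_ t : 2^-1 <= t < 1 -> circle_lift (phit t).
  move=> /half/andP[ta tb]; apply: deform_lift => //; first exact: ltW.
  by apply: le_trans tM; apply: ler_wpM2r; [exact: ltW|apply: ler_wpM2l].
pose g t := if t < 2^-1 then id else lift_map (phit t).
have gE t : 2^-1 <= t -> g t = lift_map (phit t) by rewrite /g ltNge => ->.
have gid t : t < 2^-1 -> g t = id by rewrite /g => ->.
have Eid : conformal_energy (id : R[i] -> R[i]) = (energy_const R * log_energy (@id R))%:E.
  by apply: energyE => //; exact: log_integrand_id_int.
have Egt t : 2^-1 <= t < 1 -> conformal_energy (g t) = (energy_const R * log_energy (phit t))%:E.
  move=> ht; have [iLt _ _] := Hd _ (half _ ht).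
  rewrite gE; last by case/andP: ht.
  by apply: energyE => // s; apply: lift_map_expi; exact: lt_.
have ce0 := energy_const_gt0 R.
have id_homeo : circle_homeo (id : R[i] -> R[i]).
  have cid : {within @circle R, continuous (id : R[i] -> R[i])}.
    by apply: continuous_subspaceT => z; exact: cvg_id.
  by exists id; split => //; split.
have near1 : \forall t \near (1 : R)^'-, 2^-1 <= t < 1.
  near=> t; apply/andP; split; last by near: t; exact: nbhs_left_lt.
  by near: t; apply: nbhs_left_ge; lra.
have near0 : \forall t \near (0 : R)^'+, t < 2^-1.
  by near=> t; near: t; apply: nbhs_right_lt; lra.
exists g; split; first move=> t /andP[ta tb].
  have [mixed_phase|mixed_phase] := ltP t 2^-1; first by rewrite gid.
  by rewrite gE//; apply: lift_map_homeo; apply: lt_; rewrite mixed_phase.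
have tau_cvg : tau t @[t --> (1 : R)^'-] --> (0 : R).
  have -> : (0 : R) = t0 * (1 - 1) by rewrite subrr mulr0.
  apply: cvg_at_left_filter; apply: cvgM; first exact: cvg_cst.
  by apply: cvgB; [exact: cvg_cst|exact: cvg_id].
split.
- apply: uniform_circle_cvg => e e0.
  have e4 : 0 < e / 4 by rewrite divr_gt0.
  (* The sum |r| + |q| bounds the field; the added 1 makes it a legitimate divisor. *)
  have B0 : 0 < `|r| + `|q| + 1 by rewrite ltr_pwDr ?addr_ge0.
  have e5 : 0 < e / 4 / (`|r| + `|q| + 1) by rewrite divr_gt0.
  have /cvgrPdist_lt/(_ _ e5) Hn := tau_cvg.
  near=> t => w cw.
  have ht : 2^-1 <= t < 1 by near: t.
  have /andP[ta tb] := half _ ht.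
  have tsmall : tau t < e / 4 / (`|r| + `|q| + 1).
    have : `|0 - tau t| < e / 4 / (`|r| + `|q| + 1) by near: t.
    by rewrite sub0r normrN gtr0_norm.
  rewrite gE; last by case/andP: ht.
  rewrite (argcK cw) lift_map_expi; last exact: lt_.
  rewrite gphi; apply: lt_le_trans (normc_expiB_le e4 _) _; last by rewrite lecR; lra.
  rewrite /phit /deform opprD addrA subrr add0r normrN normrM (gtr0_norm ta).
  have vb x : `|vfield r q n x| <= `|r| + `|q| + 1.
    apply: (le_trans (ler_normD _ _)); rewrite !normrM.
    have h1 := ler_wpM2l (normr_ge0 r) (sin_max (n%:R * x)).
    have h2 := ler_wpM2l (normr_ge0 q) (cos_max (n%:R * x)).
    lra.
  rewrite ltr_pdivlMr// in tsmall; apply: le_trans (ltW tsmall).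
  by apply: ler_wpM2l; [exact: ltW|exact: vb].
- split.
    move=> t /andP[ta tb]; rewrite Ego.
    have [mixed_phase|mixed_phase] := ltP t 2^-1.
      rewrite gid// Eid lte_fin ltr_pM2l//; have [k Ak] := exA.
      have := energy_gap k lphi iL.
      have : 0 < fourier_sqr phi 1 k.+1 / k.+1%:R by rewrite divr_gt0// lt_neqAle fourier_sqr_ge0 eq_sym Ak.
      by move: (fourier_sqr phi 1 k.+1 / k.+1%:R) => x; lra.
    have ht : 2^-1 <= t < 1 by rewrite mixed_phase.
    have [_ lt12 _] := Hd _ (half _ ht).
    by rewrite Egt// lte_fin ltr_pM2l.
  rewrite Ego.
  have Ecvg : (energy_const R * log_energy (phit t)) @[t --> (1 : R)^'-] --> energy_const R * log_energy phi.
    apply: cvgM; first exact: cvg_cst.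
    apply/cvgrPdist_le => e e0.
    have K1 : 0 < K + 1 by lra.
    have e5 : 0 < e / (K + 1) by rewrite divr_gt0.
    have /cvgrPdist_lt/(_ _ e5) Hn := tau_cvg.
    near=> t.
    have ht : 2^-1 <= t < 1 by near: t.
    have /andP[ta tb] := half _ ht.
    have [_ _ hK] := Hd _ (half _ ht).
    have tsmall : tau t < e / (K + 1).
      have : `|0 - tau t| < e / (K + 1) by near: t.
      by rewrite sub0r normrN gtr0_norm.
    rewrite distrC; apply: (le_trans hK).
    by rewrite ltr_pdivlMr// in tsmall; lra.
  have hE : (energy_const R * log_energy (phit t))%:E @[t --> (1 : R)^'-] --> (energy_const R * log_energy phi)%:E.
    by apply: cvg_EFin; [exact: nearW|exact: Ecvg].
  apply: cvg_trans hE.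
  apply: near_eq_cvg; near=> t; rewrite /= Egt//.
  by near: t.
- exists id; split.
    exists 1, 0; rewrite normr1 normr0; split => // w _.
    by rewrite /mobius rmorph0 mul0r !subr0 divr1 mul1r.
  apply: uniform_circle_cvg => e e0; near=> t => w cw.
  rewrite gid; last by near: t.
  by rewrite subrr normr0 ltcR.
Unshelve. all: by end_near. Qed.
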